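(* Let $k$ be a field, $E=A\#_fH$ a crossed product with convolution invertible cocycle $f$, $M$ a right $E$-module and $N$ a left $E$-module. Then there is a convergent spectral sequence $$E^2_{rs}=H_r(H,\mathrm{Tor}^A_s(M,N))\ \Rightarrow\ \mathrm{Tor}^E_{r+s}(M,N).$$
   Context: $\otimes=\otimes_k$, $H$ is a Hopf $k$-algebra with counit $\epsilon$, antipode $S$ and Sweedler notation $\Delta(h)=h^{(1)}\otimes h^{(2)}$ (sum understood), $A$ is a $k$-algebra. A weak action of $H$ on $A$ is a bilinear map $(h,a)\mapsto a^h$, $H\times A\to A$, with $(ab)^h=a^{h^{(1)}}b^{h^{(2)}}$, $1^h=\epsilon(h)1$, $a^1=a$. Given a weak action and a $k$-linear map $f:H\otimes H\to A$, $A\#_fH$ is $A\otimes H$ (elements written $a\#h$) with product $(a\#h)(b\#l)=ab^{h^{(1)}}f(h^{(2)},l^{(1)})\#h^{(3)}l^{(2)}$; it is called a crossed product if it is associative with unit $1\#1$, equivalently: $f(h,1)=f(1,h)=\epsilon(h)1_A$; $f(l^{(1)},m^{(1)})^{h^{(1)}}f(h^{(2)},l^{(2)}m^{(2)})=f(h^{(1)},l^{(1)})f(h^{(2)}l^{(2)},m)$; and $(a^{l^{(1)}})^{h^{(1)}}f(h^{(2)},l^{(2)})=f(h^{(1)},l^{(1)})a^{h^{(2)}l^{(2)}}$ for all $h,l,m\in H$, $a\in A$. $A$ is regarded as the subalgebra $A\#1$ of $E$. When $f$ is convolution invertible, $h\mapsto1\#h$ is convolution invertible with inverse $h\mapsto(1\#h)^{-1}:=f^{-1}(S(h^{(2)}),h^{(3)})\#S(h^{(1)})$.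 $\mathrm{Tor}^A_s(M,N)$ is identified with the Hochschild homology $H_s(A,N\otimes M)$, where $P=N\otimes M$ is an $E$-bimodule via $x(n\otimes m)y=xn\otimes my$; it is a left $H$-module with $h\in H$ acting through the map induced on homology by the chain endomorphism $p\otimes a_1\otimes\cdots\otimes a_s\mapsto(1\#h^{(s+2)})\,p\,(1\#h^{(1)})^{-1}\otimes a_1^{h^{(2)}}\otimes\cdots\otimes a_s^{h^{(s+1)}}$ of the normalized Hochschild complex $(P\otimes\overline A^*,b_* )$, $\overline A=A/k$. For a left $H$-module $L$, $H_*(H,L)=\mathrm{Tor}^H_*(k,L)$, with $k$ the trivial right $H$-module. *)

(* Defs.v *)
From HB Require Import structures.
From mathcomp Require Import all_boot all_order all_algebra.
From mathcomp Require Import generic_quotient ring_quotient sesquilinear.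
From mathcomp Require Import boolp classical_sets.
From mathcomp Require Import freeg.

Set Implicit Arguments.
Unset Strict Implicit.
Unset Printing Implicit Defensive.

Import GRing.Theory.
Local Open Scope ring_scope.
Local Open Scope quotient_scope.
Local Open Scope classical_set_scope.

Definition submodule (k : fieldType) (V : lmodType k) (W : set V) : Prop :=
  W 0 /\ forall (c : k) x y, W x -> W y -> W (c *: x + y).

Definition span (k : fieldType) (V : lmodType k) (S : set V) : set V :=
  [set x | forall W : set V, submodule W -> S `<=` W -> W x].

Definition spanb (k : fieldType) (V : lmodType k) (S : set V) : {pred V} :=
  fun x => `[< span S x >].

Lemma spanb_closed (k : fieldType) (V : lmodType k) (S : set V) :
  GRing.submod_closed (spanb S).
Proof.
split; first by apply/asboolP => W [].
move=> c x y /asboolP Sx /asboolP Sy; apply/asboolP => W hW hS.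
by apply: hW.2; [apply: Sx | apply: Sy].
Qed.

HB.instance Definition _ (k : fieldType) (V : lmodType k) (S : set V) :=
  GRing.isSubmodClosed.Build k V (spanb S) (spanb_closed S).

Section SubQuot.
Variables (k : fieldType) (V : lmodType k) (S : set V).

(* S is an arbitrary subset of V: sub S is the subspace it spans, quot S is the
   quotient of V by that subspace. *)
Definition sub := {x : V | spanb S x}.
HB.instance Definition _ := SubChoice.on sub.
HB.instance Definition _ := [SubChoice_isSubLmodule of sub by <:].

Definition quot := Quotient.quot (spanb S).
HB.instance Definition _ := GRing.Zmodule.on quot.
HB.instance Definition _ := ZmodQuotient.on quot.

Lemma cls_eqP (x y : V) :
  (\pi_quot x = \pi_quot y) <-> span S (x - y).
Proof.
split.
  by move/eqP; rewrite piE Quotient.equivE => /asboolP.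
by move=> h; apply/eqP; rewrite piE Quotient.equivE; apply/asboolP.
Qed.

Lemma pi_quotD x y : \pi_quot (x + y) = \pi_quot x + \pi_quot y.
Proof. exact: (@pi_addr _ _ _ _ _ quot). Qed.

Definition scaleq (c : k) (u : quot) : quot := \pi_quot (c *: repr u).

Lemma pi_scaleq c x : scaleq c (\pi_quot x) = \pi_quot (c *: x).
Proof.
apply/cls_eqP; rewrite -scalerBr -[_ *: _]addr0.
have h: span S (repr (\pi_quot x) - x) by apply/cls_eqP; rewrite reprK.
by move=> W hW SW; apply: hW.2; [apply: h | apply: hW.1].
Qed.

Lemma scaleqA a b u : scaleq a (scaleq b u) = scaleq (a * b) u.
Proof. by elim/quotW: u => x; rewrite (pi_scaleq b) !pi_scaleq scalerA. Qed.
Lemma scale1q : left_id 1 scaleq.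
Proof. by elim/quotW => x; rewrite !pi_scaleq scale1r. Qed.
Lemma scaleqDr : right_distributive scaleq +%R.
Proof.
move=> c; elim/quotW => x; elim/quotW => y.
by rewrite -(pi_quotD x y) (pi_scaleq _ (x + y)) !pi_scaleq -pi_quotD scalerDr.
Qed.
Lemma scaleqDl u : {morph scaleq^~ u : a b / a + b}.
Proof.
by move=> a b; elim/quotW: u => x; rewrite !pi_scaleq -pi_quotD scalerDl.
Qed.
HB.instance Definition _ :=
  GRing.Zmodule_isLmodule.Build k quot scaleqA scale1q scaleqDr scaleqDl.

Lemma pi_linear : linear (\pi_quot).
Proof. by move=> c x y; rewrite pi_quotD -pi_scaleq. Qed.
End SubQuot.

Section Presented.
Variables (k : fieldType) (X : choiceType) (rel : set {freeg X / k}).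

(* The k-space generated by X subject to the relations r = 0 for r in rel. *)
Definition presented := quot rel.
HB.instance Definition _ := GRing.Lmodule.on presented.

Definition gen (x : X) : presented := \pi_(quot rel) << x >>.

(* Linear extension of a map given on generators. It is computed on a chosen
   representative, hence total in phi; it is the expected linear map whenever
   phi respects the relations (lemmas ext_linear and ext_gen). *)
Definition ext (W : lmodType k) (phi : X -> W) (u : presented) : W :=
  fglift phi (repr (u : quot rel)).

Lemma fglift_linear (W : lmodType k) (phi : X -> W) : linear (fglift phi).
Proof.
have add (D1 D2 : {freeg X / k}) :
    fglift phi (D1 + D2) = fglift phi D1 + fglift phi D2.
  have B a b := lift_is_additive phi a b.
  have f0 : fglift phi 0 = 0 by rewrite -(subrr D1) B subrr.
  have fN b : fglift phi (- b) = - fglift phi b by rewrite -[- b]sub0r B f0 sub0r.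
  by rewrite -[D2 in LHS]opprK B fN opprK.
have f0 : fglift phi 0 = 0 by apply: (@addrI _ (fglift phi 0)); rewrite -add !addr0.
have sum (I : Type) (s : seq I) (F : I -> {freeg X / k}) :
    fglift phi (\sum_(i <- s) F i) = \sum_(i <- s) fglift phi (F i).
  by elim: s => [|i s IHs]; rewrite ?big_nil ?big_cons ?f0 // add IHs.
move=> c x y; rewrite add; congr (_ + _).
have -> : c *: x = \sum_(z <- dom x) << c * coeff z x *g z >> by [].
rewrite -[x in RHS]freeg_sumE !sum scaler_sumr.
by apply: eq_bigr => z _; rewrite !liftU scalerA.
Qed.

Lemma ext_pi (W : lmodType k) (phi : X -> W) :
  (forall r, rel r -> fglift phi r = 0) ->
  forall x, ext phi (\pi_(quot rel) x) = fglift phi x.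
Proof.
move=> h x; apply/eqP; rewrite -subr_eq0; apply/eqP.
have lin := fglift_linear phi.
have f0 : fglift phi 0 = 0 by have := lin (-1) 0 0; rewrite scaler0 addr0 scaleN1r addNr.
rewrite -scaleN1r addrC /ext -lin scaleN1r addrC.
have hx : span rel (repr (\pi_(quot rel) x) - x) by apply/cls_eqP; rewrite reprK.
apply: (hx [set y | fglift phi y = 0]) => //; split=> // c a b /= ha hb.
by rewrite lin ha hb scaler0 addr0.
Qed.

Lemma ext_linear (W : lmodType k) (phi : X -> W) :
  (forall r, rel r -> fglift phi r = 0) -> linear (ext phi).
Proof.
move=> h c u v; rewrite -[u](@reprK _ (quot rel)) -[v](@reprK _ (quot rel)).
move: (repr (u : quot rel)) (repr (v : quot rel)) => x y.
by rewrite -pi_linear !ext_pi // fglift_linear.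
Qed.

Lemma ext_gen (W : lmodType k) (phi : X -> W) :
  (forall r, rel r -> fglift phi r = 0) -> forall x, ext phi (gen x) = phi x.
Proof. by move=> h x; rewrite /gen ext_pi // liftU scale1r. Qed.

Lemma ext_fun_linear (W : lmodType k) (phi psi : X -> W) c u :
  ext (fun x => c *: phi x + psi x) u = c *: ext phi u + ext psi u.
Proof.
rewrite /ext -[repr _]freeg_repr !fglift_Freeg /prelift scaler_sumr -big_split /=.
by apply: eq_bigr => z _; rewrite scalerDr !scalerA mulrC.
Qed.

Lemma ext_eq (W : lmodType k) (phi psi : X -> W) u :
  phi =1 psi -> ext phi u = ext psi u.
Proof. by move=> /funext ->. Qed.
End Presented.

Section Tensor.
Variable k : fieldType.
Local Notation bilin f := (bilinear_for *:%R *:%R f).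

Definition bilinear_relations (V W : lmodType k) : set {freeg (V * W)%type / k} :=
  [set r | (exists c x x' y,
              r = << (c *: x + x', y) >> - c *: << (x, y) >> - << (x', y) >>)
        \/ (exists c x y y',
              r = << (x, c *: y + y') >> - c *: << (x, y) >> - << (x, y') >>)].

Definition tensor (V W : lmodType k) := presented (@bilinear_relations V W).
HB.instance Definition _ V W := GRing.Lmodule.on (tensor V W).

Definition tens (V W : lmodType k) (x : V) (y : W) : tensor V W :=
  gen (@bilinear_relations V W) (x, y).

Lemma bilin_kills (V W U : lmodType k) (phi : V -> W -> U) : bilin phi ->
  forall r, bilinear_relations r -> fglift (fun p => phi p.1 p.2) r = 0.
Proof.
move=> [h1 h2] r; set F := fglift _.
have lin : linear F by apply: fglift_linear.
have FE p : F << p >> = phi p.1 p.2 by rewrite /F liftU scale1r.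
have sub3 c (x y z : {freeg (V * W)%type / k}) :
    F (x - c *: y - z) = F x - (c *: F y + F z).
  rewrite -lin -[X in F X]addrA -opprD; move: (c *: y + z) => w.
  have -> : x - w = (-1) *: w + x by rewrite scaleN1r addrC.
  by rewrite lin scaleN1r addrC.
case=> [[c [x [x' [y ->]]]]|[c [x [y [y' ->]]]]]; rewrite sub3 !FE /=.
  by rewrite h1 subrr.
by rewrite h2 subrr.
Qed.

(* The linear map tensor V W -> U induced by a bilinear map phi. *)
Definition tlift (V W U : lmodType k) (phi : V -> W -> U) : tensor V W -> U :=
  ext (fun p => phi p.1 p.2).

Lemma tlift_linear (V W U : lmodType k) (phi : V -> W -> U) :
  bilin phi -> linear (tlift phi).
Proof. by move=> h; apply: ext_linear; apply: bilin_kills. Qed.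

Lemma tliftE (V W U : lmodType k) (phi : V -> W -> U) :
  bilin phi -> forall x y, tlift phi (tens x y) = phi x y.
Proof. by move=> h x y; rewrite /tlift ext_gen //; apply: bilin_kills. Qed.

Lemma tlift_fun_linear (V W U : lmodType k) (phi psi chi : V -> W -> U) c u :
  (forall x y, chi x y = c *: phi x y + psi x y) ->
  tlift chi u = c *: tlift phi u + tlift psi u.
Proof.
move=> h; rewrite -ext_fun_linear; apply: ext_eq => p; exact: h.
Qed.

Lemma tens_bilin (V W : lmodType k) : bilin (@tens V W).
Proof.
have pi := @pi_linear k _ (@bilinear_relations V W).
have E r : bilinear_relations r -> \pi_(quot (@bilinear_relations V W)) r = 0.
  move=> hr; have -> : 0 = \pi_(quot (@bilinear_relations V W)) 0.
    by have := pi (-1) 0 0; rewrite scaler0 addr0 scaleN1r addNr.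
  by apply/cls_eqP; rewrite subr0 => X hX; apply.
have sub3 c (x y z : {freeg (V * W)%type / k}) :
    bilinear_relations (x - c *: y - z) ->
    \pi_(quot (@bilinear_relations V W)) x =
    c *: \pi_(quot (@bilinear_relations V W)) y
    + \pi_(quot (@bilinear_relations V W)) z.
  move=> /E h; rewrite -pi; apply/cls_eqP; rewrite opprD addrA.
  by have: \pi_(quot (@bilinear_relations V W)) (x - c *: y - z)
     = \pi_(quot (@bilinear_relations V W)) 0;
    [rewrite h; have := pi (-1) 0 0; rewrite scaler0 addr0 scaleN1r addNr
    | move/cls_eqP; rewrite subr0].
split.
  by move=> y c x x'; apply: sub3; left; exists c, x, x', y.
by move=> x c y y'; apply: sub3; right; exists c, x, y, y'.
Qed.
End Tensor.

Notation bilin f := (bilinear_for *:%R *:%R f).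
Notation "x \ox y" := (tens x y) (at level 40, left associativity) : ring_scope.

Section Sweedler.
Variables (k : fieldType) (H : lmodType k) (D : H -> tensor H H).
Variable U : lmodType k.

(* sw h phi is the sum of phi h(1) h(2), for the coproduct D; sw3 and swn use
   the iterated coproduct (id * D) D, resp. n tensor factors added to the
   first one: swn n h phi is the sum of phi [:: h(1); ...; h(n+1)]. *)
Definition sw (h : H) (phi : H -> H -> U) : U := tlift phi (D h).

Definition sw3 (h : H) (phi : H -> H -> H -> U) : U :=
  tlift (fun h1 h' => tlift (phi h1) (D h')) (D h).

Fixpoint swn (n : nat) (h : H) (phi : seq H -> U) : U :=
  if n is m.+1 then tlift (fun h1 h' => swn m h' (fun s => phi (h1 :: s))) (D h)
  else phi [:: h].
End Sweedler.

Section SweedlerLinear.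
Variables (k : fieldType) (H : lmodType k) (D : {linear H -> tensor H H}).
Variable U : lmodType k.

Lemma sw_linear (phi : H -> H -> U) :
  bilin phi -> linear (fun h => sw D h phi).
Proof. by move=> h c x y; rewrite /sw linearP (tlift_linear h). Qed.

Lemma sw3_linear (phi : H -> H -> H -> U) :
  (forall x, bilin (phi x)) -> (forall y z, linear (fun x => phi x y z)) ->
  linear (fun h => sw3 D h phi).
Proof.
move=> h1 h2; apply: (sw_linear (phi := fun x h => tlift (phi x) (D h))).
split=> [h c x y | x c h h'] /=.
  by apply: tlift_fun_linear => *; apply: h2.
by rewrite linearP (tlift_linear (h1 x)).
Qed.
End SweedlerLinear.

Record hopf (k : fieldType) (H : algType k) := Hopf {
  comul : {linear H -> tensor H H};
  counit : {scalar H};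
  antipode : {linear H -> H};
  comul1 : comul 1 = 1 \ox 1;
  comulM : forall h l, comul (h * l) =
    sw comul h (fun h1 h2 => sw comul l (fun l1 l2 => (h1 * l1) \ox (h2 * l2)));
  counit1 : counit 1 = 1;
  counitM : forall h l, counit (h * l) = counit h * counit l;
  comulA : forall h,
    sw comul h (fun h1 h2 => sw comul h1 (fun x y => (x \ox y) \ox h2)) =
    sw comul h (fun h1 h2 => sw comul h2 (fun x y => (h1 \ox x) \ox y));
  comul1l : forall h, sw comul h (fun h1 h2 => counit h1 *: h2) = h;
  comul1r : forall h, sw comul h (fun h1 h2 => counit h2 *: h1) = h;
  antipodel : forall h,
    sw comul h (fun h1 h2 => antipode h1 * h2) = counit h *: 1;
  antipoder : forall h,
    sw comul h (fun h1 h2 => h1 * antipode h2) = counit h *: 1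
}.

Section CrossedProduct.
Variables (k : fieldType) (H : algType k) (HH : hopf H) (A : algType k).
Local Notation sw := (sw (comul HH)).
Local Notation sw3 := (sw3 (comul HH)).

(* wact h a is a^h. *)
Record weak_action := WeakAction {
  wact : H -> A -> A;
  wact_bilin : bilin wact;
  wactM : forall h a b, wact h (a * b) = sw h (fun h1 h2 => wact h1 a * wact h2 b);
  wact1r : forall h, wact h 1 = counit HH h *: 1;
  wact1l : forall a, wact 1 a = a
}.

Section Product.
Variables (w : weak_action) (f : {linear tensor H H -> A}).

(* (a # h)(b # l) = a b^h(1) f(h(2), l(1)) # h(3) l(2), extended bilinearly. *)
Definition cp_mul (u v : tensor A H) : tensor A H :=
  tlift (fun a h => tlift (fun b l =>
    sw3 h (fun h1 h2 h3 => sw l (fun l1 l2 =>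
      (a * wact w h1 b * f (h2 \ox l1)) \ox (h3 * l2)))) v) u.
End Product.

Record crossed_product := CrossedProduct {
  cp_act : weak_action;
  cocycle : {linear tensor H H -> A};
  cp_mulA : associative (cp_mul cp_act cocycle);
  cp_mul1l : left_id (1 \ox 1) (cp_mul cp_act cocycle);
  cp_mul1r : right_id (1 \ox 1) (cp_mul cp_act cocycle)
}.

(* Inverses for the convolution product of Hom(H (x) H, A), where H (x) H has
   coproduct (h (x) l) |-> (h(1) (x) l(1)) (x) (h(2) (x) l(2)). *)
Definition convolution_inverse (f g : {linear tensor H H -> A}) : Prop :=
  forall h l,
    sw h (fun h1 h2 => sw l (fun l1 l2 => f (h1 \ox l1) * g (h2 \ox l2))) =
      (counit HH h * counit HH l) *: 1 /\
    sw h (fun h1 h2 => sw l (fun l1 l2 => g (h1 \ox l1) * f (h2 \ox l2))) =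
      (counit HH h * counit HH l) *: 1.


(* The algebra A #_f H; the element a # h is a \ox h. *)
Definition cp_alg (C : crossed_product) : Type := tensor A H.

Section AlgebraStructure.
Variable C : crossed_product.
Local Notation E := (cp_alg C).
Local Notation mul := (cp_mul (cp_act C) (cocycle C)).

HB.instance Definition _ := GRing.Lmodule.on E.

Lemma cp_mul_bilin : bilin mul.
Proof.
have [tl tr] := @tens_bilin k A H.
have [wl wr] := wact_bilin (cp_act C).
have [ul ur] := @tens_bilin k H H.
have inA (h : H) (b : A) (l : H) c (a a' : A) :
    sw3 h (fun h1 h2 h3 => sw l (fun l1 l2 =>
      ((c *: a + a') * wact (cp_act C) h1 b * cocycle C (h2 \ox l1)) \ox (h3 * l2)))
    = c *: sw3 h (fun h1 h2 h3 => sw l (fun l1 l2 =>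
      (a * wact (cp_act C) h1 b * cocycle C (h2 \ox l1)) \ox (h3 * l2)))
    + sw3 h (fun h1 h2 h3 => sw l (fun l1 l2 =>
      (a' * wact (cp_act C) h1 b * cocycle C (h2 \ox l1)) \ox (h3 * l2))).
  apply: tlift_fun_linear => h1 h'; apply: tlift_fun_linear => h2 h3.
  apply: tlift_fun_linear => l1 l2.
  rewrite !mulrDl -!scalerAl; apply: tl.
have inB (h : H) (a : A) (l : H) c (b b' : A) :
    sw3 h (fun h1 h2 h3 => sw l (fun l1 l2 =>
      (a * wact (cp_act C) h1 (c *: b + b') * cocycle C (h2 \ox l1)) \ox (h3 * l2)))
    = c *: sw3 h (fun h1 h2 h3 => sw l (fun l1 l2 =>
      (a * wact (cp_act C) h1 b * cocycle C (h2 \ox l1)) \ox (h3 * l2)))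
    + sw3 h (fun h1 h2 h3 => sw l (fun l1 l2 =>
      (a * wact (cp_act C) h1 b' * cocycle C (h2 \ox l1)) \ox (h3 * l2))).
  apply: tlift_fun_linear => h1 h'; apply: tlift_fun_linear => h2 h3.
  apply: tlift_fun_linear => l1 l2.
  rewrite wr mulrDr mulrDl -scalerAr -scalerAl; apply: tl.
have inl1 (a b : A) (h1 h2 h3 : H) : bilin (fun l1 l2 : H =>
      (a * wact (cp_act C) h1 b * cocycle C (h2 \ox l1)) \ox (h3 * l2)).
  split=> [y c l l' | x c l l'] /=.
    rewrite ur linearP mulrDr -scalerAr; apply: tl.
  rewrite mulrDr -scalerAr; apply: tr.
have inL (a b : A) (h : H) c (l l' : H) :
    sw3 h (fun h1 h2 h3 => sw (c *: l + l') (fun l1 l2 =>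
      (a * wact (cp_act C) h1 b * cocycle C (h2 \ox l1)) \ox (h3 * l2)))
    = c *: sw3 h (fun h1 h2 h3 => sw l (fun l1 l2 =>
      (a * wact (cp_act C) h1 b * cocycle C (h2 \ox l1)) \ox (h3 * l2)))
    + sw3 h (fun h1 h2 h3 => sw l' (fun l1 l2 =>
      (a * wact (cp_act C) h1 b * cocycle C (h2 \ox l1)) \ox (h3 * l2))).
  apply: tlift_fun_linear => h1 h'; apply: tlift_fun_linear => h2 h3.
  exact: sw_linear.
have inH (a b : A) (l : H) : linear (fun h =>
    sw3 h (fun h1 h2 h3 => sw l (fun l1 l2 =>
      (a * wact (cp_act C) h1 b * cocycle C (h2 \ox l1)) \ox (h3 * l2)))).
  apply: sw3_linear => [h1|y z c x x'].
    split=> [y c x x' | x c y y'] /=; apply: tlift_fun_linear => l1 l2.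
      rewrite ul linearP mulrDr -scalerAr; apply: tl.
    rewrite mulrDl -scalerAl; apply: tr.
  apply: tlift_fun_linear => l1 l2.
  rewrite wl mulrDr mulrDl -scalerAr -scalerAl; apply: tl.
split=> [v|u].
  apply: tlift_linear; split=> [h c a a' | a c h h'] /=.
    by apply: tlift_fun_linear => b l; apply: inA.
  by apply: tlift_fun_linear => b l; apply: inH.
move=> c v v'; apply: tlift_fun_linear => a h; apply: tlift_linear.
by split=> [l d b b' | b d l l'] /=; [apply: inB | apply: inL].
Qed.

Lemma cp_mulDl : left_distributive (mul : E -> E -> E) +%R.
Proof. by move=> x y z; have /= := cp_mul_bilin.1 z 1 x y; rewrite !scale1r. Qed.

Lemma cp_mulDr : right_distributive (mul : E -> E -> E) +%R.
Proof. by move=> x y z; have /= := cp_mul_bilin.2 x 1 y z; rewrite !scale1r. Qed.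

Lemma cp_one_neq0 : (1 : A) \ox (1 : H) != 0 :> E.
Proof.
pose phi (a : A) h := counit HH h *: a.
have hphi : bilin phi.
  split=> [h c a b | a c h l]; rewrite /phi /=.
    by rewrite scalerDr !scalerA mulrC.
  by rewrite linearP scalerDl scalerA.
apply/eqP => h; have := tliftE hphi 1 1.
rewrite /phi counit1 scale1r h => h1; have := oner_neq0 A.
rewrite -h1; have := tlift_linear hphi (-1) 0 0.
by rewrite scaler0 addr0 scaleN1r addNr => ->; rewrite eqxx.
Qed.

HB.instance Definition _ := GRing.Zmodule_isNzRing.Build E
  (@cp_mulA C) (@cp_mul1l C) (@cp_mul1r C) cp_mulDl cp_mulDr cp_one_neq0.

Lemma cp_scaleAl (c : k) (x y : E) : c *: (x * y) = (c *: x) * y.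
Proof.
have h := cp_mul_bilin.1 y c x 0; rewrite addr0 in h; apply: esym.
exact: etrans h (etrans (congr1 (+%R _) (mul0r (y : E))) (addr0 _)).
Qed.
HB.instance Definition _ := GRing.Lmodule_isLalgebra.Build k E cp_scaleAl.

Lemma cp_scaleAr (c : k) (x y : E) : c *: (x * y) = x * (c *: y).
Proof.
have h := cp_mul_bilin.2 x c y 0; rewrite addr0 in h; apply: esym.
exact: etrans h (etrans (congr1 (+%R _) (mulr0 (x : E))) (addr0 _)).
Qed.
HB.instance Definition _ := GRing.Lalgebra_isAlgebra.Build k E cp_scaleAr.
End AlgebraStructure.
End CrossedProduct.


HB.instance Definition _ (k : fieldType) (R : algType k) :=
  GRing.Lmodule.copy R^c R.
HB.instance Definition _ (k : fieldType) (R : algType k) :=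
  GRing.Lmodule_isLalgebra.Build k R^c
    (fun a (u v : R) => scalerAr a v u : a *: (v * u) = v * (a *: u)).
HB.instance Definition _ (k : fieldType) (R : algType k) :=
  GRing.Lalgebra_isAlgebra.Build k R^c
    (fun a (u v : R) => scalerAl a v u : a *: (v * u) = (a *: v) * u).

Definition is_module (k : fieldType) (R : algType k) (V : lmodType k)
    (act : R -> V -> V) : Prop :=
  [/\ bilin act, forall v, act 1 v = v
    & forall r s v, act (r * s) v = act r (act s v)].

(* Left R-modules; the k-structure, which is determined by the R-structure, is
   part of the carrier. *)
Record module (k : fieldType) (R : algType k) := Module {
  mod_sort :> lmodType k;
  act : R -> mod_sort -> mod_sort;
  act_is_module : is_module act
}.
Arguments act {k R} _ r m.

(* Right R-modules are left modules over the opposite algebra, act M r m being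
   m r. *)
Notation rmodule R := (module (R^c : algType _)).

Definition module_hom (k : fieldType) (R : algType k) (M N : module R)
    (g : M -> N) : Prop :=
  linear g /\ forall r m, g (act M r m) = act N r (g m).

Definition projective (k : fieldType) (R : algType k) (P : module R) : Prop :=
  forall (M N : module R) (g : M -> N) (h : P -> N),
    module_hom g -> (forall y, exists x, g x = y) -> module_hom h ->
  exists2 l : P -> M, module_hom l & forall x, g (l x) = h x.

Record resolution (k : fieldType) (R : algType k) (M : module R) := Resolution {
  res :> nat -> module R;
  dres : forall n, res n.+1 -> res n;
  aug : res 0%N -> M;
  res_projective : forall n, projective (res n);
  dres_hom : forall n, module_hom (@dres n);
  aug_hom : module_hom aug;
  aug_surj : forall y, exists x, aug x = y;
  aug_exact : forall x, aug x = 0 <-> exists y, dres y = x;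
  dres_exact : forall n (x : res n.+1), dres x = 0 <-> exists y, dres y = x
}.

Definition linear_iso (k : fieldType) (U V : lmodType k) : Prop :=
  exists2 g : U -> V, linear g & bijective g.

(* Ker g / Im f, when f and g are linear with g o f = 0. *)
Definition homology (k : fieldType) (U V W : lmodType k)
    (f : U -> V) (g : V -> W) : lmodType k :=
  quot [set z : sub [set x | g x = 0] | exists y, f y = val z].

Section ChainHomology.
Variables (k : fieldType) (C : nat -> lmodType k) (d : forall n, C n.+1 -> C n).

(* The differential out of degree n, which is zero in degree 0. *)
Definition d_out (n : nat) : C n -> C n.-1 :=
  if n is m.+1 then @d m else fun _ => 0.

Definition chain_homology (n : nat) : lmodType k := homology (@d n) (@d_out n).
End ChainHomology.

Section Tor.
Variables (k : fieldType) (R : algType k).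

Section TensorOver.
Variables (M : rmodule R) (N : module R).

Definition balanced_relations : set {freeg (M * N)%type / k} :=
  @bilinear_relations k M N `|`
  [set r | exists a x y, r = << (act M a x, y) >> - << (x, act N a y) >>].

Definition tensor_over : lmodType k := presented balanced_relations.

Definition tens_over (x : M) (y : N) : tensor_over := gen balanced_relations (x, y).
End TensorOver.

(* Tor^R_n(M, N), computed from a projective resolution of either argument. *)
Definition Tor_left (M : rmodule R) (P : resolution M) (N : module R) (n : nat) :
    lmodType k :=
  chain_homology (C := fun i => tensor_over (P i) N)
    (fun i => ext (fun p => tens_over (dres p.1) p.2)) n.

Definition Tor_right (M : rmodule R) (N : module R) (Q : resolution N) (n : nat) :
    lmodType k :=
  chain_homology (C := fun i => tensor_over M (Q i))
    (fun i => ext (fun p => tens_over p.1 (dres p.2))) n.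
End Tor.

Section Hochschild.
Variables (k : fieldType) (A : algType k) (P : lmodType k).

(* P (x) Abar^(x) s, Abar = A / k, presented by the symbols p (x) a_1 ... a_s. *)
Definition hoch_relations (s : nat) : set {freeg (P * s.-tuple A)%type / k} :=
  [set r | (exists c p p' t,
              r = << (c *: p + p', t) >> - c *: << (p, t) >> - << (p', t) >>)
        \/ (exists (i : 'I_s) c p (t u v : s.-tuple A),
              [/\ tnth t i = c *: tnth u i + tnth v i,
                  forall j, j != i -> tnth t j = tnth u j /\ tnth t j = tnth v j
                & r = << (p, t) >> - c *: << (p, u) >> - << (p, v) >>])
        \/ (exists (i : 'I_s) c p (t : s.-tuple A),
              tnth t i = c%:A /\ r = << (p, t) >>)].

Definition hoch_chain (s : nat) : lmodType k := presented (@hoch_relations s).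

Definition hoch_tens (s : nat) (p : P) (t : s.-tuple A) : hoch_chain s :=
  gen (@hoch_relations s) (p, t).

Variables (la : A -> P -> P) (ra : P -> A -> P).

(* (a_0, ..., a_i a_(i+1), ..., a_s). *)
Definition contract (s : nat) (i : 'I_s) (t : s.+1.-tuple A) : s.-tuple A :=
  [tuple let x := tnth t (widen_ord (leqnSn s) j) in let y := tnth t (fintype.lift ord0 j) in
         if (j < i)%N then x else if j == i then x * y else y | j < s].

(* la and ra are the left and right actions of A on the bimodule P. *)
Definition hoch_d (s : nat) : hoch_chain s.+1 -> hoch_chain s :=
  ext (fun pt : P * s.+1.-tuple A => let: (p, t) := pt in
    hoch_tens (ra p (thead t)) [tuple of behead t]
    + \sum_(i < s) (-1) ^+ i.+1 *: hoch_tens p (contract i t)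
    + (-1) ^+ s.+1 *: hoch_tens (la (tnth t ord_max) p)
                        [tuple tnth t (widen_ord (leqnSn s) j) | j < s]).

Definition hoch_homology (s : nat) : lmodType k := chain_homology hoch_d s.
End Hochschild.

Record spectral_sequence (k : fieldType) := SpectralSequence {
  page : nat -> int -> int -> lmodType k;
  (* Only the components with p' = p - r and q' = q + r - 1 are meaningful. *)
  diff : forall (r : nat) (p q p' q' : int), {linear page r p q -> page r p' q'};
  diff_diff : forall (r : nat) (p q p' q' p'' q'' : int), (2 <= r)%N ->
    p' = p - r%:Z -> q' = q + r%:Z - 1 -> p'' = p' - r%:Z -> q'' = q' + r%:Z - 1 ->
    forall x, diff r p' q' p'' q'' (diff r p q p' q' x) = 0;
  page_next : forall (r : nat) (p q : int), (2 <= r)%N ->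
    linear_iso (page r.+1 p q)
      (homology (diff r (p + r%:Z) (q - r%:Z + 1) p q)
                (diff r p q (p - r%:Z) (q + r%:Z - 1)))
}.

Definition first_quadrant (k : fieldType) (S : spectral_sequence k) : Prop :=
  forall p q, (p < 0) || (q < 0) -> forall x : page S 2 p q, x = 0.

(* Each T n has a finite filtration F by subspaces whose graded pieces are the
   stable values of the pages; r0 may depend on (p, q). *)
Definition converges_to (k : fieldType) (S : spectral_sequence k)
    (T : nat -> lmodType k) : Prop :=
  forall n, exists F : int -> set (T n),
    [/\ forall p, submodule (F p), forall p, F (p - 1) `<=` F p,
        exists a b, F a = [set 0] /\ F b = setT
      & forall p q, p + q = n%:Z -> exists r0, forall r : nat, (r0 <= r)%N ->
          [/\ forall x, diff S r p q (p - r%:Z) (q + r%:Z - 1) x = 0,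
              forall x, diff S r (p + r%:Z) (q - r%:Z + 1) p q x = 0
            & linear_iso (page S r p q)
                (quot [set z : sub (F p) | F (p - 1) (val z)])]].

Section CrossedProductHomology.
Variables (k : fieldType) (H : algType k) (HH : hopf H) (A : algType k).
Variable C : crossed_product HH A.
Local Notation E := (cp_alg C : algType k).
Local Notation sw3 := (sw3 (comul HH)).
Local Notation swn := (swn (comul HH)).

Definition cp_of_alg (a : A) : E := a \ox 1.
Definition cp_of_hopf (h : H) : E := 1 \ox h.

(* The convolution inverse h |-> (1 # h)^-1 of cp_of_hopf. *)
Definition cp_of_hopf_inv (finv : {linear tensor H H -> A}) (h : H) : E :=
  sw3 h (fun h1 h2 h3 => finv (antipode HH h2 \ox h3) \ox antipode HH h1).

Variables (M : rmodule E) (N : module E).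

(* The E-bimodule N (x) M. *)
Definition bimod : lmodType k := tensor N M.
Definition bimod_left (x : E) : bimod -> bimod :=
  tlift (fun n m => act N x n \ox m).
Definition bimod_right (u : bimod) (y : E) : bimod :=
  tlift (fun n m => n \ox act M y m) u.

(* H_s(A, N (x) M), with which Tor^A_s(M, N) is identified. *)
Definition tor_alg_chain (s : nat) : lmodType k := hoch_chain A bimod s.
Definition tor_alg_d (s : nat) : tor_alg_chain s.+1 -> tor_alg_chain s :=
  @hoch_d k A bimod (fun a => bimod_left (cp_of_alg a))
    (fun u a => bimod_right u (cp_of_alg a)) s.
Definition tor_alg (s : nat) : lmodType k := chain_homology tor_alg_d s.

(* The chain endomorphism of h; in swn s.+1, the list hs is h(1), ..., h(s+2). *)
Definition hopf_chain (finv : {linear tensor H H -> A}) (h : H) (s : nat) :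
    tor_alg_chain s -> tor_alg_chain s :=
  ext (fun pt : bimod * s.-tuple A => let: (p, t) := pt in
    swn s.+1 h (fun hs =>
      hoch_tens
        (bimod_left (cp_of_hopf (nth 0 hs s.+1))
          (bimod_right p (cp_of_hopf_inv finv (nth 0 hs 0))))
        [tuple wact (cp_act C) (nth 0 hs i.+1) (tnth t i) | i < s])).

(* The action of H on H_s(A, N (x) M) induced by hopf_chain. *)
Definition induced_action (finv : {linear tensor H H -> A}) (s : nat)
    (a : H -> tor_alg s -> tor_alg s) : Prop :=
  forall h (z : sub [set x | d_out tor_alg_d x = 0]),
  exists2 z' : sub [set x | d_out tor_alg_d x = 0],
    val z' = hopf_chain finv h (val z) & a h (\pi z) = \pi z'.
End CrossedProductHomology.

(* The trivial right H-module k. *)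
Definition trivial_act (k : fieldType) (H : algType k) (HH : hopf H)
  (h : H^c) (x : k^o) : k^o := counit HH h * x.

Lemma trivial_is_module (k : fieldType) (H : algType k) (HH : hopf H) :
  is_module (R := H^c) (trivial_act HH).
Proof.
split=> [|x|h l x]; rewrite /trivial_act.
- split=> [x c h l|h c x y] /=.
    by rewrite linearP mulrDl -mulrA.
  by rewrite mulrDr /GRing.scale /= mulrCA.
- by rewrite counit1 mul1r.
by rewrite counitM mulrA (mulrC (counit HH h)).
Qed.

Definition trivial (k : fieldType) (H : algType k) (HH : hopf H) : rmodule H :=
  Module (trivial_is_module HH).

(* Main.v *)
(* Write gamma h = 1 # h and u for its convolution inverse. For a left E-module N the space M (x)_A N is a
   left H-module through h (m (x) n) = m u(h1) (x) gamma(h2) n, and k (x)_H (M (x)_A N) = M (x)_E N. If N is a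
   direct summand of a free E-module, the coaction a # h |-> (a # h1) (x) h2 of H on E yields an H-linear
   section of H (x) (M (x)_A N) -> M (x)_A N; so M (x)_A N is flat over H.

   Take the double complex K_i (x)_H (M (x)_A Q_j). Its rows in i resolve k (x)_H (M (x)_A Q_j) = M (x)_E Q_j,
   so its total homology is Tor^E(M, N). Each K_i is flat, so the homology in j followed by the homology in i is
   H_r(H, H_s(M (x)_A Q)). Finally H_s(M (x)_A Q) is identified with H_s(A, N (x) M), with its action of H,
   by the double complex of Hochschild chains C_i(A, Q_j (x) M): it resolves M (x)_A Q_j because Q_j is also
   a direct summand of a free A-module, it resolves C_i(A, N (x) M) because k is a field, and the chain
   endomorphism of h acts on it, inducing the above action on M (x)_A Q_j. *)
Require Import Defs.
From HB Require Import structures.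
From mathcomp Require Import all_boot all_order all_algebra.
From mathcomp Require Import generic_quotient ring_quotient sesquilinear.
From mathcomp Require Import boolp classical_sets.
From mathcomp Require Import freeg zify.

Set Implicit Arguments.
Unset Strict Implicit.
Unset Printing Implicit Defensive.

Import GRing.Theory.
Local Open Scope ring_scope.
Local Open Scope quotient_scope.
Local Open Scope classical_set_scope.

(** The chain endomorphisms of h and l need not compose to that of hl: a weak action is not an
    action, and 1 # h is not multiplicative in h. On M (x)_A Q_j, however, the formula for h defines
    an honest H-module. The action on H_s(A, N (x) M) is therefore transported from the homology of
    M (x)_A Q, and only then shown to be induced by the chain endomorphisms; the module axioms need
    no chain homotopies.

    Isomorphisms of subquotients come from linear relations between representatives. One total cycle
    of a double complex determines a class on each edge, but neither class determines the cycle, so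
    a relation is the natural datum; the successive pages, the limit, the second page and the
    comparison of two edges are all handled this way.

    Exactness over k is always witnessed by linear splittings, hence is inherited by tensor products
    and Hochschild chains. Projectivity enters only through a linear section of the action map, and
    the same notion of section, produced by hand, serves for modules that are not assumed
    projective: Q_j over A and M (x)_A Q_j over H. *)

Local Notation span := Defs.span.

(** * Linear algebra over a field: linear relations, subquotients, complements *)

Section Linear.
Variables (k : fieldType) (U V : lmodType k) (f : U -> V).
Hypothesis lf : linear f.

Lemma lin0 : f 0 = 0.
Proof. by have := lf (-1) 0 0; rewrite scaler0 addr0 scaleN1r addNr. Qed.
Lemma linD x y : f (x + y) = f x + f y.
Proof. by have := lf 1 x y; rewrite !scale1r. Qed.
Lemma linZ c x : f (c *: x) = c *: f x.
Proof. by have := lf c x 0; rewrite lin0 !addr0. Qed.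
Lemma linN x : f (- x) = - f x.
Proof. by rewrite -scaleN1r linZ scaleN1r. Qed.
Lemma linB x y : f (x - y) = f x - f y.
Proof. by rewrite linD linN. Qed.
Lemma lin_sum (I : Type) (s : seq I) (P : pred I) (F : I -> U) :
  f (\sum_(i <- s | P i) F i) = \sum_(i <- s | P i) f (F i).
Proof. exact: (big_morph f linD lin0). Qed.
End Linear.

Section LinearMaps.
Variables (k : fieldType).
Implicit Types U V W : lmodType k.

Lemma linear_id U : linear (fun x : U => x).
Proof. by []. Qed.
Lemma linear_zero U V : linear (fun _ : U => 0 : V).
Proof. by move=> c x y; rewrite scaler0 addr0. Qed.
Lemma linear_comp U V W (g : V -> W) (f : U -> V) :
  linear g -> linear f -> linear (fun x => g (f x)).
Proof. by move=> lg lf c x y; rewrite lf lg. Qed.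
Lemma linear_add U V (f g : U -> V) : linear f -> linear g -> linear (fun x => f x + g x).
Proof. by move=> lf lg c x y; rewrite lf lg scalerDr addrACA. Qed.
Lemma linear_scale U V a (f : U -> V) : linear f -> linear (fun x => a *: f x).
Proof. by move=> lf c x y; rewrite lf scalerDr !scalerA mulrC. Qed.
Lemma linear_opp U V (f : U -> V) : linear f -> linear (fun x => - f x).
Proof. by move=> lf c x y; rewrite lf opprD scalerN. Qed.
Lemma linear_sub U V (f g : U -> V) : linear f -> linear g -> linear (fun x => f x - g x).
Proof. by move=> lf lg; apply: linear_add => //; apply: linear_opp. Qed.
Lemma linear_bundled U V (f : {linear U -> V}) : linear f.
Proof. by move=> c x y; rewrite linearP. Qed.
Lemma linear_mull U (B : algType k) (f : U -> B) b : linear f -> linear (fun x => f x * b).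
Proof. by move=> lf c x y; rewrite lf mulrDl scalerAl. Qed.
Lemma linear_mulr U (B : algType k) (f : U -> B) b : linear f -> linear (fun x => b * f x).
Proof. by move=> lf c x y; rewrite lf mulrDr scalerAr. Qed.
Lemma linear_bigsum U V (I : Type) (s : seq I) (P : pred I) (f : I -> U -> V) :
  (forall i, linear (f i)) -> linear (fun x => \sum_(i <- s | P i) f i x).
Proof.
move=> lf c x y; rewrite scaler_sumr -big_split /=.
by apply: eq_bigr => i _; rewrite lf.
Qed.

Lemma bundle_linear U V (f : U -> V) : linear f -> exists g : {linear U -> V}, g =1 f.
Proof.
move=> lf; pose m := GRing.isLinear.Build k U V *:%R f lf.
by exists (HB.pack_for {linear U -> V} f m).
Qed.

Lemma bilin_fst U V W (b : U -> V -> W) y : bilin b -> linear (b^~ y).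
Proof. by case. Qed.
Lemma bilin_snd U V W (b : U -> V -> W) x : bilin b -> linear (b x).
Proof. by case. Qed.

Lemma submodule_span U (S : set U) : submodule S -> forall x, span S x <-> S x.
Proof. by move=> mS x; split=> [h|h W _]; [apply: h | apply]. Qed.

Lemma submoduleB U (S : set U) x y : submodule S -> S x -> S y -> S (x - y).
Proof. by move=> [_ h] Sx Sy; rewrite addrC -scaleN1r; apply: h. Qed.

Lemma submoduleN U (S : set U) x : submodule S -> S x -> S (- x).
Proof. by move=> mS Sx; rewrite -sub0r; apply: submoduleB => //; apply: mS.1. Qed.

Lemma submoduleD U (S : set U) x y : submodule S -> S x -> S y -> S (x + y).
Proof. by move=> [_ h] Sx Sy; rewrite -[x]scale1r; apply: h. Qed.

Lemma submodule_ker U V (f : U -> V) : linear f -> submodule [set x | f x = 0].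
Proof. by move=> lf; split=> [|c x y /= hx hy]; rewrite /= ?lin0 // lf hx hy scaler0 addr0. Qed.

Lemma submodule_im U V (f : U -> V) : linear f -> submodule [set x | exists y, f y = x].
Proof.
move=> lf; split=> [|c x y /= [a <-] [b <-]]; first by exists 0; rewrite lin0.
by exists (c *: a + b); rewrite lf.
Qed.

(** A subspace of [U * V]. Correspondences such as that of a total cycle with its edge class become
    bijective only after dividing by boundaries, so they are kept as relations until then. *)
Definition linear_rel U V (R : U -> V -> Prop) : Prop :=
  R 0 0 /\ forall c x x' y y', R x y -> R x' y' -> R (c *: x + x') (c *: y + y').

Lemma linear_relB U V (R : U -> V -> Prop) x x' y y' :
  linear_rel R -> R x y -> R x' y' -> R (x - x') (y - y').
Proof.
by move=> [_ h] a b; rewrite [x - _]addrC [y - _]addrC -!scaleN1r; apply: h.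
Qed.

Lemma rel_iso U V (R : U -> V -> Prop) : linear_rel R ->
  (forall x, exists y, R x y) -> (forall y, exists x, R x y) ->
  (forall y, R 0 y -> y = 0) -> (forall x, R x 0 -> x = 0) -> linear_iso U V.
Proof.
move=> lR /choice[g hg] /choice[g' hg'] h0 h0'.
have u x y : R x y -> y = g x.
  move=> h; apply/eqP; rewrite -subr_eq0; apply/eqP/h0.
  by rewrite -(subrr x); apply: linear_relB.
have u' x y : R x y -> x = g' y.
  move=> h; apply/eqP; rewrite -subr_eq0; apply/eqP/h0'.
  by rewrite -(subrr y); apply: linear_relB.
exists g; first by move=> c x y; apply/esym/u/lR.2.
by exists g' => x; apply: esym; [apply: u' | apply: u].
Qed.

Lemma quot_repr U (S : set U) (u : quot S) : u = \pi_(quot S) (repr u).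
Proof. by rewrite reprK. Qed.

Lemma pi0 U (S : set U) : \pi_(quot S) 0 = 0.
Proof. exact: lin0 (@pi_linear _ _ S). Qed.

Lemma pi_eq0 U (S : set U) : submodule S -> forall x, \pi_(quot S) x = 0 <-> S x.
Proof. by move=> mS x; rewrite -(pi0 S) cls_eqP subr0 submodule_span. Qed.

Lemma submodule_lift U (S : set U) (mS : submodule S) x : S x -> exists z : sub S, val z = x.
Proof.
move=> Sx; have h : spanb S x by apply/asboolP/submodule_span.
by exists (exist _ x h).
Qed.

Lemma sub_valP U (S : set U) (mS : submodule S) (z : sub S) : S (val z).
Proof. by case: z => z /= /asboolP; rewrite submodule_span. Qed.

Lemma val_linear U (S : set U) : linear (val : sub S -> U).
Proof. by []. Qed.

Lemma submodule_comap U V (f : U -> V) (S : set V) : linear f -> submodule S ->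
  submodule [set x | S (f x)].
Proof. by move=> lf [S0 h]; split=> [|c x y hx hy] /=; rewrite ?(lin0 lf) ?lf //; apply: h. Qed.

(** A relation that is total in both directions between [Z] and [Z'] and matches [B] with [B']
    induces the graph of a bijection on the quotients. When [Z'] is a kernel and [B'] an image, the
    target unfolds to [homology]; this is how pages are compared. *)
Lemma subquot_iso U V (Z B : set U) (Z' B' : set V) (R : U -> V -> Prop) :
  submodule Z -> submodule B -> submodule Z' -> submodule B' -> linear_rel R ->
  (forall x, Z x -> exists2 y, Z' y & R x y) ->
  (forall y, Z' y -> exists2 x, Z x & R x y) ->
  (forall x y, Z x -> Z' y -> R x y -> B x <-> B' y) ->
  linear_iso (quot [set z : sub Z | B (val z)]) (quot [set z : sub Z' | B' (val z)]).
Proof.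
move=> mZ mB mZ' mB' lR h1 h2 h3.
have mq := submodule_comap (@val_linear _ Z) mB.
have mq' := submodule_comap (@val_linear _ Z') mB'.
apply: (@rel_iso _ _ (fun u v => exists (z : sub Z) (z' : sub Z'),
  [/\ R (val z) (val z'), u = \pi_(quot _) z & v = \pi_(quot _) z'])).
- split=> [|c u u' v v' [z [w [r -> ->]]] [z' [w' [r' -> ->]]]].
    by exists 0, 0; rewrite !pi0; split=> //; apply: lR.1.
  exists (c *: z + z'), (c *: w + w'); rewrite !pi_linear; split=> //.
  exact: lR.2.
- move=> u; have [y /(submodule_lift mZ')[z' <-] r] := h1 _ (sub_valP mZ (repr u)).
  by exists (\pi_(quot _) z'), (repr u), z'; rewrite reprK.
- move=> u; have [y /(submodule_lift mZ)[z' <-] r] := h2 _ (sub_valP mZ' (repr u)).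
  by exists (\pi_(quot _) z'), z', (repr u); rewrite reprK.
- move=> _ [z [z' [r /esym/(pi_eq0 mq) hz ->]]]; apply/(pi_eq0 mq').
  by apply/(h3 _ _ _ _ r) => //; apply: sub_valP.
- move=> _ [z [z' [r -> /esym/(pi_eq0 mq') hz]]]; apply/(pi_eq0 mq).
  by apply/(h3 _ _ _ _ r) => //; apply: sub_valP.
Qed.

Lemma complement U (S : set U) : submodule S -> exists W : set U,
  [/\ submodule W, forall x, W x -> S x -> x = 0
    & forall x, exists2 w, W w & S (x - w)].
Proof.
move=> mS.
(* Membership of 0 is left out of [P], so that the empty set, which is the union of the empty chain,
   satisfies it; maximality gives 0 back. *)
pose P (W : set U) : Prop :=
  (forall (c : k) x y, W x -> W y -> W (c *: x + y)) /\ forall x, W x -> S x -> x = 0.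
have [|W [[cW WS] maxW]] := Zorn_bigcup (P := P).
  move=> F FP tF; split=> [c x y [X FX Xx] [Y FY Yy]|x [X FX Xx]]; last exact: (FP X FX).2.
  have [XY|YX] := tF _ _ FX FY.
    by exists Y => //; apply: (FP Y FY).1 => //; apply: XY.
  by exists X => //; apply: (FP X FX).1 => //; apply: YX.
have W0 : W 0.
  have [[x Wx]|nW] := pselect (exists x, W x).
    by have := cW (-1) x x Wx Wx; rewrite scaleN1r addNr.
  case: (maxW [set 0]).
    split=> [x Wx|]; first by case: nW; exists x.
    by move=> /(_ 0 erefl) h; apply: nW; exists 0.
  by split=> [c x y -> ->|x ->] //; rewrite /= scaler0 addr0.
exists W; split=> // x; apply: contrapT => nx.
(* If [x] were not in [W + S], then [W + k x] would be strictly larger and would still meet [S] only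
   in 0. *)
have sW : W `<` [set y | exists c w, W w /\ y = c *: x + w].
  split=> [w Ww|h]; first by exists 0, w; rewrite scale0r add0r.
  apply: nx; exists x; last by rewrite subrr; apply: mS.1.
  by apply: h; exists 1, 0; rewrite scale1r addr0.
apply: (maxW _ sW); split=> [c _ _ [a [w [Ww ->]]] [b [w' [Ww' ->]]]|_ [c [w [Ww ->]]] Sy].
  exists (c * a + b), (c *: w + w'); split; first exact: cW.
  by rewrite scalerDr scalerDl scalerA addrACA.
have [c0|c0] := eqVneq c 0; first by move: Sy; rewrite c0 scale0r add0r; apply: WS.
case: nx; exists (- c^-1 *: w); first by rewrite -[_ *: w]addr0; apply: cW.
rewrite scaleNr opprK -[x](scalerK c0) -scalerDr -[_ *: _]addr0.
by apply: mS.2 => //; apply: mS.1.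
Qed.

(** Here [s v] is the unique [w] in a complement of the kernel such that [v - f w] lies in a
    complement of the image. Exactness of tensoring over [k] rests on this. *)
Lemma pseudo_inverse U V (f : U -> V) : linear f ->
  exists2 s : V -> U, linear s & forall x, f (s (f x)) = f x.
Proof.
move=> lf.
have [W [mW W0 hW]] := complement (submodule_ker lf).
have [W' [mW' W'0 hW']] := complement (submodule_im lf).
have uniq w w' : W w -> W w' -> W' (f w - f w') -> w = w'.
  move=> Ww Ww' h; apply/eqP; rewrite -subr_eq0; apply/eqP/W0; first exact: submoduleB.
  by rewrite /= linB //; apply: W'0 => //; exists (w - w'); rewrite linB.
have ex v : exists w, W w /\ W' (v - f w).
  have [w' Ww' [x hx]] := hW' v; have [w Ww hw] := hW x.
  exists w; split=> //; suff -> : f w = v - w' by rewrite opprB addrCA subrr addr0.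
  by rewrite -hx; apply/esym/eqP; rewrite -subr_eq0 -linB //; apply/eqP.
have /choice[s hs] := ex.
exists s => [c x y|x].
  have [Wx Vx] := hs x; have [Wy Vy] := hs y; have [Wz Vz] := hs (c *: x + y).
  apply: uniq => //; first exact: mW.2.
  have -> : f (s (c *: x + y)) - f (c *: s x + s y) =
      (c *: (x - f (s x)) + (y - f (s y))) - (c *: x + y - f (s (c *: x + y))).
    by rewrite lf scalerBr addrACA -opprD opprB [RHS]addrC addrA addrNK.
  by apply: submoduleB => //; apply: mW'.2.
have [Wx Vx] := hs (f x); apply/esym/eqP; rewrite -subr_eq0; apply/eqP/W'0 => //.
by exists (x - s (f x)); rewrite linB.
Qed.
End LinearMaps.

(** * Filtered complexes *)

Section FilteredComplex.
Variables (k : fieldType) (V : lmodType k) (D : V -> V).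
Variables (F G : int -> set V).
Hypotheses (lD : linear D) (DD : forall x, D (D x) = 0).
Hypotheses (mF : forall p, submodule (F p)) (mG : forall n, submodule (G n)).
Hypothesis leF : forall p p' x, F p x -> (p <= p')%R -> F p' x.
Hypothesis DG : forall n n' x, G n x -> n' = n - 1 -> G n' (D x).

(** The classical [Z^r_{p,q}] of a filtered complex. The index [r] is an integer so that [r - 1] can
    be formed on every page. *)
Definition cycles (r p q : int) : set V :=
  [set x | [/\ F p x, G (p + q) x & F (p - r) (D x)]].

(** The classical denominator [Z^{r-1}_{p-1,q+1} + D Z^{r-1}_{p+r-1,q-r+2}] of [E^r_{p,q}]; the
    second index of [b] puts it in total degree [p + q + 1]. *)
Definition boundaries (r p q : int) : set V :=
  [set x | exists a b, [/\ x = a + D b, cycles (r - 1) (p - 1) (q + 1) a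
                         & cycles (r - 1) (p + r - 1) (q - r + 2) b]].

Lemma cycles_submodule r p q : submodule (cycles r p q).
Proof.
split=> [|c x y [Fx Gx Dx] [Fy Gy Dy]].
  by split; [apply: (mF _).1 | apply: (mG _).1 | rewrite lin0 //; apply: (mF _).1].
by split; [apply: (mF _).2 | apply: (mG _).2 | rewrite lD; apply: (mF _).2].
Qed.

Lemma boundaries_submodule r p q : submodule (boundaries r p q).
Proof.
split=> [|c _ _ [a [b [-> Za Zb]]] [a' [b' [-> Za' Zb']]]].
  by exists 0, 0; rewrite lin0 // addr0; split=> //; apply: (cycles_submodule _ _ _).1.
exists (c *: a + a'), (c *: b + b'); split; try exact: (cycles_submodule _ _ _).2.
by rewrite lD scalerDr addrACA.
Qed.

Lemma cyclesE r p q r' p' q' x : cycles r p q x ->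
  (p <= p')%R -> p + q = p' + q' -> (p - r <= p' - r')%R -> cycles r' p' q' x.
Proof.
move=> [Fx Gx Dx] hp hq hr; split; [exact: leF hp| by rewrite -hq|exact: leF hr].
Qed.

Definition fpage (r : nat) (p q : int) : lmodType k :=
  quot [set z : sub (cycles r%:Z p q) | boundaries r%:Z p q (val z)].

Lemma fpage_rel r p q : submodule [set z : sub (cycles r%:Z p q) | boundaries r%:Z p q (val z)].
Proof. exact: submodule_comap (@val_linear _ _ _) (boundaries_submodule _ _ _). Qed.

Lemma fpage_repr r p q (u : fpage r p q) :
  exists2 z : sub (cycles r%:Z p q), u = \pi z & cycles r%:Z p q (val z).
Proof.
by exists (repr u); rewrite ?reprK //; apply: sub_valP => //; apply: cycles_submodule.
Qed.

Lemma fpage_eq0 r p q (z : sub (cycles r%:Z p q)) :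
  \pi_(fpage r p q) z = 0 <-> boundaries r%:Z p q (val z).
Proof. exact: (pi_eq0 (fpage_rel _ _ _)). Qed.

(** The record [spectral_sequence] asks for a map between any two bidegrees; away from the target
    [(p - r, q + r - 1)] the zero map is supplied. At the target the class of [D z] does not depend
    on the representative [z]: [D] kills the summand [D b] of a boundary and sends the summand [a]
    to a boundary of the second kind. *)
Lemma fdiff_exists (r : nat) (p q p' q' : int) :
  exists d : {linear fpage r p q -> fpage r p' q'},
    p' = p - r%:Z -> q' = q + r%:Z - 1 ->
    forall (z : sub (cycles r%:Z p q)) (z' : sub (cycles r%:Z p' q')),
      val z' = D (val z) -> d (\pi z) = \pi z'.
Proof.
have [[hp hq]|h] := pselect (p' = p - r%:Z /\ q' = q + r%:Z - 1); last first.
  have [d _] := bundle_linear (@linear_zero k (fpage r p q) (fpage r p' q')).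
  by exists d => hp hq; case: h.
have mZ : forall p q, submodule (cycles r%:Z p q) by move=> *; apply: cycles_submodule.
have ex (u : fpage r p q) : exists v : fpage r p' q',
    exists2 z : sub (cycles r%:Z p q), u = \pi z &
    exists2 z' : sub (cycles r%:Z p' q'), v = \pi z' & val z' = D (val z).
  have [z uz [Fz Gz Dz]] := fpage_repr u.
  have /(submodule_lift (mZ _ _))[z' hz'] : cycles r%:Z p' q' (D (val z)).
    split; [by rewrite hp| by apply: DG Gz _; lia | by rewrite DD; apply: (mF _).1].
  by exists (\pi z'), z => //; exists z'.
have [d hd] := choice ex.
have dE z z' : val z' = D (val z) -> d (\pi z) = \pi z'.
  move=> e; have [y zy [y' -> ey]] := hd (\pi z).
  apply/eqP; rewrite -subr_eq0 -(linB (@pi_linear _ _ _)); apply/eqP/fpage_eq0.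
  have /fpage_eq0[a [b [e' Za Zb]]] : \pi_(fpage r p q) (y - z) = 0.
    by rewrite (linB (@pi_linear _ _ _)) zy subrr.
  rewrite /= in e'; rewrite /= ey e -linB // e' linD // DD addr0.
  exists 0, a; rewrite add0r; split=> //; first exact: (cycles_submodule _ _ _).1.
  by apply: cyclesE Za _ _ _; lia.
have ld : linear d.
  move=> c u v; have [x ux [x' -> ex']] := hd u; have [y vy [y' -> ey]] := hd v.
  rewrite ux vy -!pi_linear; apply: dE.
  by rewrite !val_linear ex' ey lD.
have [g hg] := bundle_linear ld.
by exists g => _ _ z z' /dE <-; rewrite hg.
Qed.

Definition fdiff (r : nat) (p q p' q' : int) : {linear fpage r p q -> fpage r p' q'} :=
  projT1 (cid (fdiff_exists r p q p' q')).

Lemma fdiffE (r : nat) (p q p' q' : int) : p' = p - r%:Z -> q' = q + r%:Z - 1 ->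
  forall (z : sub (cycles r%:Z p q)), 
    exists2 z' : sub (cycles r%:Z p' q'), val z' = D (val z) & fdiff r p q p' q' (\pi z) = \pi z'.
Proof.
move=> hp hq z; rewrite /fdiff; case: cid => /= d /(_ hp hq) h.
have mZ := cycles_submodule r%:Z p' q'.
have [Fz Gz Dz] := sub_valP (cycles_submodule _ _ _) z.
have /(submodule_lift mZ)[z' hz'] : cycles r%:Z p' q' (D (val z)).
  split; [by rewrite hp| by apply: DG Gz _; lia | by rewrite DD; apply: (mF _).1].
by exists z' => //; apply: h.
Qed.

Lemma fdiff_diff (r : nat) (p q p' q' p'' q'' : int) : (2 <= r)%N ->
  p' = p - r%:Z -> q' = q + r%:Z - 1 -> p'' = p' - r%:Z -> q'' = q' + r%:Z - 1 ->
  forall x, fdiff r p' q' p'' q'' (fdiff r p q p' q' x) = 0.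
Proof.
move=> _ hp hq hp' hq' u; have [z -> _] := fpage_repr u.
have [z' e ->] := fdiffE hp hq z; have [z'' e' ->] := fdiffE hp' hq' z'.
apply/fpage_eq0; rewrite e' e DD; exact: (boundaries_submodule _ _ _).1.
Qed.

(** An element of [Z^{r+1}] is related to its class in [E^r]. A class killed by the differential has
    a representative in [Z^{r+1}]: if [D z = a + D b], then [z - b] is one, and [b] lies in
    [Z^{r-1}_{p-1,q+1}], so it is a boundary. *)
Lemma fpage_next (r : nat) (p q : int) : (2 <= r)%N ->
  linear_iso (fpage r.+1 p q)
    (homology (fdiff r (p + r%:Z) (q - r%:Z + 1) p q)
              (fdiff r p q (p - r%:Z) (q + r%:Z - 1))).
Proof.
move=> r2; have mZ r p q := cycles_submodule r p q.
have d1 := @fdiffE r (p + r%:Z) (q - r%:Z + 1) p q.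
have d2 := @fdiffE r p q (p - r%:Z) (q + r%:Z - 1) erefl erefl.
apply: (@subquot_iso k V (fpage r p q) (cycles r.+1%:Z p q) (boundaries r.+1%:Z p q)
  [set x | fdiff r p q (p - r%:Z) (q + r%:Z - 1) x = 0]
  [set x | exists y, fdiff r (p + r%:Z) (q - r%:Z + 1) p q y = x]
  (fun x u => exists2 z : sub (cycles r%:Z p q), val z = x & u = \pi z)).
- exact: mZ.
- exact: boundaries_submodule.
- exact/submodule_ker/linear_bundled.
- exact/submodule_im/linear_bundled.
- split=> [|c _ _ _ _ [z <- ->] [z' <- ->]]; first by exists 0; rewrite ?pi0.
  by exists (c *: z + z'); rewrite ?pi_linear.
- move=> x Zx; have [|z hz] := @submodule_lift k V _ (mZ r%:Z p q) x.
    by apply: cyclesE Zx _ _ _; lia.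
  exists (\pi z); last by exists z.
  have [z' e /= ->] := d2 z; apply/fpage_eq0.
  exists (val z'), 0; rewrite lin0 // addr0; split=> //; last exact: (mZ _ _ _).1.
  have [_ _ _] := Zx; have [Fz' Gz' Dz'] := sub_valP (mZ _ _ _) z'.
  split; [|by move: Gz'; congr (G _ _); lia|by rewrite e DD; apply: (mF _).1].
  by rewrite e hz; case: Zx => _ _ h; apply: leF h _; lia.
- move=> u /= du; have [z uz Zz] := fpage_repr u; rewrite uz in du *.
  have [z' e e'] := d2 z; move: du; rewrite e' => /fpage_eq0[a [b [h Za Zb]]].
  have Zrb : cycles r%:Z p q b by apply: cyclesE Zb _ _ _; lia.
  have [w hw] := submodule_lift (mZ _ _ _) Zrb.
  exists (val z - b); last first.
    exists (z - w); first by rewrite /= hw.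
    apply/eqP; rewrite -subr_eq0 -linB; last exact: pi_linear.
    rewrite opprB addrC subrK; apply/eqP/fpage_eq0; rewrite hw.
    exists b, 0; rewrite lin0 // addr0; split=> //; last exact: (mZ _ _ _).1.
    by apply: cyclesE Zb _ _ _; lia.
  have [Fz Gz Dz] := Zz; have [Fb Gb Db] := Zrb; have [Fa Ga Da] := Za.
  split; [exact: submoduleB|exact: submoduleB|].
  by rewrite linB // -e h addrK; apply: leF Fa _; lia.
move=> x u Zx du [z hz ->]; rewrite -{x}hz in Zx *; split=> [[a [b [e Za Zb]]]|].
  have Zrb : cycles r%:Z (p + r%:Z) (q - r%:Z + 1) b by apply: cyclesE Zb _ _ _; lia.
  have [w hw] := submodule_lift (mZ _ _ _) Zrb; exists (\pi w).
  have [||z' e' ->] := d1 _ _ w; try lia.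
  apply/eqP; rewrite -subr_eq0 -(linB (@pi_linear _ _ _)); apply/eqP/fpage_eq0.
  exists (- a), 0; rewrite /= e' hw e lin0 // opprD addr0 addrCA subrr addr0; split=> //; last exact: (mZ _ _ _).1.
  apply: submoduleN => //.
  by apply: cyclesE Za _ _ _; lia.
case=> v; have [w -> Zw] := fpage_repr v.
have [||z' e' ->] := d1 _ _ w; try lia.
move/eqP; rewrite -subr_eq0 -(linB (@pi_linear _ _ _)) => /eqP/fpage_eq0[a [b [e Za Zb]]].
have ez : val z = - a + D (val w - b).
  by rewrite linB // -e' addrCA -opprD -e /= opprB addrC subrK.
exists (- a), (val w - b); split=> //.
  apply: submoduleN => //.
  have [Fa Ga Da] := Za; split=> //.
  (* So far [a] is only in [Z^{r-1}]. This identity gives [D a = - D z], which has filtration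
     [p - r - 1]; hence [a] is in [Z^r], as the boundaries of page [r + 1] demand. *)
  have -> : a = D (val w - b) - val z by rewrite ez opprD opprK addrCA subrr addr0.
  rewrite linB // DD sub0r; apply: submoduleN => //.
  by case: Zx => _ _ h; apply: leF h _; lia.
apply: submoduleB => //; first by apply: cyclesE Zw _ _ _; lia.
by apply: cyclesE Zb _ _ _; lia.
Qed.

Definition filtered_ss : spectral_sequence k := SpectralSequence fdiff_diff fpage_next.

Hypothesis F_neg : forall p x, (p < 0)%R -> F p x -> x = 0.
Hypothesis G_F : forall n p x, G n x -> (n <= p)%R -> F p x.

Lemma fpage_neg (r : nat) p q : (p < 0)%R -> forall x : fpage r p q, x = 0.
Proof.
move=> p0 u; have [z -> [Fz _ _]] := fpage_repr u.
by apply/fpage_eq0; rewrite (F_neg p0 Fz); apply: (boundaries_submodule _ _ _).1.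
Qed.

(** For [q < 0] the total degree is at most [p - 1], so every cycle already has filtration [p - 1]
    and is itself the first summand of a boundary. *)
Lemma fpage_neg_compl (r : nat) p q : (q < 0)%R -> forall x : fpage r p q, x = 0.
Proof.
move=> q0 u; have [z -> [Fz Gz Dz]] := fpage_repr u.
apply/fpage_eq0; exists (val z), 0; rewrite lin0 // addr0; split=> //.
  split; [by apply: G_F Gz _; lia|by move: Gz; congr (G _ _); lia|].
  by apply: leF Dz _; lia.
exact: (cycles_submodule _ _ _).1.
Qed.

Lemma filtered_first_quadrant : first_quadrant filtered_ss.
Proof. by move=> p q /orP[|] h x; [apply: fpage_neg|apply: fpage_neg_compl]. Qed.

Variables (T : nat -> lmodType k) (L : forall n, V -> T n -> Prop).
Arguments L : clear implicits.
Hypothesis lL : forall n, linear_rel (L n).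
Hypothesis L_dom : forall n x t, L n x t -> G n%:Z x /\ D x = 0.
Hypothesis L_total : forall n x, G n%:Z x -> D x = 0 -> exists t, L n x t.
Hypothesis L_surj : forall n t, exists x, L n x t.
Hypothesis L_fun : forall n t, L n 0 t -> t = 0.
Hypothesis L_eq0 : forall n x, L n x 0 -> exists2 b, G n.+1%:Z b & D b = x.
Hypothesis L_bound : forall n b, G n.+1%:Z b -> L n (D b) 0.

(** [T n] is known only through [L n], which presents it as cycles of degree [n] modulo boundaries;
    it is filtered by the classes having a representative in [F p]. *)
Lemma filtered_converges : converges_to filtered_ss T.
Proof.
move=> n; pose FT (p : int) : set (T n) := [set t | exists2 x, F p x & L n x t].
have mFT p : submodule (FT p).
  split=> [|c x y [a Fa La] [b Fb Lb]].
    by exists 0; [apply: (mF _).1 | apply: (lL _).1].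
  by exists (c *: a + b); [apply: (mF _).2 | apply: (lL _).2].
exists FT; split=> //.
- by move=> p x [a Fa La]; exists a => //; apply: leF Fa _; lia.
- exists (-1), n%:Z; split; apply/seteqP; split=> x //.
  + by case=> a /F_neg -> // /L_fun.
  + by move=> ->; exists 0; [apply: (mF _).1|apply: (lL _).1].
  + by move=> _; have [a La] := L_surj x; exists a => //; apply: (@G_F n%:Z); [case: (L_dom La)|].
(* From this [r] on, [p - r < 0] kills the target of the outgoing differential, [q - r + 1 < 0]
   kills the source of the incoming one, and [n + 1 <= p + r - 1] puts every element of degree
   [n + 1] into the filtration that [boundaries] asks of [b]. *)
move=> p q pq; exists (`|p|%N + n + 2)%N => r hr; split.
- by move=> x; apply: fpage_neg; lia.
- move=> x; rewrite (_ : x = 0); first exact: lin0 (linear_bundled _).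
  by apply: fpage_neg_compl; lia.
have Zr x : cycles r%:Z p q x -> D x = 0 by case=> _ _; apply: F_neg; lia.
apply: (@subquot_iso k V (T n) (cycles r%:Z p q) (boundaries r%:Z p q) (FT p) (FT (p - 1)) (L n)) => //.
- exact: cycles_submodule.
- exact: boundaries_submodule.
- move=> x Zx; have [|t Lt] := @L_total n x _ (Zr x Zx); first by case: Zx; rewrite pq.
  by exists t => //; exists x => //; case: Zx.
- move=> t [x Fx Lx]; exists x => //; have [Gx Dx] := L_dom Lx.
  by split; rewrite ?pq ?Dx //; apply: (mF _).1.
move=> x t Zx _ Lx; split=> [[a [b [e Za Zb]]]|[a Fa La]].
  exists a; first by case: Za.
  have -> : a = x - D b by rewrite e addrK.
  rewrite -[t]subr0; apply: linear_relB => //; apply: L_bound.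
  by case: Zb => _ Gb _; move: Gb; congr (G _ _); lia.
have [|b Gb Db] := @L_eq0 n (x - a); first by rewrite -(subrr t); apply: linear_relB.
have [Ga Da] := L_dom La; have [Gx Dx] := L_dom Lx; have [Fx _ _] := Zx.
exists a, b; split; first by rewrite Db addrC subrK.
  by split=> //; [move: Ga; congr (G _ _); lia|rewrite Da; apply: (mF _).1].
split; [by apply: G_F Gb _; lia|by move: Gb; congr (G _ _); lia|rewrite Db].
apply: submoduleB => //; first by apply: leF Fx _; lia.
by apply: leF Fa _; lia.
Qed.
End FilteredComplex.

(** * Double complexes *)

Section BigradedFamilies.
Variables (k : fieldType) (X : nat -> nat -> lmodType k).

(** The full product over all bidegrees. As [i] and [j] are natural numbers, a total degree meets
    finitely many bidegrees, so [in_degree n] is the usual term of the total complex. *)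
Definition family2 : Type := forall i j, X i j.
Implicit Types x y z : family2.

HB.instance Definition _ := gen_eqMixin family2.
HB.instance Definition _ := gen_choiceMixin family2.

Lemma family2P x y : (forall i j, x i j = y i j) -> x = y.
Proof. by move=> h; apply: functional_extensionality_dep => i; apply: functional_extensionality_dep. Qed.

Definition family2_add x y : family2 := fun i j => x i j + y i j.
Definition family2_opp x : family2 := fun i j => - x i j.
Definition family2_zero : family2 := fun i j => 0.
Definition family2_scale (c : k) x : family2 := fun i j => c *: x i j.

Lemma family2_addA : associative family2_add.
Proof. by move=> x y z; apply: family2P => i j; apply: addrA. Qed.
Lemma family2_addC : commutative family2_add.
Proof. by move=> x y; apply: family2P => i j; apply: addrC. Qed.
Lemma family2_add0 : left_id family2_zero family2_add.
Proof. by move=> x; apply: family2P => i j; apply: add0r. Qed.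
Lemma family2_addN : left_inverse family2_zero family2_opp family2_add.
Proof. by move=> x; apply: family2P => i j; apply: addNr. Qed.
HB.instance Definition _ := GRing.isZmodule.Build family2
  family2_addA family2_addC family2_add0 family2_addN.

Lemma family2_scaleA a b x : family2_scale a (family2_scale b x) = family2_scale (a * b) x.
Proof. by apply: family2P => i j; apply: scalerA. Qed.
Lemma family2_scale1 : left_id 1 family2_scale.
Proof. by move=> x; apply: family2P => i j; apply: scale1r. Qed.
Lemma family2_scaleDr : right_distributive family2_scale +%R.
Proof. by move=> c x y; apply: family2P => i j; apply: scalerDr. Qed.
Lemma family2_scaleDl x : {morph family2_scale^~ x : a b / a + b}.
Proof. by move=> a b; apply: family2P => i j; apply: scalerDl. Qed.
HB.instance Definition _ := GRing.Zmodule_isLmodule.Build k family2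
  family2_scaleA family2_scale1 family2_scaleDr family2_scaleDl.

Lemma family2D x y i j : (x + y) i j = x i j + y i j. Proof. by []. Qed.
Lemma family2N x i j : (- x) i j = - x i j. Proof. by []. Qed.
Lemma family2Z c x i j : (c *: x) i j = c *: x i j. Proof. by []. Qed.
Lemma family20 i j : (0 : family2) i j = 0. Proof. by []. Qed.
Definition family2E := (family2D, family2N, family2Z, family20).

(** Bidegrees are compared as pairs, so that one cast transports [c]; the next lemmas hide it. *)
Definition single i j (c : X i j) : family2 := fun i' j' =>
  match pselect ((i, j) = (i', j')) with
  | left e => ecast p (X p.1 p.2) e c
  | right _ => 0
  end.

Lemma single_same i j (c : X i j) : single c i j = c.
Proof.
rewrite /single; case: pselect => // e.
by rewrite (Prop_irrelevance e erefl).
Qed.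

Lemma single_other i j (c : X i j) i' j' : (i, j) <> (i', j') -> single c i' j' = 0.
Proof. by rewrite /single; case: pselect. Qed.

Lemma single_other1 i j (c : X i j) i' j' : (i != i') || (j != j') -> single c i' j' = 0.
Proof. by move=> h; apply: single_other => -[e e']; move: h; rewrite e e' !eqxx. Qed.

Lemma single0 i j i' j' : single (0 : X i j) i' j' = 0.
Proof.
have [ei|ni] := eqVneq i i'; last by rewrite single_other1 // ni.
have [ej|nj] := eqVneq j j'; last by rewrite single_other1 // nj orbT.
by subst i' j'; rewrite single_same.
Qed.

Definition in_degree (n : int) : set family2 :=
  [set x | forall i j, i%:Z + j%:Z <> n -> x i j = 0].
Definition in_columns (p : int) : set family2 :=
  [set x | forall i j, (p < i%:Z)%R -> x i j = 0].

Lemma in_degree_submodule n : submodule (in_degree n).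
Proof. by split=> [//|c x y hx hy i j h]; rewrite !family2E hx // hy // scaler0 addr0. Qed.
Lemma in_columns_submodule p : submodule (in_columns p).
Proof. by split=> [//|c x y hx hy i j h]; rewrite !family2E hx // hy // scaler0 addr0. Qed.

Lemma in_columns_le p p' x : in_columns p x -> (p <= p')%R -> in_columns p' x.
Proof. by move=> h pp' i j hi; apply: h; lia. Qed.
Lemma in_columns_neg p x : (p < 0)%R -> in_columns p x -> x = 0.
Proof. by move=> p0 h; apply: family2P => i j; apply: h; lia. Qed.
Lemma in_degree_columns n p x : in_degree n x -> (n <= p)%R -> in_columns p x.
Proof. by move=> h pp' i j hi; apply: h; lia. Qed.

Lemma single_degree i j (c : X i j) n : n = i%:Z + j%:Z -> in_degree n (single c).
Proof. by move=> -> i' j' h; apply: single_other => -[] e e'; case: h; rewrite e e'. Qed.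
End BigradedFamilies.

Section DoubleComplex.
Variables (k : fieldType) (X : nat -> nat -> lmodType k).
Variables (dh : forall i j, X i.+1 j -> X i j) (dv : forall i j, X i j.+1 -> X i j).
Arguments dh : clear implicits.
Arguments dv : clear implicits.

Record double_complex : Prop := DoubleComplex {
  dh_linear : forall i j, linear (dh i j);
  dv_linear : forall i j, linear (dv i j);
  dh_dh : forall i j x, dh i j (dh i.+1 j x) = 0;
  dv_dv : forall i j x, dv i j (dv i j.+1 x) = 0;
  dh_dv : forall i j x, dh i j (dv i.+1 j x) = dv i j (dh i j.+1 x)
}.
Hypothesis dc : double_complex.
Let lh := dh_linear dc.
Let lv := dv_linear dc.
Arguments lh : clear implicits.
Arguments lv : clear implicits.

(** As [dh] and [dv] commute, the sign on [dv] is what makes the square vanish. *)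
Definition total_d (x : family2 X) : family2 X :=
  fun i j => dh i j (x i.+1 j) + (-1) ^+ i *: dv i j (x i j.+1).

Lemma total_d_linear : linear total_d.
Proof.
move=> c x y; apply: family2P => i j; rewrite !family2E /total_d !family2E (lh _ _) (lv _ _).
by rewrite !scalerDr addrACA !scalerA [c * _]mulrC.
Qed.
Let lD := total_d_linear.

Lemma total_d_d x : total_d (total_d x) = 0.
Proof.
apply: family2P => i j; rewrite /total_d (linD (lh _ _)) (linD (lv _ _)).
rewrite !(linZ (lh _ _)) !(linZ (lv _ _)) dh_dh // dv_dv // dh_dv // scaler0 addr0 add0r.
by rewrite exprS mulN1r scaleNr addNr.
Qed.

Lemma total_d_degree n n' x : in_degree n x -> n' = n - 1 -> in_degree n' (total_d x).
Proof.
move=> h e i j hij; rewrite /total_d !h; try lia.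
by rewrite (lin0 (lh _ _)) (lin0 (lv _ _)) scaler0 addr0.
Qed.

Lemma sign_scaleK (V : lmodType k) i (v : V) : (-1) ^+ i *: ((-1) ^+ i *: v) = v.
Proof. by rewrite scalerA -expr2 sqrr_sign scale1r. Qed.

Section Augmented.
Variables (B : nat -> lmodType k) (dB : forall j, B j.+1 -> B j) (eps : forall j, X 0 j -> B j).
Arguments dB : clear implicits.
Arguments eps : clear implicits.

(** It is the rows that are exact: row [j], augmented by [eps j], resolves [B j], and [B] is an
    additional column on the left. *)
Record column_resolution : Prop := ColumnResolution {
  eps_linear : forall j, linear (eps j);
  dB_linear : forall j, linear (dB j);
  eps_dv : forall j x, eps j (dv 0 j x) = dB j (eps j.+1 x);
  eps_surj : forall j b, exists x, eps j x = b;
  eps_dh : forall j x, eps j (dh 0 j x) = 0;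
  eps_exact : forall j x, eps j x = 0 -> exists y, dh 0 j y = x;
  dh_exact : forall i j x, dh i j x = 0 -> exists y, dh i.+1 j y = x
}.
Hypothesis cr : column_resolution.
Let le := eps_linear cr.
Let lB := dB_linear cr.
Arguments le : clear implicits.
Arguments lB : clear implicits.

(* A staircase: starting from an entry c whose vertical boundary is killed by
   the horizontal differential (or augmentation), correct it further and
   further to the right. *)
Definition left_cycle i j (c : X i j) : Prop :=
  match i return X i j -> Prop with
  | 0 => fun c => eps j c = 0
  | i'.+1 => fun c => dh i' j c = 0
  end c.

Lemma left_cycle_exact i j (c : X i j) : left_cycle c -> exists y, dh i j y = c.
Proof. by case: i c => [|i] c /= h; [apply: eps_exact | apply: dh_exact]. Qed.

Lemma left_cycleZ i j a (c : X i j) : left_cycle c -> left_cycle (a *: c).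
Proof.
case: i c => [|i] c /= h; first by rewrite (linZ (le _)) h scaler0.
by rewrite (linZ (lh _ _)) h scaler0.
Qed.

Definition dv_left_cycle i j (c : X i j) : Prop :=
  match j return X i j -> Prop with
  | 0 => fun _ => True
  | j'.+1 => fun c => left_cycle (dv i j' c)
  end c.

(** The next entry [c'], at [(i + 1, j)], is chosen with [dh c' = - (-1)^i dv c], which cancels the
    contribution of [c] in column [i]. The hypothesis passes to [c'] because
    [dh (dv c') = dv (dh c')] is a multiple of [dv (dv c) = 0]; the descent ends in row 0. *)
Lemma staircase j i (c : X i j) : dv_left_cycle c ->
  exists y : family2 X, [/\ y i j = c, in_degree (i%:Z + j%:Z) y,
    forall i' j', (i' < i)%N -> y i' j' = 0
    & forall i' j', (i <= i')%N -> total_d y i' j' = 0].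
Proof.
elim: j i c => [|j IH] i c /=.
  move=> _; exists (single c); split=> [|||i' j' hi].
  - exact: single_same.
  - exact: single_degree.
  - by move=> i' j' hi; apply: single_other1; lia.
  by rewrite /total_d !single_other1 ?(lin0 (lh _ _)) ?(lin0 (lv _ _)) ?scaler0 ?addr0 //; lia.
move=> hc; have [c' hc'] := left_cycle_exact (left_cycleZ (- (-1) ^+ i) hc).
have [|y [yc dy ly Dy]] := IH i.+1 c'.
  case: j c hc c' hc' {IH} => //= j c hc c' hc'.
  by rewrite (dh_dv dc) hc' (linZ (lv _ _)) (dv_dv dc) scaler0.
exists (single c + y); split.
- by rewrite !family2E single_same ly ?addr0.
- apply: (submoduleD (in_degree_submodule _ _)); first exact: single_degree.
  by move=> i' j' h; apply: dy; lia.
- by move=> i' j' h; rewrite !family2E ly; [rewrite single_other1 ?addr0 //; lia|lia].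
move=> i' j' hi; rewrite (linD lD) family2E.
have [hi'|hi'] := ltnP i i'.
  rewrite Dy // addr0 /total_d !single_other1; try lia.
  by rewrite (lin0 (lh _ _)) (lin0 (lv _ _)) scaler0 addr0.
have {hi hi'} -> : i' = i by lia.
have [->|hj] := eqVneq j' j.
  rewrite /total_d single_same [single c _ j]single_other1; last lia.
  rewrite yc hc' [y i _]ly // (lin0 (lh _ _)) (lin0 (lv _ _)) scaler0 addr0 add0r.
  by rewrite scaleNr subrr.
rewrite (@total_d_degree _ _ (single c) (single_degree c erefl) erefl) ?add0r; last lia.
by rewrite (@total_d_degree _ _ y dy erefl) //; lia.
Qed.

Lemma augmentation_surj n (b : B n) : d_out dB b = 0 ->
  exists y : family2 X, [/\ in_degree n%:Z y, total_d y = 0 & eps n (y 0%N n) = b].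
Proof.
move=> hb; have [c hc] := eps_surj cr b.
have [|y [yc dy _ Dy]] := @staircase n 0 c.
  by case: n b hb c hc => //= n b hb c hc; rewrite (eps_dv cr) hc.
by exists y; split; [rewrite -[n%:Z]add0r| apply: family2P => i j; apply: Dy | rewrite yc].
Qed.

Lemma augmentation_cycle n (y : family2 X) : total_d y = 0 -> d_out dB (eps n (y 0%N n)) = 0.
Proof.
case: n => //= n /(congr1 (fun x : family2 X => eps n (x 0%N n))).
by rewrite /total_d expr0 scale1r (linD (le _)) (eps_dh cr) add0r (eps_dv cr) (lin0 (le _)).
Qed.

Lemma augmentation_boundary n (y : family2 X) :
  eps n (total_d y 0%N n) = dB n (eps n.+1 (y 0%N n.+1)).
Proof. by rewrite /total_d expr0 scale1r (linD (le _)) (eps_dh cr) add0r (eps_dv cr). Qed.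

(** The leftmost entry of a total cycle is a horizontal cycle, hence of the form [dh c]. Subtracting
    [total_d (single c)] moves the left end one column to the right, until it passes column [n];
    [m = n + 1 - i] counts the columns that remain. *)
Lemma total_boundary n m i (y : family2 X) : (n.+1 = m + i)%N ->
  in_degree n%:Z y -> total_d y = 0 -> (forall i' j', (i' < i)%N -> y i' j' = 0) ->
  (forall j, i = 0%N -> eps j (y 0%N j) = 0) ->
  exists2 z, in_degree n.+1%:Z z & total_d z = y.
Proof.
elim: m i y => [|m IH] i y hi dy Dy ly ey.
  exists 0; first exact: (in_degree_submodule _ _).1.
  rewrite (lin0 lD); apply: family2P => i' j'; rewrite family2E.
  by have [h|h] := ltnP i' i; [rewrite ly | rewrite dy //; lia].
have [hmi|hmi] := ltnP n i.
  exists 0; first exact: (in_degree_submodule _ _).1.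
  rewrite (lin0 lD); apply: family2P => i' j'; rewrite family2E.
  by have [h|h] := ltnP i' i; [rewrite ly | rewrite dy //; lia].
pose j := (n - i)%N.
have hc : left_cycle (y i j).
  case: i hi ly ey hmi @j => [|i] hi ly ey hmi j /=; first exact: ey.
  have := congr1 (fun x : family2 X => x i j) Dy.
  by rewrite /total_d [y i _]ly // (lin0 (lv _ _)) scaler0 addr0.
have [c ec] := left_cycle_exact hc.
have dc1 : in_degree n.+1%:Z (single c) by apply: single_degree; rewrite /j; lia.
have [|||||z dz ez] := IH i.+1 (y - total_d (single c)).
- lia.
- apply: (submoduleB (in_degree_submodule _ _)) => //.
  by apply: total_d_degree dc1 _; lia.
- by rewrite (linB lD) Dy total_d_d subrr.
- move=> i' j' h; rewrite !family2E.
  have [hd|hd] := pselect (i'%:Z + j'%:Z = n%:Z); last first.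
    by rewrite dy // (total_d_degree dc1 (erefl _)) ?subrr //; lia.
  have [hi'|hi'] := ltnP i' i.
    rewrite ly // /total_d !single_other1 ?(lin0 (lh _ _)) ?(lin0 (lv _ _)) ?scaler0 ?addr0 ?subr0 //; lia.
  have ei : i' = i by lia.
  have ej : j' = j by rewrite /j; lia.
  rewrite ei ej /total_d single_same ec [single c _ _]single_other1 ?(lin0 (lv _ _)); last lia.
  by rewrite scaler0 addr0 subrr.
- by [].
exists (z + single c); first exact: (submoduleD (in_degree_submodule _ _)).
by rewrite (linD lD) ez subrK.
Qed.

(** Subtracting the total boundary of a lift of [b] makes the edge entry vanish under [eps], and
    [total_boundary] applies from column 0. *)
Lemma augmentation_inj n (y : family2 X) b : in_degree n%:Z y -> total_d y = 0 ->
  eps n (y 0%N n) = dB n b -> exists2 z, in_degree n.+1%:Z z & total_d z = y.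
Proof.
move=> dy Dy ey; have [c ec] := eps_surj cr b.
have dc1 : in_degree n.+1%:Z (single c) by apply: single_degree.
have [||||z dz ez] := @total_boundary n n.+1 0 (y - total_d (single c)) (esym (addn0 _)).
- apply: (submoduleB (in_degree_submodule _ _)) => //.
  by apply: total_d_degree dc1 _; lia.
- by rewrite (linB lD) Dy total_d_d subrr.
- by [].
- move=> j _; rewrite !family2E; have [->|hj] := eqVneq j n.
    by rewrite (linB (le _)) augmentation_boundary single_same ec ey subrr.
  rewrite dy ?(total_d_degree dc1 erefl) ?subrr ?(lin0 (le _)) //; lia.
exists (z + single c); first exact: (submoduleD (in_degree_submodule _ _)).
by rewrite (linD lD) ez subrK.
Qed.

(** The edge map from total homology to the homology of [B], before total cycles are divided by
    total boundaries. *)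
Definition augmentation_rel n (y : family2 X) (t : chain_homology dB n) : Prop :=
  [/\ in_degree n%:Z y, total_d y = 0
    & exists2 z : sub [set b | d_out dB b = 0], val z = eps n (y 0%N n) & t = \pi z].

End Augmented.
End DoubleComplex.

Section AugmentationRelation.
Variables (k : fieldType) (X : nat -> nat -> lmodType k).
Variables (dh : forall i j, X i.+1 j -> X i j) (dv : forall i j, X i j.+1 -> X i j).
Hypothesis dc : double_complex dh dv.
Variables (B : nat -> lmodType k) (dB : forall j, B j.+1 -> B j) (eps : forall j, X 0 j -> B j).
Hypothesis cr : column_resolution dh dv dB eps.
Arguments dh : clear implicits.
Arguments dv : clear implicits.
Arguments dB : clear implicits.
Arguments eps : clear implicits.
Let le := eps_linear cr.
Let lB := dB_linear cr.
Let lD := total_d_linear dc.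
Arguments le : clear implicits.
Arguments lB : clear implicits.
Let L := @augmentation_rel k X dh dv B dB eps.
Arguments L : clear implicits.

Lemma d_out_linear n : linear (d_out dB (n := n)).
Proof. by case: n => [|n]; [apply: linear_zero | apply: lB]. Qed.

Let mZ n := submodule_ker (@d_out_linear n).
Let mB n : submodule [set z : sub [set b | d_out dB (n := n) b = 0] | exists y, dB n y = val z].
Proof. exact: submodule_comap (@val_linear _ _ _) (submodule_im (lB n)). Qed.

Lemma augmentation_rel_linear n : linear_rel (L n).
Proof.
split=> [|c x x' _ _ [dx Dx [z hz ->]] [dx' Dx' [z' hz' ->]]].
  split; [exact: (in_degree_submodule _ _).1|exact: lin0|].
  by exists 0; rewrite ?pi0 // family2E (lin0 (le _)).
split; [exact: (in_degree_submodule _ _).2|by rewrite lD Dx Dx' scaler0 addr0|].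
by exists (c *: z + z'); rewrite ?pi_linear // !family2E (le n) val_linear hz hz'.
Qed.

Lemma augmentation_rel_total n x : in_degree n%:Z x -> total_d dh dv x = 0 -> exists t, L n x t.
Proof.
move=> dx Dx; have [z hz] := submodule_lift (mZ n) (augmentation_cycle cr n Dx).
by exists (\pi z); split=> //; exists z.
Qed.

Lemma augmentation_rel_surj n t : exists x, L n x t.
Proof.
have [x [dx Dx hx]] := augmentation_surj dc cr (sub_valP (mZ n) (repr t)).
by exists x; split=> //; exists (repr t); rewrite ?reprK.
Qed.

Lemma augmentation_rel_eq0 n x : L n x 0 ->
  exists2 b, in_degree n.+1%:Z b & total_d dh dv b = x.
Proof.
case=> dx Dx [z hz /esym/(pi_eq0 (@mB n)) [b hb]].
by apply: (augmentation_inj dc cr (b := b)); rewrite ?hb ?hz.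
Qed.

Lemma augmentation_rel_boundary n b : in_degree n.+1%:Z b -> L n (total_d dh dv b) 0.
Proof.
move=> db; have db' := @total_d_degree _ _ _ _ dc _ n%:Z _ db.
have [|t Lt] := @augmentation_rel_total n (total_d dh dv b) _ (total_d_d dc b).
  by apply: db'; lia.
suff <- : t = 0 by [].
case: Lt => _ _ [z hz ->]; apply/(pi_eq0 (@mB n)); exists (eps n.+1 (b 0 n.+1)).
by rewrite hz (augmentation_boundary cr).
Qed.

Lemma augmentation_rel_fun n t : L n 0 t -> t = 0.
Proof.
case=> _ _ [z hz ->]; apply/(pi_eq0 (@mB n)).
by exists 0; rewrite (lin0 (lB _)) hz family2E (lin0 (le _)).
Qed.
End AugmentationRelation.

(** * The column filtration of a double complex and its second page *)

Section DoubleComplexSpectralSequence.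
Variables (k : fieldType) (X : nat -> nat -> lmodType k).
Variables (dh : forall i j, X i.+1 j -> X i j) (dv : forall i j, X i j.+1 -> X i j).
Hypothesis dc : double_complex dh dv.
Arguments dh : clear implicits.
Arguments dv : clear implicits.
Let lh := dh_linear dc.
Let lv := dv_linear dc.
Arguments lh : clear implicits.
Arguments lv : clear implicits.
Let lD := total_d_linear dc.

Definition column_ss : spectral_sequence k :=
  filtered_ss lD (total_d_d dc) (@in_columns_submodule k X) (@in_degree_submodule k X)
    (@in_columns_le k X) (total_d_degree dc).

Lemma column_ss_first_quadrant : first_quadrant column_ss.
Proof.
apply: filtered_first_quadrant; [exact: in_columns_neg | exact: in_degree_columns].
Qed.

Lemma column_ss_converges (B : nat -> lmodType k) (dB : forall j, B j.+1 -> B j)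
    (eps : forall j, X 0 j -> B j) :
  column_resolution dh dv dB eps -> converges_to column_ss (chain_homology dB).
Proof.
move=> cr; apply: (filtered_converges lD (total_d_d dc) (@in_columns_submodule k X) (@in_degree_submodule k X)
    (@in_columns_le k X) (total_d_degree dc) _ _ (L := @augmentation_rel k X dh dv B dB eps)).
- exact: in_columns_neg.
- exact: in_degree_columns.
- exact: augmentation_rel_linear.
- by move=> n x t [].
- exact: augmentation_rel_total.
- exact: augmentation_rel_surj.
- exact: augmentation_rel_fun.
- exact: augmentation_rel_eq0.
- exact: augmentation_rel_boundary.
Qed.

(* The relation R p q presents U p q as the vertical homology at (p, q). *)
Variables (U : nat -> nat -> lmodType k) (dU : forall i j, U i.+1 j -> U i j).
Variable R : forall p q, X p q -> U p q -> Prop.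
Arguments dU : clear implicits.
Arguments R : clear implicits.
Hypothesis dU_linear : forall i j, linear (dU i j).
Hypothesis R_linear : forall p q, linear_rel (R p q).
Hypothesis R_total : forall p q x, d_out (dv p) (n := q) x = 0 -> exists u, R p q x u.
Hypothesis R_surj : forall p q u, exists x, R p q x u.
Hypothesis R_cycle : forall p q x u, R p q x u -> d_out (dv p) (n := q) x = 0.
Hypothesis R_eq0 : forall p q x u, R p q x u -> u = 0 <-> exists c, dv p q c = x.
Hypothesis R_d : forall p q x u, R p.+1 q x u -> R p q (dh p q x) (dU p q u).

Lemma total_d_single_right p q (x : X p q) i j :
  d_out (dv p) x = 0 -> (p <= i)%N -> total_d dh dv (single x) i j = 0.
Proof.
move=> vx hi; rewrite /total_d [single x i.+1 j]single_other1; last lia.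
rewrite (lin0 (lh _ _)) add0r.
have [ei|ni] := eqVneq i p; last by rewrite single_other1 ?(lin0 (lv _ _)) ?scaler0 //; lia.
have [ej|nj] := eqVneq q j.+1; last by rewrite single_other1 ?(lin0 (lv _ _)) ?scaler0 //; lia.
by subst i q; rewrite single_same [dv _ _ _]vx scaler0.
Qed.

Lemma total_d_single_far p q (x : X p q) i j : (p < i)%N -> total_d dh dv (single x) i j = 0.
Proof.
move=> hi; rewrite /total_d !single_other1; try lia.
by rewrite (lin0 (lh _ _)) (lin0 (lv _ _)) scaler0 addr0.
Qed.

(** In column [p] the total differential multiplies [dv] by [(-1)^p]; the same factor in front of
    [c] removes that sign. *)
Lemma total_d_pair p q (x : X p.+1 q) (c : X p q.+1) : d_out (dv p.+1) x = 0 ->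
  in_columns p%:Z (total_d dh dv (single x + single ((-1) ^+ p *: c))) /\
  forall j, total_d dh dv (single x + single ((-1) ^+ p *: c)) p j =
            single (dh p q x + dv p q c) p j.
Proof.
move=> vx; split=> [i j hi|j]; rewrite (linD lD) family2E.
  by rewrite total_d_single_right ?total_d_single_far ?addr0 //; lia.
rewrite /total_d [single x p _]single_other1; last lia.
rewrite [single (_ *: _) p.+1 j]single_other1; last lia.
rewrite (lin0 (lh _ _)) (lin0 (lv _ _)) scaler0 addr0 add0r.
have [->|nj] := eqVneq j q.
  by rewrite !single_same (linZ (lv _ _)) sign_scaleK.
rewrite !single_other1 ?(lin0 (lh _ _)) ?(lin0 (lv _ _)) ?scaler0 ?addr0 //; lia.
Qed.

(** The first page is bypassed: an element of [Z^2] is related to the classes of its entry at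
    [(p, q)]. The total differential vanishes in columns [p] and [p - 1]; at [(p, q - 1)] this makes
    the entry a vertical cycle, and at [(p - 1, q)] it makes [dh] of the entry a vertical boundary,
    so [dU] kills the class. *)
Lemma column_page2 (p q : nat) :
  linear_iso (page column_ss 2 p%:Z q%:Z) (chain_homology (C := U^~ q) (fun i => dU i q) p).
Proof.
have mG := @in_degree_submodule k X; have mF := @in_columns_submodule k X.
have DG := total_d_degree dc.
apply: (@subquot_iso k (family2 X) (U p q)
  (cycles (total_d dh dv) (@in_columns k X) (@in_degree k X) 2%:Z p q)
  (boundaries (total_d dh dv) (@in_columns k X) (@in_degree k X) 2%:Z p q)
  [set u | d_out (C := U^~ q) (fun i => dU i q) u = 0]
  [set u | exists v, dU p q v = u] (fun x u => R p q (x p q) u)).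
- exact: cycles_submodule.
- exact: boundaries_submodule.
- by apply: submodule_ker; case: p => [|p]; [apply: linear_zero|apply: dU_linear].
- exact: submodule_im.
- split; first exact: (R_linear _ _).1.
  by move=> c x x' y y' r r'; apply: (R_linear _ _).2.
- move=> x [Fx Gx Dx].
  have vx : d_out (dv p) (x p q) = 0.
    case: q Gx Dx => // q Gx Dx /=; have := Dx p q; rewrite /total_d [x p.+1 q]Fx; last lia.
    rewrite (lin0 (lh _ _)) add0r => h.
    by rewrite -[dv _ _ _](sign_scaleK p) h ?scaler0 //; lia.
  have [u Ru] := R_total vx; exists u => //.
  case: p Fx Gx Dx vx u Ru => // p Fx Gx Dx vx u Ru /=.
  apply/(R_eq0 (R_d Ru)); exists (- (-1) ^+ p *: x p q.+1); rewrite (linZ (lv _ _)).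
  have := Dx p q; rewrite /total_d => /(_ _)/eqP; rewrite addrC addr_eq0 => h.
  by rewrite scaleNr (eqP (h _)) ?opprK //; lia.
- move=> u hu; have [x Rx] := R_surj u; have vx := R_cycle Rx.
  have [y [yx Gy Fy Dy]] : exists y : family2 X, [/\ y p q = x, in_degree (p%:Z + q%:Z) y,
      in_columns p y & in_columns (p%:Z - 2) (total_d dh dv y)].
    (* In column 0 the single entry [x] suffices. Otherwise [dU u = 0] yields [c] with
       [dv c = dh x], and the entry [- c], with its sign, cancels [dh x] in the column to the
       left. *)
    case: p u hu x Rx vx => [|p] u /= hu x Rx vx.
      exists (single x); split; [exact: single_same|exact: single_degree| |].
        by move=> i j hi; rewrite single_other1 //; lia.
      by move=> i j hi; rewrite total_d_single_right.
    have [c hc] := (R_eq0 (R_d Rx)).1 hu.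
    have [Dc Dp] := total_d_pair (- c) vx.
    exists (single x + single ((-1) ^+ p *: - c)); split.
    + by rewrite family2E single_same single_other1 ?addr0 //; lia.
    + apply: (submoduleD (mG _)); first exact: single_degree.
      by apply: single_degree; lia.
    + by move=> i j hi; rewrite family2E !single_other1 ?addr0 //; lia.
    move=> i j hi; have [ei|ni] := eqVneq i p; last by apply: Dc; lia.
    by rewrite ei Dp (linN (lv _ _)) hc subrr single0.
  exists y; last by rewrite yx.
  by split.
move=> x u Zx du Rx; have [Fx Gx Dx] := Zx; split=> [[a [b [e [Fa Ga Da] [Fb Gb Db]]]]|[v hv]].
  have vb : d_out (dv p.+1) (b p.+1 q) = 0.
    case: q {x u Zx du Rx Fx Gx Dx e Ga Gb} Db => // q Db /=.
    have := Db p.+1 q; rewrite /total_d [b p.+2 q]Fb; last lia.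
    rewrite (lin0 (lh _ _)) add0r => h.
    by rewrite -[dv _ _ _](sign_scaleK p.+1) h ?scaler0 //; lia.
  have [v Rv] := R_total vb; exists v; apply/esym/eqP; rewrite -subr_eq0; apply/eqP.
  apply/(R_eq0 (linear_relB (R_linear p q) Rx (R_d Rv))).
  exists ((-1) ^+ p *: b p q.+1); rewrite (linZ (lv _ _)) e family2E [a p q]Fa ?add0r; last lia.
  by rewrite /total_d addrC addKr.
have [x' Rx'] := R_surj v; have vx' := R_cycle Rx'.
have := linear_relB (R_linear p q) Rx (R_d Rx'); rewrite hv subrr.
move=> /R_eq0[/(_ erefl)[c hc] _].
(* The entry of [total_d b] at [(p, q)] is [dh x' + dv c = x p q], so subtracting it leaves only
   columns below [p]. *)
pose b := single x' + single ((-1) ^+ p *: c).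
have [Dc Dp] := total_d_pair c vx'.
have Gb : in_degree (p%:Z + q%:Z + 1) b.
  by apply: (submoduleD (mG _)); apply: single_degree; lia.
have Fb : in_columns (p%:Z + 1) b.
  by move=> i j hi; rewrite /b family2E !single_other1 ?addr0 //; lia.
exists (x - total_d dh dv b), b; split; first by rewrite subrK.
  have Gxb : in_degree (p%:Z + q%:Z) (x - total_d dh dv b).
    by apply: (submoduleB (mG _)) => //; apply: DG Gb _; lia.
  split; [|by move: Gxb; congr (in_degree _ _); lia|].
    move=> i j hi; have [ei|ni] := eqVneq i p; last first.
      by rewrite !family2E Fx ?[total_d _ _ _ _ _]Dc ?subrr //; lia.
    rewrite ei !family2E [total_d _ _ _ _ _]Dp; have [->|nj] := eqVneq j q.
      by rewrite single_same hc [_ + (_ - _)]addrC subrK subrr.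
    by rewrite [single _ _ _]single_other1 ?Gx ?subrr //; lia.
  rewrite (linB lD) total_d_d // subr0; apply: in_columns_le Dx _; lia.
split; [by apply: in_columns_le Fb _; lia|by move: Gb; congr (in_degree _ _); lia|].
by apply: in_columns_le Dc _; lia.
Qed.
End DoubleComplexSpectralSequence.

(** * Maps induced on homology and the comparison of the two edges of a double complex *)

Section InducedOnHomology.
Variables (k : fieldType) (C : nat -> lmodType k) (d : forall n, C n.+1 -> C n).
Arguments d : clear implicits.
Hypothesis d_linear : forall n, linear (d n).

Lemma d_out_submodule n : submodule [set x | d_out d (n := n) x = 0].
Proof. by apply: submodule_ker; case: n => [|n]; [apply: linear_zero | apply: d_linear]. Qed.

Lemma homology_eq0 n (z : sub [set x | d_out d (n := n) x = 0]) :
  \pi_(chain_homology d n) z = 0 <-> exists y, d n y = val z.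
Proof.
have h := submodule_comap (@val_linear _ _ [set x | d_out d (n := n) x = 0])
  (submodule_im (@d_linear n)).
exact: (pi_eq0 h).
Qed.

Definition homology_graph (phi : forall n, C n -> C n) n (t t' : chain_homology d n) : Prop :=
  exists z z' : sub [set x | d_out d (n := n) x = 0],
    [/\ t = \pi z, t' = \pi z' & val z' = phi n (val z)].

Variable phi : forall n, C n -> C n.
Hypothesis phi_linear : forall n, linear (@phi n).
Hypothesis phi_d : forall n x, phi (d n x) = d n (phi x).

Lemma phi_cycle n x : d_out d (n := n) x = 0 -> d_out d (n := n) (phi x) = 0.
Proof.
case: n x => //= n x; rewrite -phi_d => ->.
exact: lin0 (@phi_linear n).
Qed.

Lemma homology_graph_linear n : linear_rel (homology_graph phi (n := n)).
Proof.
split=> [|c _ _ _ _ [z [z' [-> -> h]]] [w [w' [-> -> h']]]].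
  by exists 0, 0; rewrite !pi0; split=> //=; rewrite (lin0 (@phi_linear n)).
exists (c *: z + w), (c *: z' + w'); rewrite !pi_linear; split=> //.
by rewrite !val_linear h h' (@phi_linear n).
Qed.

Lemma homology_graph_total n (z : sub [set x | d_out d (n := n) x = 0]) :
  exists2 z' : sub [set x | d_out d (n := n) x = 0],
    val z' = phi (val z) & homology_graph phi (\pi_(chain_homology d n) z) (\pi z').
Proof.
have h := phi_cycle (sub_valP (d_out_submodule n) z).
have [z' hz'] := submodule_lift (d_out_submodule n) h.
by exists z' => //; exists z, z'.
Qed.

Lemma homology_graph_fun n (t : chain_homology d n) : homology_graph phi 0 t -> t = 0.
Proof.
case=> z [z' [/esym/homology_eq0[y hy] -> h]]; apply/homology_eq0.
by exists (phi y); rewrite -phi_d hy h.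
Qed.
End InducedOnHomology.

Section TwoAugmentations.
Variables (k : fieldType) (X : nat -> nat -> lmodType k).
Variables (dh : forall i j, X i.+1 j -> X i j) (dv : forall i j, X i j.+1 -> X i j).
Arguments dh : clear implicits.
Arguments dv : clear implicits.
Hypothesis dc : double_complex dh dv.

Let lh := dh_linear dc.
Let lv := dv_linear dc.
Arguments lh : clear implicits.
Arguments lv : clear implicits.

Definition flip2 (i j : nat) : lmodType k := X j i.
Definition flip_dh (i j : nat) : flip2 i.+1 j -> flip2 i j := dv j i.
Definition flip_dv (i j : nat) : flip2 i j.+1 -> flip2 i j := dh j i.

Lemma flip_double_complex : double_complex flip_dh flip_dv.
Proof.
split=> i j; [exact: (dv_linear dc)|exact: (dh_linear dc)|exact: (dv_dv dc)|exact: (dh_dh dc)|].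
by move=> x; rewrite /flip_dh /flip_dv (dh_dv dc).
Qed.

(** A double complex and its transpose both put the sign on their own vertical differential; the
    factor [(-1)^(i j)] passes from one convention to the other, so that transposition commutes with
    the total differentials. *)
Definition flip (y : family2 X) : family2 flip2 := fun i j => (-1) ^+ (i * j)%N *: y j i.
Definition unflip (y : family2 flip2) : family2 X := fun i j => (-1) ^+ (i * j)%N *: y j i.

Lemma flip_linear : linear flip.
Proof.
move=> c x y; apply: family2P => i j; rewrite /flip !family2E scalerDr !scalerA.
by rewrite [c * _]mulrC.
Qed.

Lemma unflipK y : flip (unflip y) = y.
Proof. by apply: family2P => i j; rewrite /flip /unflip mulnC sign_scaleK. Qed.

Lemma flip_inj : injective flip.
Proof.
move=> x y e; apply: family2P => i j; rewrite -[x i j](sign_scaleK (j * i)%N).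
by rewrite -[y i j](sign_scaleK (j * i)%N); congr (_ *: _); apply: (congr1 (fun z : family2 flip2 => z j i) e).
Qed.

Lemma flip_total_d y : total_d flip_dh flip_dv (flip y) = flip (total_d dh dv y).
Proof.
apply: family2P => i j; rewrite /total_d /flip /flip_dh /flip_dv.
have e1 : (-1) ^+ i * (-1) ^+ (i * j.+1) = (-1) ^+ (i * j) :> k.
  by rewrite mulnS exprD mulrA -expr2 sqrr_sign mul1r.
have e2 : (-1) ^+ (i.+1 * j) = (-1) ^+ (i * j) * (-1) ^+ j :> k by rewrite mulSn exprD mulrC.
by rewrite (linZ (lv _ _)) (linZ (lh _ _)) scalerDr addrC !scalerA e1 e2.
Qed.

Lemma flip_degree n y : in_degree n (flip y) <-> in_degree n y.
Proof.
split=> h i j hij; last by rewrite /flip h ?scaler0 //; lia.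
have := h j i; rewrite /flip => e; rewrite -[y i j](sign_scaleK (j * i)%N) e ?scaler0 //; lia.
Qed.

Variables (A : nat -> lmodType k) (dA : forall j, A j.+1 -> A j) (eta : forall j, X j 0 -> A j).
Variables (B : nat -> lmodType k) (dB : forall j, B j.+1 -> B j) (eps : forall j, X 0 j -> B j).
Arguments dA : clear implicits.
Arguments eta : clear implicits.
Arguments dB : clear implicits.
Arguments eps : clear implicits.
Hypothesis crA : column_resolution flip_dh flip_dv dA eta.
Hypothesis crB : column_resolution dh dv dB eps.
Let dc' := flip_double_complex.
Let le := eps_linear crA.
Arguments le : clear implicits.

(* The isomorphism between the homologies of the two edges, as a graph. *)
Definition edge_rel n (a : chain_homology dA n) (b : chain_homology dB n) : Prop :=
  exists2 y, augmentation_rel flip_dh flip_dv eta (flip y) a & augmentation_rel dh dv eps y b.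

Lemma edge_rel_linear n : linear_rel (@edge_rel n).
Proof.
have lA := augmentation_rel_linear dc' crA n; have lB := augmentation_rel_linear dc crB n.
split=> [|c a a' b b' [y ya yb] [y' ya' yb']].
  by exists 0; [rewrite (lin0 flip_linear); apply: lA.1 | apply: lB.1].
by exists (c *: y + y'); [rewrite flip_linear; apply: lA.2 | apply: lB.2].
Qed.

Lemma edge_rel_total n a : exists b, @edge_rel n a b.
Proof.
have [y hy] := augmentation_rel_surj dc' crA a.
have Dy : total_d dh dv (unflip y) = 0.
  apply: flip_inj; rewrite -flip_total_d unflipK (lin0 flip_linear).
  by case: hy.
have [|b hb] := augmentation_rel_total crB (n := n) _ Dy.
  by apply/flip_degree; rewrite unflipK; case: hy.
by exists b, (unflip y); rewrite ?unflipK.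
Qed.

Lemma edge_rel_surj n b : exists a, @edge_rel n a b.
Proof.
have [y hy] := augmentation_rel_surj dc crB b.
have [dy Dy _] := hy.
have [||a ha] := augmentation_rel_total crA (n := n) (x := flip y).
- exact/flip_degree.
- by rewrite flip_total_d Dy (lin0 flip_linear).
by exists a, y.
Qed.

(** When the class on one edge is zero, the total cycle is a total boundary, and a total boundary
    has class zero on the other edge. *)
Lemma edge_rel_fun n b : @edge_rel n 0 b -> b = 0.
Proof.
case=> y /(augmentation_rel_eq0 dc' crA)[z dz hz] hb.
have Dz : total_d dh dv (unflip z) = y.
  by apply: flip_inj; rewrite -flip_total_d unflipK.
have := augmentation_rel_boundary dc crB (n := n) (b := unflip z).
rewrite Dz => hb0.
have /hb0 {}hb0 : in_degree n.+1%:Z (unflip z) by apply/flip_degree; rewrite unflipK.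
apply: (augmentation_rel_fun crB); rewrite -(subrr y) -[b]subr0.
exact: (linear_relB (augmentation_rel_linear dc crB n)).
Qed.

Lemma edge_rel_inj n a : @edge_rel n a 0 -> a = 0.
Proof.
case=> y ha /(augmentation_rel_eq0 dc crB)[z dz hz].
have := augmentation_rel_boundary dc' crA (n := n) (b := flip z).
rewrite flip_total_d hz => ha0.
have /ha0 {}ha0 : in_degree n.+1%:Z (flip z) by apply/flip_degree.
apply: (augmentation_rel_fun crA); rewrite -(subrr (flip y)) -[a]subr0.
exact: (linear_relB (augmentation_rel_linear dc' crA n)).
Qed.

Variables (fX : forall i j, X i j -> X i j) (fA : forall n, A n -> A n) (fB : forall n, B n -> B n).
Hypothesis fX_linear : forall i j, linear (@fX i j).
Hypothesis fA_linear : forall n, linear (@fA n).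
Hypothesis fB_linear : forall n, linear (@fB n).
Hypothesis fX_dh : forall i j x, fX (dh i j x) = dh i j (fX x).
Hypothesis fX_dv : forall i j x, fX (dv i j x) = dv i j (fX x).
Hypothesis fA_eta : forall n x, fA (eta n x) = eta n (fX x).
Hypothesis fB_eps : forall n x, fB (eps n x) = eps n (fX x).

Lemma fA_dA n x : fA (dA n x) = dA n (fA x).
Proof.
have [y <-] := eps_surj crA x.
by rewrite -(eps_dv crA) !fA_eta -(eps_dv crA) /flip_dv fX_dh.
Qed.

Lemma fB_dB n x : fB (dB n x) = dB n (fB x).
Proof.
have [y <-] := eps_surj crB x.
by rewrite -(eps_dv crB) !fB_eps -(eps_dv crB) fX_dv.
Qed.

(** Applying [fX] entrywise to a total cycle that links [a] and [b] gives one that links their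
    images. As the induced maps are single-valued, [a'] and [b'] may be computed from the
    representatives [z] and [w] at hand. *)
Lemma edge_rel_equivariant n a b a' b' : @edge_rel n a b ->
  homology_graph fA a a' -> homology_graph fB b b' -> edge_rel a' b'.
Proof.
have lA := dB_linear crA; have lB := dB_linear crB.
have mA := d_out_submodule lA n; have mB := d_out_submodule lB n.
case=> y [dy Dy [z hz ea]] [dy' Dy' [w hw eb]] ha hb.
have [z' hz' ha'] := homology_graph_total lA fA_linear fA_dA z.
have [w' hw' hb'] := homology_graph_total lB fB_linear fB_dB w.
have -> : a' = \pi z'.
  apply/eqP; rewrite -subr_eq0; apply/eqP; apply: (homology_graph_fun lA fA_dA).
  rewrite -(subrr a); apply: (linear_relB (homology_graph_linear _ fA_linear _)) => //.
  by rewrite ea.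
have -> : b' = \pi w'.
  apply/eqP; rewrite -subr_eq0; apply/eqP; apply: (homology_graph_fun lB fB_dB).
  rewrite -(subrr b); apply: (linear_relB (homology_graph_linear _ fB_linear _)) => //.
  by rewrite eb.
pose fy : family2 X := fun i j => fX (y i j).
have dfy : in_degree n%:Z fy.
  by move=> i j h; rewrite /fy dy' // (lin0 (@fX_linear _ _)).
have Dfy : total_d dh dv fy = 0.
  apply: family2P => i j; rewrite /total_d /fy -fX_dh -fX_dv -(linZ (@fX_linear _ _)).
  rewrite -(linD (@fX_linear _ _)); have := congr1 (fun x : family2 X => x i j) Dy'.
  by rewrite /total_d => ->; rewrite (lin0 (@fX_linear _ _)).
exists fy; split=> //.
- exact/flip_degree.
- by rewrite flip_total_d Dfy (lin0 flip_linear).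
- exists z' => //; rewrite hz' hz /flip /fy (linZ (le _)) (linZ (@fA_linear _)) fA_eta.
  by rewrite (linZ (le _)).
- by exists w' => //; rewrite hw' hw fB_eps.
Qed.
End TwoAugmentations.

(** * Tensor products *)

Section PresentedSpaces.
Variables (k : fieldType) (X : choiceType) (rel : set {freeg X / k}).

Lemma freeg_scaleU (c : k) (z : X) : << c *g z >> = c *: << z >> :> {freeg X / k}.
Proof. by apply/eqP/freeg_eqP => y; rewrite coeff_fgscale !coeffU mul1r. Qed.

Lemma gen_ind (W : set (presented rel)) : submodule W -> (forall x, W (gen rel x)) -> forall u, W u.
Proof.
move=> mW Wx u; rewrite (quot_repr u) -[repr u]freeg_sumE.
rewrite (lin_sum (@pi_linear _ _ rel)); elim: (dom _) => [|z s IH].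
  by rewrite big_nil; apply: mW.1.
rewrite big_cons freeg_scaleU (linZ (@pi_linear _ _ rel)).
by apply: mW.2 => //; apply: Wx.
Qed.

Lemma gen_ext (V : lmodType k) (f g : presented rel -> V) : linear f -> linear g ->
  (forall x, f (gen rel x) = g (gen rel x)) -> forall u, f u = g u.
Proof.
move=> lf lg h; apply: (gen_ind (W := [set u | f u = g u])) => //.
by split=> [|c x y /= ex ey]; rewrite /= ?(lin0 lf) ?(lin0 lg) // lf lg ex ey.
Qed.

Lemma gen_rel0 (r : {freeg X / k}) : rel r -> \pi_(quot rel) r = 0.
Proof. by move=> hr; rewrite -(pi0 rel); apply/cls_eqP; rewrite subr0 => W _; apply. Qed.

Lemma ext_comp (V W : lmodType k) (g : V -> W) (phi : X -> V) u : linear g ->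
  g (ext phi u) = ext (rel := rel) (fun x => g (phi x)) u.
Proof.
move=> lg; rewrite /ext -[repr _]freeg_repr !fglift_Freeg /prelift (lin_sum lg).
by apply: eq_bigr => z _; rewrite (linZ lg).
Qed.
End PresentedSpaces.

Section TensorLinear.
Variable k : fieldType.
Implicit Types U V W Z : lmodType k.

Lemma linear_tensl U V W (f : U -> V) (w : W) : linear f -> linear (fun x => f x \ox w).
Proof. by move=> lf c x y; rewrite lf (bilin_fst w (@tens_bilin k V W)). Qed.
Lemma linear_tensr U V W (f : U -> W) (v : V) : linear f -> linear (fun x => v \ox f x).
Proof. by move=> lf c x y; rewrite lf (bilin_snd v (@tens_bilin k V W)). Qed.
Lemma linear_tlift U V W Z (phi : V -> W -> Z) (f : U -> tensor V W) :
  bilin phi -> linear f -> linear (fun x => tlift phi (f x)).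
Proof. by move=> b lf c x y; rewrite lf (tlift_linear b). Qed.
Lemma linear_tlift_fun U V W Z (phi : U -> V -> W -> Z) t :
  (forall v w, linear (fun x => phi x v w)) -> linear (fun x => tlift (phi x) t).
Proof. by move=> h c x y; apply: tlift_fun_linear => v w; apply: h. Qed.
Lemma linear_scalarl U V W (f : {scalar V}) (g : U -> V) (v : W) :
  linear g -> linear (fun x => f (g x) *: v).
Proof. by move=> lg c x y; rewrite lg linearP scalerDl scalerA. Qed.
Lemma linear_hom U V W (f : {linear V -> W}) (g : U -> V) :
  linear g -> linear (fun x => f (g x)).
Proof. by move=> lg c x y; rewrite lg linearP. Qed.
Lemma bilin_intro U V W (f : U -> V -> W) :
  (forall v, linear (fun u => f u v)) -> (forall u, linear (fun v => f u v)) -> bilin f.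
Proof. by move=> h1 h2; split. Qed.
Lemma linear_actl (R : algType k) (M : module R) U (f : U -> R) m :
  linear f -> linear (fun x => act M (f x) m).
Proof.
move=> lf c x y; have [b _ _] := act_is_module M.
by rewrite lf (bilin_fst m b).
Qed.
Lemma linear_actr (R : algType k) (M : module R) U (f : U -> M) r :
  linear f -> linear (fun x => act M r (f x)).
Proof.
move=> lf c x y; have [b _ _] := act_is_module M.
by rewrite lf (bilin_snd r b).
Qed.

Lemma act1 (R : algType k) (M : module R) m : act M 1 m = m.
Proof. by case: (act_is_module M). Qed.
Lemma actM (R : algType k) (M : module R) r s m : act M (r * s) m = act M r (act M s m).
Proof. by case: (act_is_module M). Qed.
Lemma actZ (R : algType k) (M : module R) c r m : act M (c *: r) m = c *: act M r m.
Proof. exact: (linZ (linear_actl m (@linear_id k R))). Qed.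

Lemma tens_ind V W (S : set (tensor V W)) : submodule S -> (forall v w, S (v \ox w)) -> forall u, S u.
Proof. by move=> mS h; apply: gen_ind => // -[v w]; apply: h. Qed.

Lemma tens_ext V W Z (f g : tensor V W -> Z) : linear f -> linear g ->
  (forall v w, f (v \ox w) = g (v \ox w)) -> forall u, f u = g u.
Proof. by move=> lf lg h; apply: gen_ext => // -[v w]; apply: h. Qed.

Lemma tlift_comp V W Z Z' (g : Z -> Z') (phi : V -> W -> Z) u : linear g ->
  g (tlift phi u) = tlift (fun v w => g (phi v w)) u.
Proof. by move=> lg; rewrite /tlift (ext_comp _ _ lg). Qed.

Lemma tlift_eq V W Z (phi psi : V -> W -> Z) u : (forall v w, phi v w = psi v w) ->
  tlift phi u = tlift psi u.
Proof. by move=> h; apply: ext_eq => -[v w]; apply: h. Qed.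

End TensorLinear.

Lemma linear_bilinl (k : fieldType) (U V W Z : lmodType k) (phi : V -> W -> Z) (f : U -> V) w :
  bilin phi -> linear f -> linear (fun x => phi (f x) w).
Proof. by move=> b lf; apply: (linear_comp (bilin_fst w b) lf). Qed.
Lemma linear_bilinr (k : fieldType) (U V W Z : lmodType k) (phi : V -> W -> Z) (f : U -> W) v :
  bilin phi -> linear f -> linear (fun x => phi v (f x)).
Proof. by move=> b lf; apply: (linear_comp (bilin_snd v b) lf). Qed.

(* The hooks lin_over, lin_sweedler, lin_crossed of lin are redefined with ::= as new operations appear. *)
Ltac lin_over := fail.
Ltac lin_sweedler := fail.
Ltac lin_crossed := fail.

Ltac lin_hyp := match goal with
  | l : GRing.linear_for _ ?g |- GRing.linear_for _ ?g => exact: l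
  | b : bilinear_for _ _ ?phi |- GRing.linear_for _ (fun x => ?phi (@?a x) ?c) => apply: (linear_bilinl c b)
  | b : bilinear_for _ _ ?phi |- GRing.linear_for _ (fun x => ?phi ?c (@?a x)) => apply: (linear_bilinr c b)
  | l : GRing.linear_for _ ?g |- GRing.linear_for _ (fun x => ?g (@?a x)) => apply: (linear_comp l)
  | l : forall _, _ |- GRing.linear_for _ _ => solve [apply: l]
  end.

Ltac lin_step := lazymatch goal with
  | |- forall _, _ => intro
  | |- bilinear_for _ _ _ => apply: bilin_intro
  | |- GRing.linear_for _ (fun x => x) => apply: linear_id
  | |- GRing.linear_for _ (fun x => Algebra.zero) => apply: linear_zero
  | |- GRing.linear_for _ (fun x => tens _ _) => first [apply: linear_tensl | apply: linear_tensr]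
  | |- GRing.linear_for _ (fun x => GRing.Linear.sort _ _) => apply: linear_hom
  | |- GRing.linear_for _ (GRing.Linear.sort _) => apply: linear_bundled
  | |- GRing.linear_for _ (fun x => GRing.scale _ _) => first [apply: linear_scale | apply: linear_scalarl]
  | |- GRing.linear_for _ (fun x => Algebra.add _ _) => apply: linear_add
  | |- GRing.linear_for _ (fun x => Algebra.opp _) => apply: linear_opp
  | |- GRing.linear_for _ (fun x => GRing.mul _ _) => first [apply: linear_mull | apply: linear_mulr]
  | |- GRing.linear_for _ (fun x => act _ _ _) => first [apply: linear_actl | apply: linear_actr]
  | |- GRing.linear_for _ (fun x => tlift _ _) => first [apply: linear_tlift_fun | apply: linear_tlift]
  | |- GRing.linear_for _ _ => first [lin_over | lin_sweedler | lin_crossed]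
  end.
(** The rules match on abstractions, so a function in any other form is eta-expanded; failing on an
    abstraction keeps [lin] from looping. *)
Ltac lin_eta := lazymatch goal with
  | |- GRing.linear_for _ (fun _ => _) => fail
  | |- GRing.linear_for ?s ?g => change (GRing.linear_for s (fun x => g x))
  end.
Ltac lin := repeat (cbv beta; first [ lin_hyp | lin_step | lin_eta; lin_step ]).

Section TensorOverUniversal.
Variables (k : fieldType) (R : algType k) (M : rmodule R) (N : module R).

Lemma tens_over_bilin : bilin (@tens_over k R M N).
Proof.
have pil := @pi_linear k _ (@balanced_relations k R M N).
have sub3 c (x y z : {freeg (M * N)%type / k}) : bilinear_relations (x - c *: y - z) ->
    \pi_(quot (@balanced_relations k R M N)) x =
    c *: \pi_(quot (@balanced_relations k R M N)) y + \pi_(quot (@balanced_relations k R M N)) z.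
  move=> h; have /gen_rel0 : balanced_relations (x - c *: y - z) by left.
  rewrite (linB pil) (linB pil) (linZ pil) => /eqP; rewrite subr_eq0 subr_eq addrC => /eqP ->.
  by [].
split=> [y c x x' | x c y y']; apply: sub3; first by left; exists c, x, x', y.
by right; exists c, x, y, y'.
Qed.

Lemma tens_over_balanced r m n : tens_over (act M r m) n = tens_over m (act N r n).
Proof.
have pil := @pi_linear k _ (@balanced_relations k R M N).
apply/eqP; rewrite -subr_eq0 -(linB pil); apply/eqP/gen_rel0.
by right; exists r, m, n.
Qed.

Lemma linear_tens_overl (U : lmodType k) (f : U -> M) (n : N) : linear f -> linear (fun x => tens_over (f x) n).
Proof. by move=> lf c x y; rewrite lf (bilin_fst n tens_over_bilin). Qed.
Lemma linear_tens_overr (U : lmodType k) (f : U -> N) (m : M) : linear f -> linear (fun x => tens_over m (f x)).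
Proof. by move=> lf c x y; rewrite lf (bilin_snd m tens_over_bilin). Qed.

Definition otlift (W : lmodType k) (phi : M -> N -> W) : tensor_over M N -> W :=
  ext (fun p => phi p.1 p.2).

Lemma tens_over_ind (S : set (tensor_over M N)) : submodule S ->
  (forall m n, S (tens_over m n)) -> forall u, S u.
Proof. by move=> mS h; apply: gen_ind => // -[m n]; apply: h. Qed.

Lemma tens_over_ext (W : lmodType k) (f g : tensor_over M N -> W) : linear f -> linear g ->
  (forall m n, f (tens_over m n) = g (tens_over m n)) -> forall u, f u = g u.
Proof. by move=> lf lg h; apply: gen_ext => // -[m n]; apply: h. Qed.

Variables (W : lmodType k) (phi : M -> N -> W).
Hypothesis phi_bilin : bilin phi.
Hypothesis phi_balanced : forall r m n, phi (act M r m) n = phi m (act N r n).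

Lemma otlift_kills r : balanced_relations r -> fglift (fun p => phi p.1 p.2) r = 0.
Proof.
case=> [h|[a [x [y ->]]]]; first exact: (bilin_kills phi_bilin).
by rewrite (linB (fglift_linear _)) !liftU !scale1r phi_balanced subrr.
Qed.

Lemma otlift_linear : linear (otlift phi).
Proof. by apply: ext_linear; apply: otlift_kills. Qed.

Lemma otliftE m n : otlift phi (tens_over m n) = phi m n.
Proof. by rewrite /otlift ext_gen //; apply: otlift_kills. Qed.
End TensorOverUniversal.

Ltac lin_over ::= lazymatch goal with
  | |- GRing.linear_for _ (fun x => tens_over _ _) => first [apply: linear_tens_overl | apply: linear_tens_overr]
  end.

(** * Exactness over the base field, and flatness of projective modules *)

Section Exactness.
Variable k : fieldType.
Implicit Types U V W : lmodType k.

(** Both maps come from pseudo-inverses: [t] from that of [g], and [s] from that of [f] applied to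
    the remainder [y - t (g y)]. The resulting identity is additive in [y] and is carried over by
    tensor products and by Hochschild chains. *)
Lemma exact_split U V W (f : U -> V) (g : V -> W) : linear f -> linear g ->
  (forall y, g y = 0 -> exists x, f x = y) ->
  exists s : V -> U, exists t : W -> V,
    [/\ linear s, linear t & forall y, y = t (g y) + f (s y)].
Proof.
move=> lf lg ex; have [t lt ht] := pseudo_inverse lg; have [s ls hs] := pseudo_inverse lf.
exists (fun y => s (y - t (g y))), t; split=> //.
  apply: (linear_comp ls); apply: linear_sub => //; exact: (linear_comp lt).
move=> y; have [|x hx] := ex (y - t (g y)); first by rewrite (linB lg) ht subrr.
by rewrite -hx hs hx addrC subrK.
Qed.

Lemma tensor_exactr P U V W (f : U -> V) (g : V -> W) : linear f -> linear g ->
  (forall y, g y = 0 -> exists x, f x = y) ->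
  forall u : tensor P V, tlift (fun p y => p \ox g y) u = 0 ->
    exists v, tlift (fun p x => p \ox f x) v = u.
Proof.
move=> lf lg ex u hu; have [s [t [ls lt st]]] := exact_split lf lg ex.
have tb (A B : lmodType k) (h : A -> B) : linear h -> bilin (fun (p : P) (x : A) => p \ox h x).
  by move=> lh; lin.
exists (tlift (fun p y => p \ox s y) u).
transitivity (tlift (fun p w => p \ox t w) (tlift (fun p y => p \ox g y) u) +
   tlift (fun p x => p \ox f x) (tlift (fun p y => p \ox s y) u)).
  by rewrite hu (lin0 (tlift_linear (tb _ _ _ lt))) add0r.
move: u {hu}; apply: tens_ext => //; first by lin.
by move=> p y; rewrite !tliftE; try exact: tb; rewrite {3}[y]st (linD (linear_tensr p (@linear_id k V))).
Qed.

Lemma tensor_exactl P U V W (f : U -> V) (g : V -> W) : linear f -> linear g ->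
  (forall y, g y = 0 -> exists x, f x = y) ->
  forall u : tensor V P, tlift (fun y p => g y \ox p) u = 0 ->
    exists v, tlift (fun x p => f x \ox p) v = u.
Proof.
move=> lf lg ex u hu; have [s [t [ls lt st]]] := exact_split lf lg ex.
have tb (A B : lmodType k) (h : A -> B) : linear h -> bilin (fun (x : A) (p : P) => h x \ox p).
  by move=> lh; lin.
exists (tlift (fun y p => s y \ox p) u).
transitivity (tlift (fun w p => t w \ox p) (tlift (fun y p => g y \ox p) u) +
   tlift (fun x p => f x \ox p) (tlift (fun y p => s y \ox p) u)).
  by rewrite hu (lin0 (tlift_linear (tb _ _ _ lt))) add0r.
move: u {hu}; apply: tens_ext => //; first by lin.
by move=> y p; rewrite !tliftE; try exact: tb; rewrite {3}[y]st (linD (linear_tensl p (@linear_id k V))).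
Qed.
End Exactness.

Section FreeModules.
Variables (k : fieldType) (R : algType k).

Definition free_act (V : lmodType k) (r : R) : tensor R V -> tensor R V :=
  tlift (fun a v => (r * a) \ox v).

Lemma free_act_bilin (V : lmodType k) (r : R) : bilin (fun (a : R) (v : V) => (r * a) \ox v).
Proof. by lin. Qed.

Lemma free_actE (V : lmodType k) (r a : R) (v : V) : free_act r (a \ox v) = (r * a) \ox v.
Proof. by rewrite /free_act (tliftE (@free_act_bilin V r)). Qed.

Lemma free_act_linear (V : lmodType k) r : linear (@free_act V r).
Proof. exact: tlift_linear (@free_act_bilin V r). Qed.

Lemma free_is_module (V : lmodType k) : is_module (@free_act V).
Proof.
split=> [|u|r s u].
- by apply: bilin_intro => [u|r]; [apply: linear_tlift_fun => a v; lin | apply: free_act_linear].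
- move: u; apply: tens_ext => //; first exact: free_act_linear.
  by move=> a v; rewrite free_actE mul1r.
move: u; apply: tens_ext; first exact: free_act_linear.
  exact: linear_comp (free_act_linear _) (free_act_linear _).
by move=> a v; rewrite !free_actE mulrA.
Qed.

Definition free_module (V : lmodType k) : module R := Module (free_is_module V).

(* An R-linear section of the action map R (x) P -> P, witnessing that P is a
   direct summand of a free module. *)
Record action_section (P : module R) (sigma : P -> tensor R P) : Prop := ActionSection {
  section_linear : linear sigma;
  section_act : forall r p, sigma (act P r p) = free_act r (sigma p);
  section_mult : forall p, tlift (act P) (sigma p) = p
}.

Lemma act_bilin (P : module R) : bilin (act P).
Proof. by case: (act_is_module P). Qed.

(** The identity of [P] is lifted along the action map from the free module [R (x) P]. *)
Lemma projective_section (P : module R) : projective P -> exists sigma, @action_section P sigma.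
Proof.
move=> hP; have b := act_bilin P.
have [|||s [ls hs] es] := hP (free_module P) P (tlift (act P)) id.
- split; first exact: tlift_linear.
  move=> r; apply: tens_ext => [||a p].
  + exact: linear_comp (tlift_linear b) (free_act_linear r).
  + by apply: linear_actr; apply: tlift_linear.
  by rewrite /= free_actE !tliftE // actM.
- by move=> p; exists (1 \ox p); rewrite tliftE // act1.
- by split.
by exists s.
Qed.
End FreeModules.

Section Flatness.
Variables (k : fieldType) (R : algType k).

Definition over_mapl (P P' : rmodule R) (N : module R) (f : P -> P') :
    tensor_over P N -> tensor_over P' N := ext (fun p => tens_over (f p.1) p.2).
Definition over_mapr (P : rmodule R) (N N' : module R) (g : N -> N') :
    tensor_over P N -> tensor_over P N' := ext (fun p => tens_over p.1 (g p.2)).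

Lemma over_maplP (P P' : rmodule R) (N : module R) (f : P -> P') : module_hom f ->
  linear (over_mapl (N := N) f) /\ forall p n, over_mapl f (tens_over p n) = tens_over (f p) n :> tensor_over P' N.
Proof.
move=> [lf hf]; have b : bilin (fun p (n : N) => tens_over (f p) n) by lin.
have e r p n : tens_over (f (act P r p)) n = tens_over (f p) (act N r n).
  by rewrite hf tens_over_balanced.
by split; [apply: (otlift_linear b e) | move=> p n; apply: (otliftE b e)].
Qed.

Lemma over_maprP (P : rmodule R) (N N' : module R) (g : N -> N') : module_hom g ->
  linear (over_mapr (P := P) g) /\ forall p n, over_mapr g (tens_over p n) = tens_over p (g n) :> tensor_over P N'.
Proof.
move=> [lg hg]; have b : bilin (fun (p : P) n => tens_over p (g n)) by lin.
have e r (p : P) n : tens_over (act P r p) (g n) = tens_over p (g (act N r n)).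
  by rewrite hg tens_over_balanced.
by split; [apply: (otlift_linear b e) | move=> p n; apply: (otliftE b e)].
Qed.

Section ProjectiveRight.
Variables (P : rmodule R) (sigma : P -> tensor (R^c : algType k) P).
Hypothesis hs : action_section sigma.

Let sg (N : module R) (p : P) (n : N) : tensor P N :=
  tlift (fun (r : R^c) p' => p' \ox act N r n) (sigma p).

(** With [sigma p] the sum of [r (x) p'], the map sends [p (x) n] to the sum of [p' (x) r n]. It is
    balanced because [sigma] is [R]-linear, and it makes [P (x)_R N] a retract of [P (x)_k N],
    compatibly with maps in [N]. *)
Lemma projective_retract (N : module R) : exists s : tensor_over P N -> tensor P N,
  [/\ linear s, forall p n, s (tens_over p n) = sg p n
    & forall x, tlift (@tens_over k R P N) (s x) = x].
Proof.
have ls := section_linear hs.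
have bi (n : N) : bilin (fun (r : R^c) (p' : P) => p' \ox act N r n).
  by lin.
have b : bilin (@sg N).
  apply: bilin_intro => [n|p]; last by apply: linear_tlift_fun => r p'; lin.
  exact: linear_tlift.
have e r p n : sg (act P r p) n = sg p (act N r n).
  rewrite /sg (section_act hs); move: (sigma p).
  apply: tens_ext => [||a p'].
  + exact: linear_comp (tlift_linear (bi n)) (free_act_linear _).
  + exact: tlift_linear.
  by rewrite free_actE !tliftE // actM.
exists (otlift (@sg _)); split; [exact: (otlift_linear b e)|exact: (otliftE b e)|].
apply: tens_over_ext => // [|p n].
  exact: linear_comp (tlift_linear (@tens_over_bilin _ _ _ _)) (otlift_linear b e).
rewrite (otliftE b e) -{2}(section_mult hs p) /sg; move: (sigma p).
apply: tens_ext => [||a p'].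
+ exact: linear_comp (tlift_linear (@tens_over_bilin _ _ _ _)) (tlift_linear (bi n)).
+ by apply: linear_tens_overl; apply: tlift_linear (act_bilin P).
rewrite !tliftE //; try exact: act_bilin; try exact: tens_over_bilin.
by rewrite tens_over_balanced.
Qed.

(** Compatibility of the retraction with [g] turns an element killed over [R] into one killed over
    [k], where tensoring is exact; a preimage found there is projected back. *)
Lemma projective_flat (N1 N2 N3 : module R) (f : N1 -> N2) (g : N2 -> N3) :
  module_hom f -> module_hom g -> (forall y, g y = 0 -> exists x, f x = y) ->
  forall u : tensor_over P N2, over_mapr g u = 0 -> exists v, over_mapr f v = u.
Proof.
move=> hf hg ex u hu.
have [s2 [l2 e2 r2]] := projective_retract N2; have [s3 [l3 e3 r3]] := projective_retract N3.
have [lgm gm] := over_maprP P hg; have [lfm fm] := over_maprP P hf.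
have bg : bilin (fun (p : P) y => p \ox g y) by case: hg => lg _; lin.
have bf : bilin (fun (p : P) x => p \ox f x) by case: hf => lf _; lin.
have [|v hv] := @tensor_exactr k P _ _ _ f g hf.1 hg.1 ex (s2 u).
  transitivity (s3 (over_mapr g u)); last by rewrite hu (lin0 l3).
  move: u {hu}; apply: tens_over_ext => [||p n].
  + exact: linear_comp (tlift_linear bg) l2.
  + exact: linear_comp l3 lgm.
  rewrite e2 gm e3 /sg (tlift_comp _ _ (tlift_linear bg)); apply: tlift_eq => r p'.
  by rewrite tliftE // hg.2.
exists (tlift (@tens_over k R P N1) v).
rewrite -[u]r2 -hv; move: v {hv}; apply: tens_ext => [||p n].
+ exact: linear_comp lfm (tlift_linear (@tens_over_bilin _ _ _ _)).
+ exact: linear_comp (tlift_linear (@tens_over_bilin _ _ _ _)) (tlift_linear bf).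
by rewrite !tliftE ?fm //; exact: tens_over_bilin.
Qed.
End ProjectiveRight.

Section ProjectiveLeft.
Variables (N : module R) (sigma : N -> tensor R N).
Hypothesis hs : action_section sigma.

Let sg (P : rmodule R) (p : P) (n : N) : tensor P N :=
  tlift (fun r n' => act P r p \ox n') (sigma n).

Lemma projective_retractl (P : rmodule R) : exists s : tensor_over P N -> tensor P N,
  [/\ linear s, forall p n, s (tens_over p n) = sg p n
    & forall x, tlift (@tens_over k R P N) (s x) = x].
Proof.
have ls := section_linear hs.
have bi (p : P) : bilin (fun (r : R) (n' : N) => act P r p \ox n').
  by lin.
have b : bilin (@sg P).
  apply: bilin_intro => [n|p]; first by apply: linear_tlift_fun => r n'; lin.
  exact: linear_tlift.
have e r p n : sg (act P r p) n = sg p (act N r n).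
  rewrite /sg (section_act hs); move: (sigma n).
  apply: tens_ext => [||a n'].
  + exact: tlift_linear.
  + exact: linear_comp (tlift_linear (bi p)) (free_act_linear _).
  by rewrite free_actE !tliftE // -actM.
exists (otlift (@sg _)); split; [exact: (otlift_linear b e)|exact: (otliftE b e)|].
apply: tens_over_ext => // [|p n].
  exact: linear_comp (tlift_linear (@tens_over_bilin _ _ _ _)) (otlift_linear b e).
rewrite (otliftE b e) -{2}(section_mult hs n) /sg; move: (sigma n).
apply: tens_ext => [||a n'].
+ exact: linear_comp (tlift_linear (@tens_over_bilin _ _ _ _)) (tlift_linear (bi p)).
+ by apply: linear_tens_overr; apply: tlift_linear (act_bilin N).
rewrite !tliftE //; try exact: act_bilin; try exact: tens_over_bilin.
by rewrite tens_over_balanced.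
Qed.

Lemma projective_flatl (P1 P2 P3 : rmodule R) (f : P1 -> P2) (g : P2 -> P3) :
  module_hom f -> module_hom g -> (forall y, g y = 0 -> exists x, f x = y) ->
  forall u : tensor_over P2 N, over_mapl g u = 0 -> exists v, over_mapl f v = u.
Proof.
move=> hf hg ex u hu.
have [s2 [l2 e2 r2]] := projective_retractl P2; have [s3 [l3 e3 r3]] := projective_retractl P3.
have [lgm gm] := over_maplP N hg; have [lfm fm] := over_maplP N hf.
have bg : bilin (fun y (n : N) => g y \ox n) by case: hg => lg _; lin.
have bf : bilin (fun x (n : N) => f x \ox n) by case: hf => lf _; lin.
have [|v hv] := @tensor_exactl k N _ _ _ f g hf.1 hg.1 ex (s2 u).
  transitivity (s3 (over_mapl g u)); last by rewrite hu (lin0 l3).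
  move: u {hu}; apply: tens_over_ext => [||p n].
  + exact: linear_comp (tlift_linear bg) l2.
  + exact: linear_comp l3 lgm.
  rewrite e2 gm e3 /sg (tlift_comp _ _ (tlift_linear bg)); apply: tlift_eq => r n'.
  by rewrite tliftE // hg.2.
exists (tlift (@tens_over k R P1 N) v).
rewrite -[u]r2 -hv; move: v {hv}; apply: tens_ext => [||p n].
+ exact: linear_comp lfm (tlift_linear (@tens_over_bilin _ _ _ _)).
+ exact: linear_comp (tlift_linear (@tens_over_bilin _ _ _ _)) (tlift_linear bf).
by rewrite !tliftE ?fm //; exact: tens_over_bilin.
Qed.
End ProjectiveLeft.
End Flatness.

Section FiniteSums.
Variables (k : fieldType) (V W : lmodType k).

(** One list works for all [Z] and [phi], bilinear or not, because [ext] evaluates on a fixed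
    representative of [u]; interchanging two [tlift] thus becomes interchanging two finite sums. *)
Lemma tlift_sum (u : tensor V W) : exists s : seq (k * (V * W)), forall (Z : lmodType k) (phi : V -> W -> Z),
  tlift phi u = \sum_(x <- s) x.1 *: phi x.2.1 x.2.2.
Proof.
exists (repr (repr (u : quot _))) => Z phi.
by rewrite /tlift /ext -[repr (u : quot _)]freeg_repr fglift_Freeg freeg_repr.
Qed.

End FiniteSums.

Lemma tlift_swap (k : fieldType) (V W V' W' Z : lmodType k) (phi : V -> W -> V' -> W' -> Z)
    (u : tensor V W) (u' : tensor V' W') :
  tlift (fun v w => tlift (phi v w) u') u = tlift (fun v' w' => tlift (fun v w => phi v w v' w') u) u'.
Proof.
have [s hs] := tlift_sum u; have [s' hs'] := tlift_sum u'.
rewrite hs hs'; under eq_bigr do rewrite hs' scaler_sumr.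
rewrite exchange_big; apply: eq_bigr => j _.
by rewrite hs scaler_sumr; apply: eq_bigr => i _; rewrite !scalerA mulrC.
Qed.

(** * Hopf algebras and crossed products *)

Section SweedlerCalculus.
Variables (k : fieldType) (H : algType k) (HH : hopf H).
Local Notation sw := (sw (comul HH)).
Local Notation S := (antipode HH).
Local Notation eps := (counit HH).
Implicit Types U V W Z : lmodType k.

Lemma linear_sw U Z (phi : H -> H -> Z) (f : U -> H) : bilin phi -> linear f ->
  linear (fun x => sw (f x) phi).
Proof. by move=> b lf; apply: linear_tlift => //; apply: linear_hom. Qed.

Lemma linear_sw_fun U Z (phi : U -> H -> H -> Z) h : (forall a b, linear (fun x => phi x a b)) ->
  linear (fun x => sw h (phi x)).
Proof. exact: linear_tlift_fun. Qed.

Lemma sw_eq Z (phi psi : H -> H -> Z) h : (forall a b, phi a b = psi a b) -> sw h phi = sw h psi.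
Proof. exact: tlift_eq. Qed.

Lemma sw_comp Z Z' (g : Z -> Z') (phi : H -> H -> Z) h : linear g ->
  g (sw h phi) = sw h (fun a b => g (phi a b)).
Proof. exact: tlift_comp. Qed.

Lemma sw_swap Z (phi : H -> H -> H -> H -> Z) h l :
  sw h (fun a b => sw l (phi a b)) = sw l (fun c d => sw h (fun a b => phi a b c d)).
Proof. exact: tlift_swap. Qed.

Lemma sw_tlift_swap V W Z (phi : H -> H -> V -> W -> Z) h u :
  sw h (fun a b => tlift (phi a b) u) = tlift (fun c d => sw h (fun a b => phi a b c d)) u.
Proof. exact: tlift_swap. Qed.

Lemma swZ Z c (phi : H -> H -> Z) h : c *: sw h phi = sw h (fun a b => c *: phi a b).
Proof. by apply: (sw_comp (g := fun z => c *: z)); lin. Qed.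

(** [comulA] is an identity in [(H (x) H) (x) H]; trilinearity of [phi] gives the linear map [F]
    that evaluates both sides. *)
Lemma sw_assoc Z (phi : H -> H -> H -> Z) h :
  (forall y z, linear (fun x => phi x y z)) -> (forall x z, linear (fun y => phi x y z)) ->
  (forall x y, linear (fun z => phi x y z)) ->
  sw h (fun a c => sw a (fun x y => phi x y c)) = sw h (fun x b => sw b (fun y c => phi x y c)).
Proof.
move=> l1 l2 l3; pose F := tlift (fun t c => tlift (fun x y => phi x y c) t).
have bi c : bilin (fun x y => phi x y c) by apply: bilin_intro => ?.
have bF : bilin (fun t c => tlift (fun x y => phi x y c) t).
  by apply: bilin_intro => [c|t]; [apply: tlift_linear|apply: linear_tlift_fun].
have lF : linear F by apply: tlift_linear.
have := congr1 F (comulA HH h); rewrite !(sw_comp _ _ lF).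
have e x y c : F ((x \ox y) \ox c) = phi x y c by rewrite /F !tliftE.
move=> E; transitivity (sw h (fun h1 h2 => F (sw h1 (fun x y => x \ox y \ox h2)))).
  by apply: sw_eq => a c; rewrite (sw_comp _ _ lF); apply: sw_eq.
by rewrite E; apply: sw_eq => a c; rewrite (sw_comp _ _ lF); apply: sw_eq.
Qed.

Lemma sw_counitl Z (phi : H -> Z) h : linear phi -> sw h (fun a b => eps a *: phi b) = phi h.
Proof.
by move=> l; rewrite -{2}[h](comul1l HH) (sw_comp _ _ l); apply: sw_eq => a b; rewrite (linZ l).
Qed.

Lemma sw_counitr Z (phi : H -> Z) h : linear phi -> sw h (fun a b => eps b *: phi a) = phi h.
Proof.
by move=> l; rewrite -{2}[h](comul1r HH) (sw_comp _ _ l); apply: sw_eq => a b; rewrite (linZ l).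
Qed.

Lemma sw_antipodel Z (phi : H -> Z) h : linear phi -> sw h (fun a b => phi (S a * b)) = eps h *: phi 1.
Proof. by move=> l; rewrite -(sw_comp _ _ l) (antipodel HH) (linZ l). Qed.

Lemma sw_antipoder Z (phi : H -> Z) h : linear phi -> sw h (fun a b => phi (a * S b)) = eps h *: phi 1.
Proof. by move=> l; rewrite -(sw_comp _ _ l) (antipoder HH) (linZ l). Qed.

Lemma sw_unit Z (phi : H -> H -> Z) : bilin phi -> sw 1 phi = phi 1 1.
Proof. by move=> b; rewrite /Defs.sw comul1 tliftE. Qed.

Lemma sw_mul Z (phi : H -> H -> Z) h l : bilin phi ->
  sw (h * l) phi = sw h (fun a b => sw l (fun c d => phi (a * c) (b * d))).
Proof.
move=> b; rewrite {1}/Defs.sw comulM (sw_comp _ _ (tlift_linear b)); apply: sw_eq => x y.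
by rewrite (sw_comp _ _ (tlift_linear b)); apply: sw_eq => z t; rewrite tliftE.
Qed.

(** Applying [eps] to [S h(1) h(2) = eps(h) 1] splits it into [eps (S h(1)) eps (h(2))], and the
    counit absorbs the second factor. *)
Lemma counit_antipode h : eps (S h) = eps h.
Proof.
have l : linear (fun x => eps x : k^o) by move=> c x y; rewrite linearP.
have := sw_antipodel h l; rewrite counit1 [RHS]mulr1 => <-.
rewrite -{1}[h](comul1r HH) (sw_comp _ _ (linear_bundled S)) (sw_comp _ _ l).
refine (@sw_eq k^o _ _ h _) => a b.
by rewrite linearZ /= scalarZ counitM mulrC.
Qed.
End SweedlerCalculus.

Ltac lin_sweedler ::= lazymatch goal with
  | |- GRing.linear_for _ (fun x => Defs.sw _ _ _) => first [apply: linear_sw_fun | apply: linear_sw]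
  end.

Section AntipodeComul.
Variables (k : fieldType) (H : algType k) (HH : hopf H).
Local Notation sw := (sw (comul HH)).
Local Notation S := (antipode HH).
Local Notation eps := (counit HH).

(* Both sides are the convolution inverse of the coproduct; they are compared
   by evaluating x h(2) S(h(5)) (x) y h(3) S(h(4)), x (x) y = S(h(1))(1) (x) S(h(1))(2), in two ways. *)
Lemma sw_antipode (Z : lmodType k) (phi : H -> H -> Z) h : bilin phi ->
  sw (S h) phi = sw h (fun a b => phi (S b) (S a)).
Proof.
move=> b.
transitivity (sw h (fun a b => sw (S a) (fun x y => sw b (fun c d =>
    sw c (fun p q => sw d (fun r s => phi (x * (p * S s)) (y * (q * S r)))))))).
  transitivity (sw h (fun a b => eps b *: sw (S a) phi)).
    by rewrite sw_counitr //; lin.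
  apply: sw_eq => a c; rewrite swZ; apply: sw_eq => x y.
  rewrite (sw_assoc HH (phi := fun p q d => sw d (fun r s => phi (x * (p * S s)) (y * (q * S r))))); try by lin.
  transitivity (sw c (fun p e => phi (x * (p * S e)) y)).
    rewrite (sw_antipoder HH (phi := fun z => phi (x * z) y)) ?mulr1 //; lin.
  apply: sw_eq => p e.
  rewrite -(sw_assoc HH (phi := fun q r s => phi (x * (p * S s)) (y * (q * S r)))); try by lin.
  transitivity (sw e (fun t s => eps t *: phi (x * (p * S s)) y)).
    by rewrite sw_counitl //; lin.
  apply: sw_eq => t s.
  by rewrite (sw_antipoder HH (phi := fun z => phi (x * (p * S s)) (y * z))) ?mulr1 //; lin.
transitivity (sw h (fun a b => sw b (fun c d => sw (S a * c) (fun x y =>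
    sw d (fun r s => phi (x * S s) (y * S r)))))).
  apply: sw_eq => a c; rewrite sw_swap; apply: sw_eq => p d.
  rewrite sw_mul; last by lin.
  apply: sw_eq => x y; apply: sw_eq => q t; apply: sw_eq => r s.
  by rewrite !mulrA.
rewrite -(sw_assoc HH (phi := fun a c d => sw (S a * c) (fun x y =>
    sw d (fun r s => phi (x * S s) (y * S r))))); try by lin.
transitivity (sw h (fun t d => eps t *: sw d (fun r s => phi (S s) (S r)))).
  apply: sw_eq => t d.
  rewrite (sw_antipodel HH (phi := fun z => sw z (fun x y => sw d (fun r s => phi (x * S s) (y * S r))))); last by lin.
  by rewrite sw_unit; [congr (_ *: _); apply: sw_eq => r s; rewrite !mul1r|lin].
by rewrite sw_counitl //; lin.
Qed.
End AntipodeComul.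

Lemma linear_wactl (k : fieldType) (H : algType k) (HH : hopf H) (A : algType k)
    (w : weak_action HH A) (U : lmodType k) (f : U -> H) a :
  linear f -> linear (fun x => wact w (f x) a).
Proof. by move=> lf; apply: (linear_bilinl _ (wact_bilin w)). Qed.
Lemma linear_wactr (k : fieldType) (H : algType k) (HH : hopf H) (A : algType k)
    (w : weak_action HH A) (U : lmodType k) (f : U -> A) h :
  linear f -> linear (fun x => wact w h (f x)).
Proof. by move=> lf; apply: (linear_bilinr _ (wact_bilin w)). Qed.

Ltac lin_crossed ::= lazymatch goal with
  | |- GRing.linear_for _ (fun x => wact _ _ _) => first [apply: linear_wactl | apply: linear_wactr]
  end.

Section CrossedProductCalculus.
Variables (k : fieldType) (H : algType k) (HH : hopf H) (A : algType k).
Variable C : crossed_product HH A.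
Local Notation E := (cp_alg C : algType k).
Local Notation sw := (sw (comul HH)).
Local Notation eps := (counit HH).
Local Notation f := (cocycle C).
Local Notation "a ^^ h" := (wact (cp_act C) h a) (at level 30).
Local Notation iota := (@cp_of_alg k H HH A C).
Local Notation gamma := (@cp_of_hopf k H HH A C).

Lemma iota_linear : linear iota.
Proof. by rewrite /cp_of_alg; lin. Qed.
Lemma gamma_linear : linear gamma.
Proof. by rewrite /cp_of_hopf; lin. Qed.

Lemma linear_iota (U : lmodType k) (g : U -> A) : linear g -> linear (fun x => iota (g x)).
Proof. exact: linear_comp iota_linear. Qed.
Lemma linear_gamma (U : lmodType k) (g : U -> H) : linear g -> linear (fun x => gamma (g x)).
Proof. exact: linear_comp gamma_linear. Qed.

Lemma cp_mulE (a : A) (h : H) (b : A) (l : H) : (a \ox h : E) * (b \ox l : E) =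
  sw h (fun h1 h' => sw h' (fun h2 h3 => sw l (fun l1 l2 =>
    (a * b ^^ h1 * f (h2 \ox l1)) \ox (h3 * l2)))) :> E.
Proof.
rewrite /GRing.mul /= /cp_mul /sw3 /Defs.sw tliftE.
  by rewrite tliftE //; lin.
by lin.
Qed.

(** The map [id (x) eps], a left inverse of [iota]; it reads identities of [A] off identities of
    [E]. *)
Definition cp_eps : E -> A := tlift (fun a h => eps h *: a).
Lemma cp_eps_bilin : bilin (fun (a : A) h => eps h *: a).
Proof. by lin. Qed.
Lemma cp_eps_linear : linear cp_eps.
Proof. exact: tlift_linear cp_eps_bilin. Qed.
Lemma cp_epsE a h : cp_eps (a \ox h) = eps h *: a.
Proof. exact: (tliftE cp_eps_bilin). Qed.

Lemma cp_one : (1 : E) = 1 \ox 1.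
Proof. by []. Qed.

(** A [crossed_product] provides associativity and the unit laws; the normalization of the cocycle
    is recovered by applying [id (x) eps] to [gamma h * 1 = gamma h]. *)
Lemma cocycle_right1 h : f (h \ox 1) = eps h *: 1.
Proof.
have := congr1 cp_eps (mulr1 (gamma h : E)).
rewrite cp_one cp_mulE !cp_epsE (sw_comp _ _ _ cp_eps_linear) => <-.
symmetry; transitivity (sw h (fun h1 h' => eps h1 *: f (h' \ox 1))); last first.
  by rewrite sw_counitl //; lin.
apply: sw_eq => h1 h'; rewrite (sw_comp _ _ _ cp_eps_linear).
transitivity (eps h1 *: sw h' (fun h2 h3 => eps h3 *: f (h2 \ox 1))); last first.
  by rewrite sw_counitr //; lin.
rewrite swZ; apply: sw_eq => h2 h3.
rewrite sw_unit; last by lin.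
rewrite cp_epsE wact1r mul1r !mulr1 -scalerAl mul1r.
by rewrite !scalerA mulrC.
Qed.

Lemma cocycle_left1 h : f (1 \ox h) = eps h *: 1.
Proof.
have := congr1 cp_eps (mul1r (gamma h : E)).
rewrite cp_one cp_mulE !cp_epsE => <-.
rewrite sw_unit; last by lin.
rewrite sw_unit; last by lin.
rewrite (sw_comp _ _ _ cp_eps_linear).
symmetry; transitivity (sw h (fun l1 l2 => eps l2 *: f (1 \ox l1))); last first.
  by rewrite sw_counitr //; lin.
by apply: sw_eq => l1 l2; rewrite cp_epsE wact1l !mul1r.
Qed.

Lemma iota_mul_tens a b l : iota a * (b \ox l) = (a * b) \ox l :> E.
Proof.
rewrite cp_mulE sw_unit; last by lin.
rewrite sw_unit; last by lin.
transitivity (sw l (fun l1 l2 => eps l1 *: ((a * b) \ox l2 : E))).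
  apply: sw_eq => l1 l2; rewrite wact1l cocycle_left1 mul1r -scalerAr mulr1.
  by rewrite (linZ (linear_tensl _ (@linear_id k A))).
by rewrite sw_counitl //; lin.
Qed.

Lemma iotaM a b : iota (a * b) = iota a * iota b.
Proof. by rewrite [RHS]iota_mul_tens. Qed.

Lemma iota_gamma a h : iota a * gamma h = a \ox h.
Proof. by rewrite iota_mul_tens mulr1. Qed.

Lemma gamma_iota h a : gamma h * iota a = sw h (fun h1 h2 => iota (a ^^ h1) * gamma h2).
Proof.
rewrite cp_mulE; apply: sw_eq => h1 h'.
transitivity (sw h' (fun h2 h3 => eps h2 *: (iota (a ^^ h1) * gamma h3))).
  apply: sw_eq => h2 h3; rewrite sw_unit; last by lin.
  rewrite cocycle_right1 mul1r mulr1 -scalerAr mulr1 iota_gamma.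
  by rewrite (linZ (linear_tensl _ (@linear_id k A))).
by rewrite sw_counitl //; apply: linear_mulr; apply: gamma_linear.
Qed.

Lemma gamma_gamma h l : gamma h * gamma l =
  sw h (fun h1 h2 => sw l (fun l1 l2 => iota (f (h1 \ox l1)) * gamma (h2 * l2))).
Proof.
rewrite cp_mulE.
transitivity (sw h (fun h1 h' => eps h1 *: sw h' (fun h2 h3 => sw l (fun l1 l2 =>
  iota (f (h2 \ox l1)) * gamma (h3 * l2))))).
  apply: sw_eq => h1 h'; rewrite swZ; apply: sw_eq => h2 h3; rewrite swZ; apply: sw_eq => l1 l2.
  rewrite wact1r mul1r -scalerAl mul1r iota_gamma.
  by rewrite (linZ (linear_tensl _ (@linear_id k A))).
rewrite sw_counitl //; apply: linear_sw => //; apply: bilin_intro => ?; apply: linear_sw_fun => ? ?.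
  by apply: linear_mull; apply: linear_iota; lin.
by apply: linear_mulr; apply: linear_gamma; lin.
Qed.

Lemma gamma1 : gamma 1 = 1.
Proof. by []. Qed.
Lemma iota1 : iota 1 = 1.
Proof. by []. Qed.
End CrossedProductCalculus.

Lemma linear_cp_inv (k : fieldType) (H : algType k) (HH : hopf H) (A : algType k)
    (C : crossed_product HH A) (finv : {linear tensor H H -> A}) (U : lmodType k) (g : U -> H) :
  linear g -> linear (fun x => @cp_of_hopf_inv k H HH A C finv (g x)).
Proof. by move=> lg; rewrite /cp_of_hopf_inv /sw3; lin. Qed.

Ltac lin_crossed ::= lazymatch goal with
  | |- GRing.linear_for _ (fun x => wact _ _ _) => first [apply: linear_wactl | apply: linear_wactr]
  | |- GRing.linear_for _ (fun x => cp_of_alg _ _) => apply: linear_iota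
  | |- GRing.linear_for _ (fun x => cp_of_hopf _ _) => apply: linear_gamma
  | |- GRing.linear_for _ (fun x => cp_of_hopf_inv _ _ _) => apply: linear_cp_inv
  end.

(** * The convolution inverse of h |-> 1 # h *)

Section HopfInverse.
Variables (k : fieldType) (H : algType k) (HH : hopf H) (A : algType k).
Variable C : crossed_product HH A.
Variable finv : {linear tensor H H -> A}.
Hypothesis hfinv : convolution_inverse HH (cocycle C) finv.
Local Notation E := (cp_alg C : algType k).
Local Notation sw := (sw (comul HH)).
Local Notation S := (antipode HH).
Local Notation eps := (counit HH).
Local Notation f := (cocycle C).
Local Notation "a ^^ h" := (wact (cp_act C) h a) (at level 30).
Local Notation iota := (@cp_of_alg k H HH A C).
Local Notation gamma := (@cp_of_hopf k H HH A C).
Local Notation u := (@cp_of_hopf_inv k H HH A C finv).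

Lemma cp_invE h : u h = sw h (fun h1 h' => sw h' (fun h2 h3 => iota (finv (S h2 \ox h3)) * gamma (S h1))).
Proof. by apply: sw_eq => h1 h'; apply: sw_eq => h2 h3; rewrite iota_gamma. Qed.

(** Since [S] reverses the coproduct, the sum is that of [finv(S h3, h4) f(S h2, h5) # S(h1) h6].
    The two coefficients form the convolution product of [finv] and [f] at [(S t, e)], which is a
    product of counits; what is left is [S(h1) h2], and the antipode axiom applies. *)
Lemma cp_inv_left h : sw h (fun a b => u a * gamma b) = eps h *: 1.
Proof.
transitivity (sw h (fun h1 c => sw c (fun h2 d => sw d (fun h3 b =>
    iota (finv (S h2 \ox h3)) * (gamma (S h1) * gamma b))))).
  transitivity (sw h (fun a b => sw a (fun h1 h' => sw h' (fun h2 h3 =>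
      iota (finv (S h2 \ox h3)) * gamma (S h1)) * gamma b))).
    by apply: sw_eq => a b; rewrite cp_invE (sw_comp HH (g := fun z : E => z * gamma b)) //; lin.
  rewrite (sw_assoc HH (phi := fun h1 h' b => sw h' (fun h2 h3 =>
      iota (finv (S h2 \ox h3)) * gamma (S h1)) * gamma b)); try by lin.
  apply: sw_eq => h1 c.
  rewrite -(sw_assoc HH (phi := fun h2 h3 b =>
    iota (finv (S h2 \ox h3)) * (gamma (S h1) * gamma b))); try by lin.
  apply: sw_eq => h' b; rewrite (sw_comp HH (g := fun z : E => z * gamma b)); last by lin.
  by apply: sw_eq => h2 h3; rewrite mulrA.
transitivity (sw h (fun h1 c => sw h1 (fun p q => sw c (fun h2 d => sw d (fun e b2 => sw e (fun h3 b1 =>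
    iota (finv (S h2 \ox h3)) * (iota (f (S q \ox b1)) * gamma (S p * b2)))))))).
  apply: sw_eq => h1 c; rewrite sw_swap; apply: sw_eq => h2 d.
  transitivity (sw d (fun h3 b => sw b (fun b1 b2 => sw h1 (fun p q =>
      iota (finv (S h2 \ox h3)) * (iota (f (S q \ox b1)) * gamma (S p * b2)))))).
    apply: sw_eq => h3 b; rewrite gamma_gamma sw_antipode; last by lin.
    rewrite (sw_comp HH (g := fun z : E => iota (finv (S h2 \ox h3)) * z)); last by lin.
    rewrite sw_swap; apply: sw_eq => p q.
    by rewrite (sw_comp HH (g := fun z : E => iota (finv (S h2 \ox h3)) * z)); last by lin.
  rewrite -(sw_assoc HH (phi := fun h3 b1 b2 => sw h1 (fun p q =>
      iota (finv (S h2 \ox h3)) * (iota (f (S q \ox b1)) * gamma (S p * b2))))); try by lin.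
  rewrite sw_swap; apply: sw_eq => e b2; exact: sw_swap.
rewrite (sw_assoc HH (phi := fun p q c => sw c (fun h2 d => sw d (fun e b2 => sw e (fun h3 b1 =>
    iota (finv (S h2 \ox h3)) * (iota (f (S q \ox b1)) * gamma (S p * b2))))))); try by lin.
transitivity (sw h (fun p c => gamma (S p * c))); last by rewrite sw_antipodel //; lin.
apply: sw_eq => p c.
rewrite -(sw_assoc HH (phi := fun q h2 d => sw d (fun e b2 => sw e (fun h3 b1 =>
    iota (finv (S h2 \ox h3)) * (iota (f (S q \ox b1)) * gamma (S p * b2)))))); try by lin.
transitivity (sw c (fun t d => eps t *: gamma (S p * d))); last by rewrite sw_counitl //; lin.
apply: sw_eq => t d; rewrite sw_swap.
transitivity (eps t *: sw d (fun e b2 => eps e *: gamma (S p * b2))); last by rewrite sw_counitl //; lin.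
rewrite swZ; apply: sw_eq => e b2.
transitivity (iota (sw (S t) (fun x y => sw e (fun h3 b1 => finv (x \ox h3) * f (y \ox b1)))) * gamma (S p * b2)).
  rewrite sw_antipode; last by lin.
  rewrite (sw_comp HH (g := fun z => iota z * gamma (S p * b2))); last by lin.
  apply: sw_eq => q h2; rewrite (sw_comp HH (g := fun z => iota z * gamma (S p * b2))); last by lin.
  by apply: sw_eq => h3 b1; rewrite iotaM mulrA.
rewrite (hfinv _ _).2 counit_antipode (linZ (@iota_linear _ _ _ _ C)) iota1 -scalerAl mul1r.
by rewrite scalerA.
Qed.

(** The [H]-component of the product is [x2 * S y1], built from two adjacent coproduct factors, so
    it collapses and the sum lies in [A]. *)
Lemma gamma_gammaS t : sw t (fun x y => gamma x * gamma (S y)) = iota (sw t (fun x y => f (x \ox S y))).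
Proof.
transitivity (sw t (fun x y => sw x (fun x1 x2 => sw y (fun y1 y2 =>
    iota (f (x1 \ox S y2)) * gamma (x2 * S y1))))).
  apply: sw_eq => x y; rewrite gamma_gamma; apply: sw_eq => x1 x2.
  by rewrite sw_antipode //; lin.
rewrite (sw_assoc HH (phi := fun x1 x2 y => sw y (fun y1 y2 =>
    iota (f (x1 \ox S y2)) * gamma (x2 * S y1)))); try by lin.
rewrite (sw_comp _ _ _ (@iota_linear _ _ _ _ C)); apply: sw_eq => x1 c.
rewrite -(sw_assoc HH (phi := fun x2 y1 y2 => iota (f (x1 \ox S y2)) * gamma (x2 * S y1))); try by lin.
transitivity (sw c (fun d y2 => eps d *: iota (f (x1 \ox S y2)))); last by rewrite sw_counitl //; lin.
apply: sw_eq => d y2.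
by rewrite (sw_antipoder HH (phi := fun z => iota (f (x1 \ox S y2)) * gamma z)) ?gamma1 ?mulr1 //; lin.
Qed.

Lemma gamma_inv_coinvariant h : exists a, sw h (fun a b => gamma a * u b) = iota a.
Proof.
exists (sw h (fun a1 c => sw c (fun t h' => sw h' (fun h2 h3 =>
  finv (S h2 \ox h3) ^^ a1 * sw t (fun x y => f (x \ox S y)))))).
transitivity (sw h (fun a b => sw a (fun a1 a2 => sw b (fun h1 h' => sw h' (fun h2 h3 =>
    iota (finv (S h2 \ox h3) ^^ a1) * (gamma a2 * gamma (S h1))))))).
  apply: sw_eq => a b; rewrite cp_invE (sw_comp HH (g := fun z : E => gamma a * z)); last by lin.
  rewrite sw_swap; apply: sw_eq => h1 h'; rewrite (sw_comp HH (g := fun z : E => gamma a * z)); last by lin.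
  rewrite sw_swap; apply: sw_eq => h2 h3; rewrite mulrA gamma_iota.
  rewrite (sw_comp HH (g := fun z : E => z * gamma (S h1))); last by lin.
  by apply: sw_eq => a1 a2; rewrite mulrA.
rewrite (sw_assoc HH (phi := fun a1 a2 b => sw b (fun h1 h' => sw h' (fun h2 h3 =>
    iota (finv (S h2 \ox h3) ^^ a1) * (gamma a2 * gamma (S h1)))))); try by lin.
rewrite (sw_comp _ _ _ (@iota_linear _ _ _ _ C)); apply: sw_eq => a1 c.
rewrite -(sw_assoc HH (phi := fun a2 h1 h' => sw h' (fun h2 h3 =>
    iota (finv (S h2 \ox h3) ^^ a1) * (gamma a2 * gamma (S h1))))); try by lin.
rewrite (sw_comp _ _ _ (@iota_linear _ _ _ _ C)); apply: sw_eq => t h'.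
rewrite (sw_comp _ _ _ (@iota_linear _ _ _ _ C)) sw_swap; apply: sw_eq => h2 h3.
rewrite -(sw_comp HH (g := fun z : E => iota (finv (S h2 \ox h3) ^^ a1) * z)); last by lin.
by rewrite gamma_gammaS iotaM.
Qed.

(** Let [G] be the convolution product of [gamma] and [u]. It takes values in [A] by
    [gamma_inv_coinvariant], and the left inverse gives [G(h1) gamma(h2) = gamma(h)]. Under
    [id (x) eps] this reads [e h = eps h], where [G = iota e]. *)
Lemma cp_inv_right h : sw h (fun a b => gamma a * u b) = eps h *: 1.
Proof.
pose G h := sw h (fun a b => gamma a * u b).
pose e h := cp_eps (G h).
have lG : linear G by rewrite /G; lin.
have le : linear e by apply: linear_comp lG; apply: cp_eps_linear.
have Ge h' : G h' = iota (e h').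
  have [a ha] := gamma_inv_coinvariant h'; rewrite /e /G ha /cp_of_alg cp_epsE.
  by rewrite counit1 scale1r.
have Gg h' : sw h' (fun a b => G a * gamma b) = gamma h'.
  transitivity (sw h' (fun a b => sw a (fun x y => gamma x * u y * gamma b))).
    by apply: sw_eq => a b; rewrite /G (sw_comp HH (g := fun z : E => z * gamma b)) //; lin.
  rewrite (sw_assoc HH (phi := fun x y b => gamma x * u y * gamma b)); try by lin.
  transitivity (sw h' (fun x b => eps b *: gamma x)); last by rewrite sw_counitr //; lin.
  apply: sw_eq => x c; transitivity (gamma x * sw c (fun y b => u y * gamma b)).
    rewrite (sw_comp HH (g := fun z : E => gamma x * z)); last by lin.
    by apply: sw_eq => y b; rewrite mulrA.
  by rewrite cp_inv_left -scalerAr mulr1.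
rewrite -/(G h) Ge; have := congr1 (@cp_eps _ _ _ _ C) (Gg h).
rewrite (sw_comp _ _ _ (@cp_eps_linear _ _ _ _ C)) [RHS]cp_epsE.
have -> : sw h (fun a b => cp_eps (G a * gamma b)) = e h.
  transitivity (sw h (fun a b => eps b *: e a)); last by rewrite sw_counitr.
  by apply: sw_eq => a b; rewrite Ge iota_gamma cp_epsE.
by move=> ->; rewrite (linZ (@iota_linear _ _ _ _ C)) iota1.
Qed.

Lemma cp_inv1 : u 1 = 1.
Proof.
have := cp_inv_left 1; rewrite sw_unit; last by lin.
by rewrite gamma1 mulr1 counit1 scale1r.
Qed.

(** The commutation rule [gamma_iota], multiplied by [u] on both sides. *)
Lemma iota_cp_inv a h : iota a * u h = sw h (fun h1 h2 => u h1 * iota (a ^^ h2)).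
Proof.
transitivity (sw h (fun h1 c => sw c (fun h2 d => sw d (fun x y =>
    u h1 * (iota (a ^^ h2) * gamma x) * u y)))); last first.
  apply: sw_eq => h1 c; transitivity (sw c (fun h2 d => eps d *: (u h1 * iota (a ^^ h2)))); last first.
    by rewrite sw_counitr //; lin.
  apply: sw_eq => h2 d; rewrite -[u h1 * _]mulr1 scalerAr -cp_inv_right.
  rewrite (sw_comp HH (g := fun z : E => u h1 * iota (a ^^ h2) * z)); last by lin.
  by apply: sw_eq => x y; rewrite !mulrA.
transitivity (sw h (fun h1 c => sw c (fun t y => u h1 * gamma t * (iota a * u y)))); last first.
  apply: sw_eq => h1 c.
  rewrite -(sw_assoc HH (phi := fun h2 x y => u h1 * (iota (a ^^ h2) * gamma x) * u y)); try by lin.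
  apply: sw_eq => t y; rewrite mulrA -[u h1 * gamma t * _]mulrA gamma_iota.
  by rewrite (sw_comp HH (g := fun z : E => u h1 * z * u y)) //; lin.
rewrite -(sw_assoc HH (phi := fun h1 t y => u h1 * gamma t * (iota a * u y))); try by lin.
transitivity (sw h (fun s y => eps s *: (iota a * u y))); first by rewrite sw_counitl //; lin.
apply: sw_eq => s y.
rewrite -(sw_comp HH (g := fun z : E => z * (iota a * u y))); last by lin.
by rewrite cp_inv_left -scalerAl mul1r.
Qed.

(** Both sides equal the sum of [u(l1) u(h1) gamma(h2) gamma(l2) u(h3 l3)]. Contracting [u] with
    [gamma] from the inside gives the left side; expanding [gamma(h2) gamma(l2)] by the cocycle and
    contracting with the last [u] gives the right side. *)
Lemma cp_invM h l : u (h * l) =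
  sw h (fun h1 h2 => sw l (fun l1 l2 => u l1 * u h1 * iota (f (h2 \ox l2)))).
Proof.
transitivity (sw h (fun h1 c => sw c (fun t y => sw l (fun l1 c' => sw c' (fun t' y' =>
    u l1 * (u h1 * gamma t) * gamma t' * u (y * y')))))).
  rewrite -(sw_assoc HH (phi := fun h1 t y => sw l (fun l1 c' => sw c' (fun t' y' =>
    u l1 * (u h1 * gamma t) * gamma t' * u (y * y'))))); try by lin.
  transitivity (sw h (fun s y => eps s *: u (y * l))); first by rewrite sw_counitl //; lin.
  apply: sw_eq => s y.
  transitivity (eps s *: sw l (fun r y' => eps r *: u (y * y'))); first by rewrite sw_counitl //; lin.
  rewrite swZ sw_swap.
  transitivity (sw l (fun l1 c' => sw c' (fun t' y' => eps s *: (u l1 * gamma t' * u (y * y'))))); last first.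
    apply: sw_eq => l1 c'; rewrite sw_swap; apply: sw_eq => t' y'.
    rewrite -(sw_comp HH (g := fun z : E => u l1 * z * gamma t' * u (y * y'))); last by lin.
    by rewrite cp_inv_left -scalerAr mulr1 -!scalerAl.
  rewrite -(sw_assoc HH (phi := fun l1 t' y' => eps s *: (u l1 * gamma t' * u (y * y')))); try by lin.
  apply: sw_eq => r y'.
  rewrite -(sw_comp HH (g := fun z : E => eps s *: (z * u (y * y')))); last by lin.
  by rewrite cp_inv_left -scalerAl mul1r.
apply: sw_eq => h1 c.
transitivity (sw c (fun h2 d => sw d (fun x y => sw l (fun l1 c' => sw c' (fun l2 d' => sw d' (fun x' y' =>
    u l1 * u h1 * (iota (f (h2 \ox l2)) * gamma (x * x')) * u (y * y'))))))).
  rewrite -(sw_assoc HH (phi := fun h2 x y => sw l (fun l1 c' => sw c' (fun l2 d' => sw d' (fun x' y' =>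
    u l1 * u h1 * (iota (f (h2 \ox l2)) * gamma (x * x')) * u (y * y')))))); try by lin.
  apply: sw_eq => t y; rewrite sw_swap; apply: sw_eq => l1 c'.
  transitivity (sw c' (fun l2 d' => sw d' (fun x' y' => sw t (fun h2 x =>
      u l1 * u h1 * (iota (f (h2 \ox l2)) * gamma (x * x')) * u (y * y'))))); last first.
    by rewrite sw_swap; apply: sw_eq => l2 d'; rewrite sw_swap.
  rewrite -(sw_assoc HH (phi := fun l2 x' y' => sw t (fun h2 x =>
      u l1 * u h1 * (iota (f (h2 \ox l2)) * gamma (x * x')) * u (y * y')))); try by lin.
  apply: sw_eq => t' y'; rewrite mulrA -[_ * gamma t * gamma t']mulrA gamma_gamma sw_swap.
  rewrite (sw_comp HH (g := fun z : E => u l1 * u h1 * z * u (y * y'))); last by lin.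
  by apply: sw_eq => h2 x; rewrite (sw_comp HH (g := fun z : E => u l1 * u h1 * z * u (y * y'))) //; lin.
transitivity (sw c (fun h2 d => eps d *: sw l (fun l1 l2 => u l1 * u h1 * iota (f (h2 \ox l2))))); last first.
  by rewrite sw_counitr //; lin.
apply: sw_eq => h2 d; rewrite sw_swap swZ; apply: sw_eq => l1 c'.
transitivity (sw c' (fun l2 d' => eps d' *: (eps d *: (u l1 * u h1 * iota (f (h2 \ox l2)))))); last first.
  by rewrite sw_counitr //; lin.
rewrite sw_swap; apply: sw_eq => l2 d'.
transitivity (u l1 * u h1 * iota (f (h2 \ox l2)) * sw (d * d') (fun a b => gamma a * u b)).
  rewrite sw_mul; last by lin.
  rewrite (sw_comp HH (g := fun z : E => u l1 * u h1 * iota (f (h2 \ox l2)) * z)); last by lin.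
  apply: sw_eq => x y; rewrite (sw_comp HH (g := fun z : E => u l1 * u h1 * iota (f (h2 \ox l2)) * z)); last by lin.
  by apply: sw_eq => x' y'; rewrite !mulrA.
by rewrite cp_inv_right counitM -scalerAr mulr1 scalerA mulrC.
Qed.
End HopfInverse.

(** * The H-module M (x)_A N *)

Section Restriction.
Variables (k : fieldType) (H : algType k) (HH : hopf H) (A : algType k).
Variable C : crossed_product HH A.
Local Notation E := (cp_alg C : algType k).
Local Notation iota := (@cp_of_alg k H HH A C).

(* The right action, with its scalar typed in R so that products are taken in R and not in R^c. *)
Definition ract (R : algType k) (M : rmodule R) (x : R) (m : M) : M := act M x m.

Lemma ract_mul (R : algType k) (M : rmodule R) (x y : R) m : ract (x * y) m = ract y (ract x m) :> M.
Proof. by rewrite /ract; refine (@actM k R^c M y x m). Qed.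
Lemma ract1 (R : algType k) (M : rmodule R) m : ract 1 m = m :> M.
Proof. by rewrite /ract; refine (@act1 k R^c M m). Qed.
Lemma ractZ (R : algType k) (M : rmodule R) c (x : R) m : ract (c *: x) m = c *: ract x m :> M.
Proof. by rewrite /ract; refine (@actZ k R^c M c x m). Qed.

Lemma linear_ract (R : algType k) (M : rmodule R) (U : lmodType k) (g : U -> R) (m : M) :
  linear g -> linear (fun x => ract (g x) m).
Proof. by rewrite /ract; refine (@linear_actl k R^c M U g m). Qed.
Lemma linear_ractr (R : algType k) (M : rmodule R) (U : lmodType k) (g : U -> M) (x : R) :
  linear g -> linear (fun m => ract x (g m)).
Proof. by rewrite /ract; refine (@linear_actr k R^c M U g x). Qed.

Lemma resl_is_module (N : module E) : is_module (fun (a : A) n => act N (iota a) n).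
Proof.
split=> [|n|a b n]; last by rewrite iotaM actM.
  by lin.
exact: act1.
Qed.
Definition resl (N : module E) : module A := Module (resl_is_module N).

Lemma resr_is_module (M : rmodule E) : is_module (R := A^c) (fun (a : A^c) (m : M) => ract (iota a) m).
Proof.
split.
- split=> [m|a].
    refine (@linear_ract E M A iota m (@iota_linear _ _ _ _ C)).
  refine (@linear_ractr E M M id (iota a) (@linear_id _ M)).
- move=> m; refine (@ract1 E M m).
move=> a b m; refine (etrans _ (@ract_mul E M (iota b) (iota a) m)).
congr (ract _ m); refine (@iotaM _ _ _ _ C b a).
Qed.
Definition resr (M : rmodule E) : rmodule A := Module (resr_is_module M).

Lemma resl_hom (N N' : module E) (g : N -> N') : module_hom g -> module_hom (M := resl N) (N := resl N') g.
Proof. by move=> [lg hg]; split=> // a n; rewrite /= hg. Qed.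
End Restriction.

Ltac lin_over ::= lazymatch goal with
  | |- GRing.linear_for _ (fun x => tens_over _ _) => first [apply: linear_tens_overl | apply: linear_tens_overr]
  | |- GRing.linear_for _ (fun x => ract _ _) => first [apply: linear_ract | apply: linear_ractr]
  end.

Section HopfActionOnTensor.
Variables (k : fieldType) (H : algType k) (HH : hopf H) (A : algType k).
Variable C : crossed_product HH A.
Variable finv : {linear tensor H H -> A}.
Hypothesis hfinv : convolution_inverse HH (cocycle C) finv.
Local Notation E := (cp_alg C : algType k).
Local Notation sw := (sw (comul HH)).
Local Notation eps := (counit HH).
Local Notation f := (cocycle C).
Local Notation "a ^^ h" := (wact (cp_act C) h a) (at level 30).
Local Notation iota := (@cp_of_alg k H HH A C).
Local Notation gamma := (@cp_of_hopf k H HH A C).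
Local Notation u := (@cp_of_hopf_inv k H HH A C finv).
Variable M : rmodule E.

Section OneModule.
Variable N : module E.
Local Notation Y := (tensor_over (resr M) (resl N)).
Local Notation "m \oA n" := (@tens_over k A (resr M) (resl N) m n) (at level 40).

Lemma oA_bilin : bilin (fun (m : M) (n : N) => m \oA n).
Proof. exact: (@tens_over_bilin k A (resr M) (resl N)). Qed.

Lemma oA_balanced a (m : M) (n : N) : ract (iota a) m \oA n = m \oA act N (iota a) n.
Proof. exact: (@tens_over_balanced k A (resr M) (resl N)). Qed.

Lemma linear_oAl (U : lmodType k) (g : U -> M) (n : N) : linear g -> linear (fun x => g x \oA n).
Proof. exact: linear_bilinl oA_bilin. Qed.
Lemma linear_oAr (U : lmodType k) (g : U -> N) (m : M) : linear g -> linear (fun x => m \oA g x).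
Proof. exact: linear_bilinr oA_bilin. Qed.

Lemma oA_ext (W : lmodType k) (F G : Y -> W) : linear F -> linear G ->
  (forall (m : M) (n : N), F (m \oA n) = G (m \oA n)) -> forall y, F y = G y.
Proof. exact: (@tens_over_ext k A (resr M) (resl N)). Qed.

(** [lin] with rules for the tensor product over [A] tried first; these rules take maps into [M] and
    [N], which are the carriers of the restricted modules. *)
Ltac loc_step := first
  [ lazymatch goal with
    | |- GRing.linear_for _ (fun x => @tens_over _ _ (resr M) (resl N) _ _) => first [apply: linear_oAl | apply: linear_oAr]
    end
  | lin_step ].
Ltac loc := repeat (cbv beta; first [ lin_hyp | loc_step | lin_eta; loc_step ]).

Definition hopf_act_fun (h : H) (m : M) (n : N) : Y :=
  sw h (fun a b => ract (u a) m \oA act N (gamma b) n).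

Definition hopf_act (h : H) : Y -> Y := otlift (M := resr M) (N := resl N) (hopf_act_fun h).

Lemma hopf_act_fun_bilin h : bilin (hopf_act_fun h).
Proof. by rewrite /hopf_act_fun; loc. Qed.

(** Moving [a] past [u] on one side and past [gamma] on the other yields the same middle term
    [a ^^ h2], which crosses the tensor sign. *)
Lemma hopf_act_fun_balanced h a (m : M) (n : N) :
  hopf_act_fun h (ract (iota a) m) n = hopf_act_fun h m (act N (iota a) n).
Proof.
transitivity (sw h (fun h1 c => sw c (fun h2 h3 =>
    ract (u h1) m \oA act N (iota (a ^^ h2)) (act N (gamma h3) n)))).
  rewrite -(sw_assoc HH (phi := fun h1 h2 h3 =>
    ract (u h1) m \oA act N (iota (a ^^ h2)) (act N (gamma h3) n))); try by loc.
  apply: sw_eq => c h3; rewrite -ract_mul iota_cp_inv //.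
  rewrite (sw_comp HH (g := fun x : E => ract x m \oA act N (gamma h3) n)); last by loc.
  by apply: sw_eq => h1 h2; rewrite ract_mul oA_balanced.
apply: sw_eq => h1 c; rewrite -actM gamma_iota.
rewrite (sw_comp HH (g := fun x : E => ract (u h1) m \oA act N x n)); last by loc.
by apply: sw_eq => h2 h3; rewrite actM.
Qed.

Lemma hopf_act_linear h : linear (hopf_act h).
Proof.
refine (@otlift_linear k A (resr M) (resl N) Y (hopf_act_fun h) (hopf_act_fun_bilin h) (hopf_act_fun_balanced h)).
Qed.

Lemma hopf_actE h (m : M) (n : N) : hopf_act h (m \oA n) = sw h (fun a b => ract (u a) m \oA act N (gamma b) n).
Proof.
refine (@otliftE k A (resr M) (resl N) Y (hopf_act_fun h) (hopf_act_fun_bilin h) (hopf_act_fun_balanced h) m n).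
Qed.

Lemma hopf_act_linearl y : linear (fun h => hopf_act h y).
Proof.
move=> c h l; move: y; apply: oA_ext => [||m n]; first exact: hopf_act_linear.
  by apply: linear_add; [apply: linear_scale|]; apply: hopf_act_linear.
have ll : linear (fun h => sw h (fun a b => ract (u a) m \oA act N (gamma b) n)) by loc.
by rewrite !hopf_actE ll.
Qed.

(** Neither [u] nor [gamma] is multiplicative, but the defects match: the cocycle value that
    [cp_invM] leaves at [m] and the one that [gamma_gamma] leaves at [n] are exchanged across
    [\oA]. *)
Lemma hopf_act_is_module : is_module hopf_act.
Proof.
split=> [|y|h l y].
- by apply: bilin_intro; [apply: hopf_act_linearl | apply: hopf_act_linear].
- move: y; apply: oA_ext => // [|m n]; first exact: hopf_act_linear.
  rewrite hopf_actE sw_unit; last by loc.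
  by rewrite cp_inv1 // gamma1 ract1 act1.
move: y; apply: oA_ext => [||m n]; first exact: hopf_act_linear.
  exact: linear_comp (hopf_act_linear h) (hopf_act_linear l).
rewrite !hopf_actE (sw_comp _ _ _ (hopf_act_linear h)).
transitivity (sw h (fun h1 c => sw l (fun l1 c' => sw c (fun h2 h3 => sw c' (fun l2 l3 =>
    ract (u l1 * u h1 * iota (f (h2 \ox l2))) m \oA act N (gamma (h3 * l3)) n))))); last first.
  transitivity (sw l (fun c' d' => sw h (fun c d => ract (u c) (ract (u c') m) \oA act N (gamma d * gamma d') n))); last first.
    by apply: sw_eq => c' d'; rewrite hopf_actE; apply: sw_eq => c d; rewrite actM.
  rewrite [RHS]sw_swap; apply: sw_eq => h1 c; apply: sw_eq => l1 c'.
  rewrite gamma_gamma -ract_mul.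
  rewrite (sw_comp HH (g := fun x : E => ract (u l1 * u h1) m \oA act N x n)); last by loc.
  apply: sw_eq => h2 h3.
  rewrite (sw_comp HH (g := fun x : E => ract (u l1 * u h1) m \oA act N x n)); last by loc.
  by apply: sw_eq => l2 l3; rewrite ract_mul oA_balanced actM.
transitivity (sw h (fun s h3 => sw l (fun t l3 => ract (u (s * t)) m \oA act N (gamma (h3 * l3)) n))).
  by rewrite sw_mul //; loc.
transitivity (sw h (fun s h3 => sw s (fun h1 h2 => sw l (fun t l3 => sw t (fun l1 l2 =>
  ract (u l1 * u h1 * iota (f (h2 \ox l2))) m \oA act N (gamma (h3 * l3)) n))))).
  apply: sw_eq => s h3; rewrite sw_swap; apply: sw_eq => t l3.
  rewrite (cp_invM hfinv) (sw_comp HH (g := fun x : E => ract x m \oA act N (gamma (h3 * l3)) n)); last by loc.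
  by apply: sw_eq => h1 h2; rewrite (sw_comp HH (g := fun x : E => ract x m \oA act N (gamma (h3 * l3)) n)) //; loc.
rewrite (sw_assoc HH (phi := fun h1 h2 h3 => sw l (fun t l3 => sw t (fun l1 l2 =>
  ract (u l1 * u h1 * iota (f (h2 \ox l2))) m \oA act N (gamma (h3 * l3)) n)))); try by loc.
apply: sw_eq => h1 c; rewrite [RHS]sw_swap; apply: sw_eq => h2 h3.
by rewrite (sw_assoc HH (phi := fun l1 l2 l3 =>
  ract (u l1 * u h1 * iota (f (h2 \ox l2))) m \oA act N (gamma (h3 * l3)) n)); try by loc.
Qed.

Definition hopf_tensor : module H := Module hopf_act_is_module.

(** The factor [gamma l1] contracts with the [u] inside the action. This trades the passage of
    [gamma l] across [\oA] for an action of [H]; both the section [theta] and the computation of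
    coinvariants depend on it. *)
Lemma hopf_act_gamma l (m : M) (n : N) :
  sw l (fun l1 l2 => hopf_act l2 (ract (gamma l1) m \oA n)) = m \oA act N (gamma l) n.
Proof.
transitivity (sw l (fun l1 c => sw c (fun p q => ract (gamma l1 * u p) m \oA act N (gamma q) n))).
  by apply: sw_eq => l1 c; rewrite hopf_actE; apply: sw_eq => p q; rewrite ract_mul.
rewrite -(sw_assoc HH (phi := fun l1 p q => ract (gamma l1 * u p) m \oA act N (gamma q) n)); try by loc.
transitivity (sw l (fun t q => eps t *: (m \oA act N (gamma q) n))); last by rewrite sw_counitl //; loc.
apply: sw_eq => t q.
rewrite -(sw_comp HH (g := fun x : E => ract x m \oA act N (gamma q) n)); last by loc.
rewrite (cp_inv_right hfinv) ractZ ract1.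
by rewrite (linZ (linear_oAl _ (@linear_id k M))).
Qed.
End OneModule.
End HopfActionOnTensor.

(** * The coaction on E, and the H-linear section on M (x)_A N *)

Section ComoduleAlgebra.
Variables (k : fieldType) (H : algType k) (HH : hopf H) (A : algType k).
Variable C : crossed_product HH A.
Local Notation E := (cp_alg C : algType k).
Local Notation sw := (sw (comul HH)).
Local Notation f := (cocycle C).
Local Notation "a ^^ h" := (wact (cp_act C) h a) (at level 30).
Local Notation iota := (@cp_of_alg k H HH A C).
Local Notation gamma := (@cp_of_hopf k H HH A C).

(* The right coaction E -> E (x) H, a # h |-> (a # h(1)) (x) h(2). *)
Definition coact : E -> tensor E H :=
  tlift (fun a h => sw h (fun h1 h2 => ((a \ox h1) : E) \ox h2)).

Lemma coact_bilin : bilin (fun (a : A) h => sw h (fun h1 h2 => ((a \ox h1) : E) \ox h2)).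
Proof. by lin. Qed.
Lemma coact_linear : linear coact.
Proof. exact: tlift_linear coact_bilin. Qed.
Lemma coactE a h : coact (a \ox h) = sw h (fun h1 h2 => ((a \ox h1) : E) \ox h2).
Proof. exact: (tliftE coact_bilin). Qed.

Lemma coact_tlift (Z : lmodType k) (phi : E -> H -> Z) a h : bilin phi ->
  tlift phi (coact (a \ox h)) = sw h (fun h1 h2 => phi (a \ox h1) h2).
Proof.
move=> b; rewrite coactE (sw_comp _ _ _ (tlift_linear b)).
by apply: sw_eq => h1 h2; rewrite tliftE.
Qed.

Lemma linear_coact (U : lmodType k) (g : U -> E) : linear g -> linear (fun x => coact (g x)).
Proof. exact: linear_comp coact_linear. Qed.

Lemma cp_ext (Z : lmodType k) (F G : E -> Z) : linear F -> linear G ->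
  (forall a h, F (a \ox h) = G (a \ox h)) -> forall e, F e = G e.
Proof. exact: tens_ext. Qed.

Lemma coact_iota (Z : lmodType k) (phi : E -> H -> Z) a e : bilin phi ->
  tlift phi (coact (iota a * e)) = tlift (fun x h => phi (iota a * x) h) (coact e).
Proof.
move=> b; have b' : bilin (fun x h => phi (iota a * x) h) by lin.
move: e; apply: cp_ext => [||b0 l].
- by apply: linear_tlift => //; apply: linear_coact; lin.
- by apply: linear_tlift => //; apply: coact_linear.
rewrite iota_mul_tens !coact_tlift //.
by apply: sw_eq => h1 h2; rewrite iota_mul_tens.
Qed.

(** Multiplicativity of the coaction, evaluated against a bilinear [phi] in place of a product on
    [E (x) H]. Both sides are sums of the same terms [X], regrouped by coassociativity. *)
Lemma coact_gamma (Z : lmodType k) (phi : E -> H -> Z) g e : bilin phi ->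
  tlift phi (coact (gamma g * e)) =
  sw g (fun g1 g2 => tlift (fun x h => phi (gamma g1 * x) (g2 * h)) (coact e)).
Proof.
move=> b; have b' g1 g2 : bilin (fun x h => phi (gamma g1 * x) (g2 * h)) by lin.
move: e; apply: cp_ext => [||b0 l].
- by apply: linear_tlift => //; apply: linear_coact; lin.
- by apply: linear_sw_fun => g1 g2; apply: linear_tlift => //; apply: coact_linear.
pose X h1 h2 l1 x y : Z := phi ((b0 ^^ h1 * f (h2 \ox l1)) \ox x) y.
have lt : linear (fun e => tlift phi (coact e)) by apply: linear_tlift => //; apply: coact_linear.
transitivity (sw g (fun h1 c => sw c (fun h2 d => sw d (fun p q => sw l (fun l1 c' => sw c' (fun r s =>
    X h1 h2 l1 (p * r) (q * s))))))).
  rewrite /cp_of_hopf cp_mulE (sw_comp _ _ _ lt); apply: sw_eq => h1 c.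
  rewrite (sw_comp _ _ _ lt); apply: sw_eq => h2 d.
  rewrite (sw_comp _ _ _ lt) [RHS]sw_swap; apply: sw_eq => l1 c'.
  rewrite coact_tlift // sw_mul; last by lin.
  by apply: sw_eq => p q; apply: sw_eq => r s; rewrite mul1r.
transitivity (sw g (fun c q => sw c (fun h1 h' => sw h' (fun h2 p => sw l (fun d s => sw d (fun l1 r =>
    X h1 h2 l1 (p * r) (q * s))))))).
  rewrite (sw_assoc HH (phi := fun h1 h' q => sw h' (fun h2 p => sw l (fun d s => sw d (fun l1 r =>
    X h1 h2 l1 (p * r) (q * s)))))); try by rewrite /X; lin.
  apply: sw_eq => h1 c.
  rewrite (sw_assoc HH (phi := fun h2 p q => sw l (fun d s => sw d (fun l1 r =>
    X h1 h2 l1 (p * r) (q * s))))); try by rewrite /X; lin.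
  apply: sw_eq => h2 d; apply: sw_eq => p q.
  by rewrite (sw_assoc HH (phi := fun l1 r s => X h1 h2 l1 (p * r) (q * s))) //; rewrite /X; lin.
apply: sw_eq => c q; rewrite coact_tlift //.
transitivity (sw l (fun d s => sw c (fun h1 h' => sw h' (fun h2 p => sw d (fun l1 r =>
    X h1 h2 l1 (p * r) (q * s)))))).
  by rewrite sw_swap; apply: sw_eq => h1 h'; rewrite sw_swap.
have lp s : linear (fun e : E => phi e (q * s)) by lin.
apply: sw_eq => d s; rewrite /cp_of_hopf cp_mulE (sw_comp _ _ _ (lp s)); apply: sw_eq => h1 h'.
rewrite (sw_comp _ _ _ (lp s)); apply: sw_eq => h2 p; rewrite (sw_comp _ _ _ (lp s)).
by apply: sw_eq => l1 r; rewrite mul1r.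
Qed.
End ComoduleAlgebra.

Ltac lin_over ::= lazymatch goal with
  | |- GRing.linear_for _ (fun x => tens_over _ _) => first [apply: linear_tens_overl | apply: linear_tens_overr]
  | |- GRing.linear_for _ (fun x => coact _) => apply: linear_coact
  | |- GRing.linear_for _ (fun x => ract _ _) => first [apply: linear_ract | apply: linear_ractr]
  end.

Section HopfProjectivity.
Variables (k : fieldType) (H : algType k) (HH : hopf H) (A : algType k).
Variable C : crossed_product HH A.
Variable finv : {linear tensor H H -> A}.
Hypothesis hfinv : convolution_inverse HH (cocycle C) finv.
Local Notation E := (cp_alg C : algType k).
Local Notation sw := (sw (comul HH)).
Local Notation eps := (counit HH).
Local Notation iota := (@cp_of_alg k H HH A C).
Local Notation gamma := (@cp_of_hopf k H HH A C).
Local Notation u := (@cp_of_hopf_inv k H HH A C finv).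
Variables (M : rmodule E) (N : module E).
Local Notation Y := (hopf_tensor hfinv M N).
Local Notation "m \oA n" := (@tens_over k A (resr M) (resl N) m n) (at level 40).
Local Notation hact := (hopf_act finv (M := M) (N := N)).
Variable sigma : N -> tensor E N.
Hypothesis hs : action_section sigma.

Ltac loc_step := first
  [ lazymatch goal with
    | |- GRing.linear_for _ (fun x => @tens_over _ _ (resr M) (resl N) _ _) => first [apply: linear_oAl | apply: linear_oAr]
    end
  | lin_step ].
Ltac loc := repeat (cbv beta; first [ lin_hyp | loc_step | lin_eta; loc_step ]).

(** If [n] is the sum of [e n'] and the coaction sends [e] to [e(0) (x) e(1)], then [hopf_act_gamma]
    writes [m (x) n] as the sum of [e(1)] acting on [m e(0) (x) n']. The section keeps [e(1)] apart
    instead of letting it act. *)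
Definition theta_pure (m : M) (n : N) : tensor H Y :=
  tlift (fun (e : E) (n' : N) => tlift (fun x h => h \ox (ract x m \oA n' : Y)) (coact e)) (sigma n).

Lemma theta_bi1 (m : M) (n' : N) : bilin (fun (x : E) (h : H) => h \ox (ract x m \oA n' : Y)).
Proof. by loc. Qed.

Lemma theta_bi2 (m : M) : bilin (fun (e : E) (n' : N) => tlift (fun x h => h \ox (ract x m \oA n' : Y)) (coact e)).
Proof.
apply: bilin_intro => [n'|e]; last by loc.
by apply: linear_tlift; [apply: theta_bi1 | apply: coact_linear].
Qed.

Lemma theta_pure_bilin : bilin theta_pure.
Proof.
have ls := section_linear hs.
apply: bilin_intro => [n|m]; first by rewrite /theta_pure; loc.
exact: linear_tlift (theta_bi2 m) ls.
Qed.

Lemma theta_pure_balanced a (m : M) (n : N) : theta_pure (ract (iota a) m) n = theta_pure m (act N (iota a) n).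
Proof.
rewrite /theta_pure (section_act hs); move: (sigma n); apply: tens_ext => [||e n'].
- exact: tlift_linear (theta_bi2 _).
- exact: linear_comp (tlift_linear (theta_bi2 _)) (free_act_linear _).
rewrite free_actE !tliftE; try exact: theta_bi2.
rewrite coact_iota; last exact: theta_bi1.
by apply: tlift_eq => x h; rewrite ract_mul.
Qed.

Definition theta : Y -> tensor H Y := otlift (M := resr M) (N := resl N) theta_pure.

Lemma theta_linear : linear theta.
Proof. refine (@otlift_linear k A (resr M) (resl N) _ theta_pure theta_pure_bilin theta_pure_balanced). Qed.
Lemma thetaE (m : M) (n : N) : theta (m \oA n) = theta_pure m n.
Proof. refine (@otliftE k A (resr M) (resl N) _ theta_pure theta_pure_bilin theta_pure_balanced m n). Qed.

(** For linearity, an element [g] puts [u(g1)] and then [gamma(g2)] between [m] and [e(0)]; these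
    contract and leave [g] multiplying the factor [H]. That the action undoes [theta] is
    [hopf_act_gamma]. *)
Lemma theta_section : action_section theta.
Proof.
split; first exact: theta_linear.
  move=> g; apply: oA_ext => [||m n].
  - exact: linear_comp theta_linear (hopf_act_linear hfinv g).
  - exact: linear_comp (free_act_linear _) theta_linear.
  rewrite [act Y g _]hopf_actE // (sw_comp _ _ _ theta_linear).
  transitivity (tlift (fun (e : E) (n' : N) => sw g (fun a b =>
      tlift (fun x h => h \ox (ract x (ract (u a) m) \oA n' : Y)) (coact (gamma b * e)))) (sigma n)).
    rewrite -sw_tlift_swap; apply: sw_eq => a b; rewrite thetaE /theta_pure (section_act hs).
    move: (sigma n); apply: tens_ext => [||e n'].
    - exact: linear_comp (tlift_linear (theta_bi2 _)) (free_act_linear _).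
    - apply: tlift_linear; apply: bilin_intro => [n'|e]; last by loc.
      by apply: linear_tlift; [apply: theta_bi1|loc].
    rewrite free_actE !tliftE //; try exact: theta_bi2.
    apply: bilin_intro => [n''|e']; last by loc.
    by apply: linear_tlift; [apply: theta_bi1|loc].
  rewrite thetaE /theta_pure (tlift_comp _ _ (free_act_linear g)).
  apply: tlift_eq => e n'; rewrite (tlift_comp _ _ (free_act_linear g)).
  transitivity (tlift (fun x h => sw g (fun a b => sw b (fun b1 b2 =>
     (b2 * h) \ox (ract (gamma b1 * x) (ract (u a) m) \oA n' : Y)))) (coact e)).
    transitivity (sw g (fun a b => sw b (fun b1 b2 => tlift (fun x h =>
        (b2 * h) \ox (ract (gamma b1 * x) (ract (u a) m) \oA n' : Y)) (coact e)))).
      by apply: sw_eq => a b; rewrite coact_gamma //; apply: theta_bi1.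
    rewrite -sw_tlift_swap; apply: sw_eq => a b; exact: sw_tlift_swap.
  apply: tlift_eq => x h; rewrite free_actE.
  rewrite -(sw_assoc HH (phi := fun a b1 b2 =>
     (b2 * h) \ox (ract (gamma b1 * x) (ract (u a) m) \oA n' : Y))); try by loc.
  transitivity (sw g (fun t b2 => eps t *: ((b2 * h) \ox (ract x m \oA n' : Y)))); last first.
    by rewrite sw_counitl //; loc.
  apply: sw_eq => t b2.
  have lg : linear (fun z : E => (b2 * h) \ox (ract (z * x) m \oA n' : Y)) by loc.
  transitivity (sw t (fun a b1 => (b2 * h) \ox (ract (u a * gamma b1 * x) m \oA n' : Y))).
    by apply: sw_eq => a b1; rewrite -ract_mul mulrA.
  by rewrite -(sw_comp _ _ _ lg) (cp_inv_left hfinv) (linZ lg) mul1r.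
apply: oA_ext => [||m n] //; first exact: linear_comp (tlift_linear (act_bilin _)) theta_linear.
rewrite thetaE /theta_pure -{2}(section_mult hs n) (tlift_comp _ _ (tlift_linear (act_bilin _))).
rewrite (tlift_comp (g := fun n' => m \oA n')); last exact: linear_oAr.
apply: tlift_eq => e n'; rewrite (tlift_comp _ _ (tlift_linear (act_bilin _))).
transitivity (tlift (fun x h => hact h (ract x m \oA n')) (coact e)).
  by apply: tlift_eq => x h; rewrite tliftE //; apply: act_bilin.
have b : bilin (fun (x : E) h => hact h (ract x m \oA n')).
  apply: bilin_intro => [h|x]; last exact: hopf_act_linearl.
  by apply: (linear_comp (hopf_act_linear hfinv h)); loc.
move: e; apply: cp_ext => [||a h].
- by apply: linear_tlift => //; apply: coact_linear.
- by loc.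
rewrite coact_tlift // -iota_gamma actM -oA_balanced -(hopf_act_gamma hfinv).
by apply: sw_eq => h1 h2; rewrite -iota_gamma ract_mul.
Qed.
End HopfProjectivity.

(** * Functoriality of the H-module M (x)_A N and its coinvariants *)

Section HopfTensorMaps.
Variables (k : fieldType) (H : algType k) (HH : hopf H) (A : algType k).
Variable C : crossed_product HH A.
Variable finv : {linear tensor H H -> A}.
Hypothesis hfinv : convolution_inverse HH (cocycle C) finv.
Local Notation E := (cp_alg C : algType k).
Local Notation sw := (sw (comul HH)).
Local Notation eps := (counit HH).
Local Notation iota := (@cp_of_alg k H HH A C).
Local Notation gamma := (@cp_of_hopf k H HH A C).
Local Notation u := (@cp_of_hopf_inv k H HH A C finv).
Variable M : rmodule E.
Local Notation Y := (hopf_tensor hfinv M).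

Lemma hopf_tensor_map_hom (N N' : module E) (g : N -> N') : module_hom g ->
  module_hom (M := Y N) (N := Y N') (over_mapr (P := resr M) (N := resl N) (N' := resl N') g).
Proof.
move=> hg; have [lg eg] := over_maprP (resr M) (resl_hom hg).
split=> // h; apply: oA_ext => [||m n].
- exact: linear_comp lg (hopf_act_linear hfinv h).
- exact: linear_comp (hopf_act_linear hfinv h) lg.
rewrite eg /= !hopf_actE // (sw_comp _ _ _ lg); apply: sw_eq => a b.
by rewrite eg hg.2.
Qed.

Section Coinvariants.
Variable N : module E.
Local Notation "m \oA n" := (@tens_over k A (resr M) (resl N) m n) (at level 40).
Local Notation "m \oE n" := (@tens_over k E M N m n) (at level 40).
Ltac loc_step := first
  [ lazymatch goal with
    | |- GRing.linear_for _ (fun x => @tens_over _ _ (resr M) (resl N) _ _) => first [apply: linear_oAl | apply: linear_oAr]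
    end
  | lin_step ].
Ltac loc := repeat (cbv beta; first [ lin_hyp | loc_step | lin_eta; loc_step ]).

Lemma oE_balanced (x : E) (m : M) (n : N) : ract x m \oE n = m \oE act N x n.
Proof. exact: tens_over_balanced. Qed.

Definition over_project : Y N -> tensor_over M N :=
  otlift (M := resr M) (N := resl N) (fun m n => m \oE n).

Lemma over_project_bilin : bilin (fun (m : resr M) (n : resl N) => (m : M) \oE (n : N)).
Proof. exact: (@tens_over_bilin k E M N). Qed.
Lemma over_project_balanced (a : A^c) (m : resr M) (n : resl N) :
  (act (resr M) a m : M) \oE (n : N) = (m : M) \oE (act (resl N) a n : N).
Proof. exact: oE_balanced. Qed.

Lemma over_project_linear : linear over_project.
Proof. refine (@otlift_linear k A (resr M) (resl N) _ _ over_project_bilin over_project_balanced). Qed.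
Lemma over_projectE (m : M) (n : N) : over_project (m \oA n) = m \oE n.
Proof. refine (@otliftE k A (resr M) (resl N) _ _ over_project_bilin over_project_balanced m n). Qed.

(** Over [E] the factor [gamma(h2)] crosses the tensor sign and meets [u(h1)]. *)
Lemma over_project_act h y : over_project (act (Y N) h y) = eps h *: over_project y.
Proof.
move: y; apply: oA_ext => [||m n].
- exact: linear_comp over_project_linear (hopf_act_linear hfinv h).
- by apply: linear_scale; apply: over_project_linear.
rewrite /= hopf_actE // (sw_comp _ _ _ over_project_linear) over_projectE.
have lg : linear (fun x : E => ract x m \oE n) by lin.
transitivity (sw h (fun a b => ract (u a * gamma b) m \oE n)).
  by apply: sw_eq => a b; rewrite over_projectE -oE_balanced ract_mul.
by rewrite -(sw_comp _ _ _ lg) (cp_inv_left hfinv) (linZ lg) ract1.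
Qed.

Variables (K : rmodule H) (aug : K -> trivial HH).
Hypothesis haug : module_hom aug.

Definition augment_pure (p : K) (y : Y N) : tensor_over M N := (aug p : k) *: over_project y.

Lemma augment_bilin : bilin augment_pure.
Proof.
split=> [y c p p'|p c y y']; rewrite /augment_pure.
  by rewrite haug.1 scalerDl -scalerA.
rewrite over_project_linear scalerDr /=; congr (_ + _); rewrite !scalerA; congr (_ *: _).
exact: mulrC.
Qed.

Lemma augment_balanced (h : H^c) (p : K) (y : Y N) : augment_pure (act K h p) y = augment_pure p (act (Y N) h y).
Proof. by rewrite /augment_pure haug.2 over_project_act scalerA; congr (_ *: _); exact: mulrC. Qed.

Definition hopf_augment : tensor_over K (Y N) -> tensor_over M N := otlift augment_pure.
Lemma augment_linear : linear hopf_augment.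
Proof. exact: otlift_linear augment_bilin augment_balanced. Qed.
Lemma augmentE p y : hopf_augment (tens_over p y) = (aug p : k) *: over_project y.
Proof. exact: otliftE augment_bilin augment_balanced p y. Qed.

Local Notation "c \oH y" := (@tens_over k H (trivial HH) (Y N) (c : k^o) y) (at level 40).

Definition unaugment_pure (m : M) (n : N) : tensor_over (trivial HH) (Y N) :=
  1 \oH (m \oA n).

Lemma unaugment_bilin : bilin unaugment_pure.
Proof. by rewrite /unaugment_pure; loc. Qed.

(** Elements of [A] cross already over [A]; for [gamma h] the price, by [hopf_act_gamma], is an
    action of [H], which the trivial module turns into a counit. *)
Lemma unaugment_balanced (x : E^c) (m : M) (n : N) : unaugment_pure (act M x m) n = unaugment_pure m (act N x n).
Proof.
rewrite -/(ract (x : E) m) /unaugment_pure; move: x.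
refine (@cp_ext _ _ _ _ C _ (fun x : E => _) (fun x : E => _) _ _ _).
- by loc.
- by loc.
move=> a h; rewrite -iota_gamma actM -oA_balanced -(hopf_act_gamma hfinv) ract_mul.
set m' := ract (iota a) m.
have lt : linear (fun y : Y N => 1 \oH y) by lin.
rewrite [RHS](sw_comp _ _ _ lt).
transitivity (sw h (fun h1 h2 => eps h2 *: (1 \oH (ract (gamma h1) m' \oA n)))).
  by rewrite sw_counitr //; loc.
apply: sw_eq => h1 h2.
rewrite -[hopf_act _ _ _]/(act (Y N) h2 _).
have eb : act (trivial HH) h2 1 \oH (ract (gamma h1) m' \oA n) = 1 \oH act (Y N) h2 (ract (gamma h1) m' \oA n).
  exact: (@tens_over_balanced k H (trivial HH) (Y N)).
have lt' : linear (fun c : k^o => c \oH (ract (gamma h1) m' \oA n)) by lin.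
by rewrite -eb -(linZ lt').
Qed.

Definition hopf_unaugment : tensor_over M N -> tensor_over (trivial HH) (Y N) := otlift unaugment_pure.
Lemma unaugment_linear : linear hopf_unaugment.
Proof. exact: otlift_linear unaugment_bilin unaugment_balanced. Qed.
Lemma unaugmentE m n : hopf_unaugment (tens_over m n) = 1 \oH (m \oA n).
Proof. exact: otliftE unaugment_bilin unaugment_balanced m n. Qed.

(** It places the kernel of [hopf_augment] inside that of [aug (x) id], so exactness of the
    augmented row reduces to flatness over [H]. *)
Lemma unaugmentK x : hopf_unaugment (hopf_augment x) = over_mapl aug x.
Proof.
have [lm em] := over_maplP (Y N) haug.
move: x; apply: tens_over_ext => // [|p y]; first exact: linear_comp unaugment_linear augment_linear.
rewrite augmentE em (linZ unaugment_linear); move: y; apply: oA_ext => [||m n].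
- by apply: linear_scale; apply: linear_comp unaugment_linear over_project_linear.
- by lin.
rewrite over_projectE unaugmentE.
have lt : linear (fun c : k^o => c \oH (m \oA n)) by lin.
by rewrite -(linZ lt) /GRing.scale /= mulr1.
Qed.

Lemma augment_surj : (forall c, exists p, aug p = c) -> forall z, exists x, hopf_augment x = z.
Proof.
move=> sa z; have [p hp] := sa (1 : k^o).
move: z; apply: tens_over_ind; first exact: submodule_im augment_linear.
by move=> m n; exists (@tens_over k H K (Y N) p (m \oA n)); rewrite augmentE over_projectE hp scale1r.
Qed.

Lemma augment_comp (K' : rmodule H) (d : K' -> K) : module_hom d -> (forall x, aug (d x) = 0) ->
  forall x, hopf_augment (over_mapl d x) = 0.
Proof.
move=> hd h0; have [ld ed] := over_maplP (Y N) hd.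
apply: tens_over_ext => [||p y]; [exact: linear_comp augment_linear ld|exact: linear_zero|].
by rewrite ed augmentE h0 scale0r.
Qed.
End Coinvariants.

Lemma augment_natural (N N' : module E) (g : N -> N') (K : rmodule H) (aug : K -> trivial HH) :
  module_hom g -> module_hom aug -> forall x : tensor_over K (Y N),
  hopf_augment aug (over_mapr (N := Y N) (N' := Y N') (over_mapr (P := resr M) (N := resl N) (N' := resl N') g) x) =
  over_mapr g (hopf_augment aug x).
Proof.
move=> hg ha; have [lg eg] := over_maprP M hg.
have [lh eh] := over_maprP (resr M) (resl_hom hg).
have [lk ek] := over_maprP K (hopf_tensor_map_hom hg).
apply: tens_over_ext => [||p y].
- exact: linear_comp (augment_linear ha) lk.
- exact: linear_comp lg (augment_linear ha).
rewrite ek !augmentE // (linZ lg); congr (_ *: _); move: y; apply: oA_ext => [||m n].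
- exact: linear_comp (@over_project_linear N') lh.
- exact: linear_comp lg (@over_project_linear N).
by rewrite eh !over_projectE eg.
Qed.
End HopfTensorMaps.

(** * Hochschild chains *)

Section HochschildGenerators.
Variables (k : fieldType) (A : algType k) (P : lmodType k).

(* Tensors p (x) g 0 (x) ... (x) g (s - 1), for a sequence g : nat -> A whose other values are irrelevant. *)
Definition hgen s (p : P) (g : nat -> A) : hoch_chain A P s := hoch_tens p [tuple g j | j < s].

Lemma hgen_tuple s p (t : s.-tuple A) : hoch_tens p t = hgen s p (nth 0 t).
Proof. by congr hoch_tens; apply: eq_from_tnth => j; rewrite tnth_mktuple (tnth_nth 0). Qed.

Definition updates (T : Type) (i : nat) (x : T) (g : nat -> T) : nat -> T := fun j => if j == i then x else g j.

(** The conditions under which [phi] factors through normalized chains; [compat_scalar] is the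
    passage from [A] to [A / k]. Entries form a sequence on [nat], so that faces and insertions are
    index arithmetic without casts. *)
Record hoch_compat s (W : lmodType k) (phi : P -> (nat -> A) -> W) : Prop := HochCompat {
  compat_ext : forall p g g', (forall j, (j < s)%N -> g j = g' j) -> phi p g = phi p g';
  compat_linear : forall g, linear (fun p => phi p g);
  compat_multi : forall p g i, (i < s)%N -> linear (fun x => phi p (updates i x g));
  compat_scalar : forall p g i c, (i < s)%N -> g i = c%:A -> phi p g = 0
}.

Definition hoch_lift s (W : lmodType k) (phi : P -> (nat -> A) -> W) : hoch_chain A P s -> W :=
  ext (fun pt : P * s.-tuple A => phi pt.1 (nth 0 pt.2)).

Section Lift.
Variables (s : nat) (W : lmodType k) (phi : P -> (nat -> A) -> W).
Hypothesis hphi : hoch_compat s phi.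

Lemma hoch_lift_kills r : hoch_relations r -> fglift (fun pt : P * s.-tuple A => phi pt.1 (nth 0 pt.2)) r = 0.
Proof.
set F := fglift _; have lF : linear F by apply: fglift_linear.
have FE pt : F << pt >> = phi pt.1 (nth 0 pt.2) by rewrite /F liftU scale1r.
case=> [[c [p [p' [t ->]]]]|[[i [c [p [t [u [v [ht hj ->]]]]]]]|[i [c [p [t [ht ->]]]]]]].
- by rewrite !(linB lF) (linZ lF) !FE /= (compat_linear hphi) -addrA -opprD subrr.
- rewrite !(linB lF) (linZ lF) !FE /=.
  have e (w : s.-tuple A) : (forall j, j != i -> tnth t j = tnth w j) ->
      phi p (nth 0 w) = phi p (updates i (tnth w i) (nth 0 t)).
    move=> h; apply: (compat_ext hphi) => j js; rewrite /updates.
    have [->|nj] := eqVneq j (i : nat); first by rewrite (tnth_nth 0).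
    have := h (Ordinal js); rewrite !(tnth_nth 0) /= => -> //.
  rewrite (e u) => [|j /hj[]//]; rewrite (e v) => [|j /hj[]//]; rewrite (e t) // ht.
  by rewrite (compat_multi hphi) // -addrA -opprD subrr.
by rewrite FE /=; apply: (@compat_scalar _ _ _ hphi p _ i c) => //; rewrite -tnth_nth.
Qed.

Lemma hoch_lift_linear : linear (hoch_lift (s := s) phi).
Proof. by apply: ext_linear; apply: hoch_lift_kills. Qed.

Lemma hoch_liftE p g : hoch_lift phi (hgen s p g) = phi p g.
Proof.
rewrite /hoch_lift /hgen /hoch_tens ext_gen /=; last exact: hoch_lift_kills.
apply: (compat_ext hphi) => j js.
by rewrite -[RHS](tnth_mktuple (fun j : 'I_s => g j) (Ordinal js)) (tnth_nth 0).
Qed.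
End Lift.

Lemma hoch_ind s (S : set (hoch_chain A P s)) : submodule S -> (forall p g, S (hgen s p g)) -> forall x, S x.
Proof.
move=> mS h; apply: gen_ind => // -[p t]; have := h p (nth 0 t).
by rewrite -hgen_tuple.
Qed.

Lemma hoch_ext s (W : lmodType k) (F G : hoch_chain A P s -> W) : linear F -> linear G ->
  (forall p g, F (hgen s p g) = G (hgen s p g)) -> forall x, F x = G x.
Proof.
move=> lF lG h; apply: gen_ext => // -[p t]; have := h p (nth 0 t).
by rewrite -hgen_tuple.
Qed.

Lemma hgen_compat s : hoch_compat s (hgen s).
Proof.
have pil := @pi_linear k _ (@hoch_relations k A P s).
have rel3 c (x y z : {freeg (P * s.-tuple A)%type / k}) : hoch_relations (x - c *: y - z) ->
    \pi_(quot (@hoch_relations k A P s)) x =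
    c *: \pi_(quot (@hoch_relations k A P s)) y + \pi_(quot (@hoch_relations k A P s)) z.
  move=> /gen_rel0; rewrite !(linB pil) (linZ pil) => /eqP; rewrite subr_eq0 subr_eq addrC => /eqP ->.
  by [].
split.
- by move=> p g g' h; congr hoch_tens; apply: eq_from_tnth => j; rewrite !tnth_mktuple h.
- by move=> g c p p'; apply: rel3; left; exists c, p, p', [tuple g j | j < s].
- move=> p g i hi c x y; apply: rel3; right; left; exists (Ordinal hi), c, p.
  exists [tuple updates i (c *: x + y) g j | j < s], [tuple updates i x g j | j < s], [tuple updates i y g j | j < s].
  split=> [|j nj|//]; rewrite !tnth_mktuple /updates ?eqxx //.
  by have /negbTE -> : (j : nat) != i by [].
move=> p g i c hi hc; apply: gen_rel0; right; right.
by exists (Ordinal hi), c, p, [tuple g j | j < s]; rewrite tnth_mktuple.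
Qed.

Lemma linear_hgen s (U : lmodType k) (f : U -> P) g : linear f -> linear (fun x => hgen s (f x) g).
Proof. exact: linear_comp (compat_linear (hgen_compat s) g). Qed.
End HochschildGenerators.

(** * The normalized Hochschild complex and its functoriality *)

Section HochschildDifferential.
Variables (k : fieldType) (A : algType k) (P : lmodType k).
Variables (la : A -> P -> P) (ra : P -> A -> P).

Record bimodule_axioms : Prop := BimoduleAxioms {
  la_bilin : bilin la;
  ra_bilin : bilin ra;
  la_mul : forall a b p, la (a * b) p = la a (la b p);
  ra_mul : forall p a b, ra p (a * b) = ra (ra p a) b;
  la_ra : forall a p b, la a (ra p b) = ra (la a p) b;
  la1 : forall p, la 1 p = p;
  ra1 : forall p, ra p 1 = p
}.
Hypothesis bm : bimodule_axioms.

Definition merge_at (i : nat) (g : nat -> A) : nat -> A :=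
  fun j => if (j < i)%N then g j else if j == i then g j * g j.+1 else g j.+1.

(** The faces of the underlying simplicial space are cut into a module part [face_p] and an algebra
    part [face_g]; the differential is their alternating sum. *)
Definition face_p n i p (g : nat -> A) : P :=
  if i == 0%N then ra p (g 0%N) else if (i < n)%N then p else la (g n.-1) p.
Definition face_g n i (g : nat -> A) : nat -> A :=
  if i == 0%N then fun j => g j.+1 else if (i < n)%N then merge_at i.-1 g else g.

Definition face_sum s p g : hoch_chain A P s :=
  \sum_(i < s.+2) (-1) ^+ i *: hgen s (face_p s.+1 i p g) (face_g s.+1 i g).

Lemma hoch_d_faces s u : hoch_d la ra (s := s) u = hoch_lift (s := s.+1) (face_sum s) u.
Proof.
apply: ext_eq => -[p t]; rewrite /= /face_sum big_ord_recl big_ord_recr /= expr0 scale1r addrA.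
congr (_ + _ + _).
- rewrite /face_p /face_g /= /thead (tnth_nth 0); congr hoch_tens; apply: eq_from_tnth => j.
  by rewrite tnth_mktuple (tnth_nth 0) /= nth_behead.
- apply: eq_bigr => i _; rewrite /face_p /face_g /= /bump /= add1n ltnS ltn_ord /=.
  congr (_ *: hoch_tens _ _); apply: eq_from_tnth => j; rewrite !tnth_mktuple /merge_at !(tnth_nth 0) /=.
  by rewrite /bump leq0n add1n -val_eqE.
rewrite /face_p /face_g /= /bump /= add1n ltnn (tnth_nth 0) /=.
by congr (_ *: hoch_tens _ _); apply: eq_from_tnth => j; rewrite !tnth_mktuple (tnth_nth 0).
Qed.

Lemma face_ext s i p g g' : (forall j, (j < s.+1)%N -> g j = g' j) ->
  hgen s (face_p s.+1 i p g) (face_g s.+1 i g) = hgen s (face_p s.+1 i p g') (face_g s.+1 i g').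
Proof.
move=> h; rewrite /face_p /face_g; case: eqP => [_|/eqP i0].
  by rewrite h //; apply: (compat_ext (hgen_compat _ _ _)) => j js; apply: h.
case: ltnP => hi; last by rewrite /= h //; apply: (compat_ext (hgen_compat _ _ _)) => j js; apply: h; lia.
by apply: (compat_ext (hgen_compat _ _ _)) => j js; rewrite /merge_at !h //; lia.
Qed.

Lemma hgen_at s (p : P) g i (U : lmodType k) (f : U -> nat -> A) : (i < s)%N ->
  (forall x j, j != i -> f x j = g j) -> linear (fun x => f x i) -> linear (fun x => hgen s p (f x)).
Proof.
move=> hi h lf c x y.
have e z : hgen s p (f z) = hgen s p (updates i (f z i) g).
  apply: (compat_ext (hgen_compat _ _ _)) => j _; rewrite /updates.
  by have [->|/h] := eqVneq j i.
by rewrite !e lf (compat_multi (hgen_compat _ _ _)).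
Qed.

Lemma face_multi s l p g i : (i < s.+1)%N ->
  linear (fun x => hgen s (face_p s.+1 l p (updates i x g)) (face_g s.+1 l (updates i x g))).
Proof.
move=> hi; have [[lal lar] [ral rar]] := (la_bilin bm, ra_bilin bm).
rewrite /face_p /face_g; case: eqP => [_|/eqP l0].
  case: i hi => [|i] hi; last first.
    apply: (@hgen_at s (ra p (g 0%N)) (fun j => g j.+1) i A (fun x j => updates i.+1 x g j.+1)) => //.
      by move=> x j nj; rewrite /updates eqSS (negbTE nj).
    by rewrite /updates eqxx.
  exact: (linear_hgen s (fun j => g j.+1) (bilin_snd p (ra_bilin bm))).
case: ltnP => hl; last first.
  rewrite /=; have [ei|ni] := eqVneq s i.
    subst i; have e x : hgen s (la (updates s x g s) p) (updates s x g) = hgen s (la x p) g.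
      rewrite {1}/updates eqxx; apply: (compat_ext (hgen_compat _ _ _)) => j js.
      by rewrite /updates ifN //; lia.
    move=> c x y; rewrite !e; move: c x y; apply: linear_hgen; exact: (linear_bilinl _ (la_bilin bm)).
  have e x : updates i x g s = g s by rewrite /updates ifN.
  move=> c x y; rewrite !e; move: c x y.
  apply: (@hgen_at s (la (g s) p) g i A (fun x => updates i x g)); first lia.
    by move=> x j nj; rewrite /updates (negbTE nj).
  by rewrite /updates eqxx.
case: l l0 hl => // l _ hl; rewrite /=.
have [h|h] := ltnP l i.
  apply: (@hgen_at s p (merge_at l g) i.-1 A (fun x => merge_at l (updates i x g))); first lia.
    move=> x j nj; rewrite /merge_at /updates.
    have -> : (j.+1 == i) = false by lia.
    case: ltnP => // h1; first by have -> : (j == i) = false by lia.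
    by case: eqP => // h2; have -> : (j == i) = false by lia.
  rewrite /merge_at /updates.
  have -> : (i.-1 < l)%N = false by lia.
  have -> : (i.-1.+1 == i) by lia.
  have -> : (i.-1 == i) = false by lia.
  by case: eqP => // h2; apply: linear_mulr.
apply: (@hgen_at s p (merge_at l g) i A (fun x => merge_at l (updates i x g))); first lia.
  move=> x j nj; rewrite /merge_at /updates (negbTE nj).
  by case: ltnP => // h1; case: eqP => // h2; have -> : (j.+1 == i) = false by lia.
rewrite /merge_at /updates eqxx; case: ltnP => // h1.
have -> : (i == l) by lia.
have -> : (i.+1 == i) = false by lia.
exact: linear_mull.
Qed.

Definition delete (i : nat) (g : nat -> A) : nat -> A := fun j => if (j < i)%N then g j else g j.+1.

(** A scalar entry persists in every face, which therefore vanishes, except in the two faces that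
    absorb it. Those two agree, and their indices are consecutive, so they cancel in the alternating
    sum: the differential is defined on normalized chains. *)
Lemma scalar_face s l p g i c : (i < s.+1)%N -> (l < s.+2)%N -> g i = c%:A ->
  hgen s (face_p s.+1 l p g) (face_g s.+1 l g) =
  if (l == i) || (l == i.+1) then c *: hgen s p (delete i g) else 0.
Proof.
move=> hi hl hg; have [[lal lar] [ral rar]] := (la_bilin bm, ra_bilin bm).
have laA q : la c%:A q = c *: q by rewrite (linZ (lal q)) (la1 bm).
have raA q : ra q c%:A = c *: q by rewrite (linZ (rar q)) (ra1 bm).
have hZ := linZ (compat_linear (hgen_compat A P s) _).
have sc := compat_scalar (hgen_compat A P s).
rewrite /face_p /face_g; case: eqP => [->|/eqP l0].
  rewrite orbF eq_sym; case: eqP => [ei|/eqP i0]; last by apply: (sc _ _ i.-1 c); rewrite ?prednK //; lia.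
  by rewrite ei in hg *; rewrite hg raA hZ.
case: ltnP => hl1; last first.
  have -> : l = s.+1 by lia.
  rewrite /=; case: ifP => [/orP[|/eqP[ei]]|hn]; first by lia.
    rewrite -ei in hg *; rewrite hg laA hZ; congr (_ *: _); apply: (compat_ext (hgen_compat _ _ _)) => j js.
    by rewrite /delete js.
  by apply: (sc _ _ i c) => //; lia.
case: l l0 hl1 {hl} => // l _ hl; rewrite /= eqSS.
have at_l : hgen s p (merge_at l g) = hgen s p (updates l (g l * g l.+1) (merge_at l g)).
  apply: (compat_ext (hgen_compat _ _ _)) => j _; rewrite /updates; case: eqP => // ->.
  by rewrite /merge_at ltnn eqxx.
have [e|n1] := eqVneq l.+1 i.
  rewrite at_l e hg -scalerAr mulr1.
  rewrite (linZ (compat_multi (hgen_compat _ _ _) _ _ _)); last lia.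
  congr (_ *: _); apply: (compat_ext (hgen_compat _ _ _)) => j js; rewrite /updates /delete /merge_at.
  have [->|nj] := eqVneq j l; first by have -> : (l < i)%N by lia.
  have -> : (j < i)%N = (j < l)%N by lia.
  by case: ltnP.
have [e|n2] := eqVneq l i.
  subst i; rewrite at_l hg -scalerAl mul1r.
  rewrite (linZ (compat_multi (hgen_compat _ _ _) _ _ _)); last lia.
  congr (_ *: _); apply: (compat_ext (hgen_compat _ _ _)) => j js; rewrite /updates /delete /merge_at.
  by have [->|nj] := eqVneq j l; first by rewrite ltnn.
rewrite orbF; have [h|h] := ltnP i l.
  by apply: (sc _ _ i c); [lia|rewrite /merge_at h].
apply: (sc _ _ i.-1 c); first lia.
rewrite /merge_at; have -> : (i.-1 < l)%N = false by lia.
have -> : (i.-1 == l) = false by lia.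
by rewrite prednK //; lia.
Qed.

Lemma face_sum_compat s : hoch_compat s.+1 (face_sum s).
Proof.
have [[lal lar] [ral rar]] := (la_bilin bm, ra_bilin bm).
split.
- by move=> p g g' h; apply: eq_bigr => i _; rewrite (face_ext _ _ h).
- move=> g; apply: linear_bigsum => i; apply: linear_scale; apply: linear_hgen.
  by rewrite /face_p; case: eqP => // _; case: ltnP.
- by move=> p g i hi; apply: linear_bigsum => l; apply: linear_scale; apply: face_multi.
move=> p g i c hi hg.
have h1 : (i < s.+2)%N by lia.
rewrite /face_sum (bigD1 (Ordinal h1)) //= (bigD1 (Ordinal (hi : i.+1 < s.+2)%N)) /=; last first.
  by rewrite -val_eqE /=; lia.
rewrite big1 ?addr0 => [|l /andP[n1 n2]]; rewrite !(@scalar_face s _ p g i c hi _ hg) //.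
  by rewrite !eqxx orbT /= exprS mulN1r scaleNr addrN.
rewrite ifN ?scaler0 //; apply/norP; split; [exact: n1 | exact: n2].
Qed.

Lemma hoch_d_linear s : linear (hoch_d la ra (s := s)).
Proof. by move=> c x y; rewrite !hoch_d_faces (hoch_lift_linear (face_sum_compat s)). Qed.

Lemma hoch_dE s p g : hoch_d la ra (hgen s.+1 p g) = face_sum s p g.
Proof. by rewrite hoch_d_faces (hoch_liftE (face_sum_compat s)). Qed.

Lemma face_mid n i p g : (i.+1 < n)%N -> face_p n i.+1 p g = p /\ face_g n i.+1 g = merge_at i g.
Proof. by rewrite /face_p /face_g /= => ->. Qed.

Lemma face_last n i p g : (n <= i.+1)%N -> face_p n i.+1 p g = la (g n.-1) p /\ face_g n i.+1 g = g.
Proof. by rewrite /face_p /face_g /= ltnNge => ->. Qed.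

Lemma merge_merge i j g l : (j <= i)%N -> merge_at j (merge_at i.+1 g) l = merge_at i (merge_at j g) l.
Proof.
move=> ji; rewrite /merge_at.
by repeat (case: ifP => ?; try by exfalso; lia); rewrite ?mulrA.
Qed.

(** The simplicial identities [d_j d_i = d_{i-1} d_j]. At the ends they express the associativity of
    the actions ([ra_mul], [la_mul]) and their commutation ([la_ra]). *)
Lemma face_face s i j p g : (j < i)%N -> (i < s.+3)%N ->
  hgen s (face_p s.+1 j (face_p s.+2 i p g) (face_g s.+2 i g)) (face_g s.+1 j (face_g s.+2 i g)) =
  hgen s (face_p s.+1 i.-1 (face_p s.+2 j p g) (face_g s.+2 j g)) (face_g s.+1 i.-1 (face_g s.+2 j g)).
Proof.
case: i => // i ji hi; rewrite [i.+1.-1]/=.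
have ce := compat_ext (hgen_compat A P s).
case: j ji => [|j] ji.
  have [hi1|hi1] := ltnP i.+1 s.+2; last first.
    have ei : i = s.+1 by lia.
    have [-> ->] := face_last p g hi1; rewrite ei.
    have [-> ->] := @face_last s.+1 s (face_p s.+2 0 p g) (face_g s.+2 0 g) (leqnn _).
    by rewrite /face_p /face_g /= (la_ra bm).
  have [-> ->] := face_mid p g hi1; case: i {ji hi} hi1 => [|i] hi1.
    by rewrite /face_p /face_g /= (ra_mul bm).
  have [-> ->] := @face_mid s.+1 i (face_p s.+2 0 p g) (face_g s.+2 0 g) hi1.
  by rewrite /face_p /face_g /=.
have [hi1|hi1] := ltnP i.+1 s.+2.
  have [-> ->] := face_mid p g hi1.
  case: i ji hi hi1 => // i ji hi hi1.
  have [|-> ->] := @face_mid s.+1 j p (merge_at i.+1 g); first lia.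
  have [|-> ->] := @face_mid s.+2 j p g; first lia.
  have [|-> ->] := @face_mid s.+1 i p (merge_at j g); first lia.
  by apply: ce => l _; apply: merge_merge.
have ei : i = s.+1 by lia.
have [-> ->] := face_last p g hi1; rewrite {}ei in ji hi hi1 *.
have [-> ->] := @face_mid s.+2 j p g ji.
have [-> ->] := @face_last s.+1 s p (merge_at j g) (leqnn _).
have [hj|hj] := ltnP j.+1 s.+1.
  have [-> ->] := @face_mid s.+1 j (la (g s.+2.-1) p) g hj.
  rewrite /= /merge_at; have -> : (s < j)%N = false by lia.
  by have -> : (s == j) = false by lia.
have [-> ->] := @face_last s.+1 j (la (g s.+2.-1) p) g hj.
have ej : j = s by lia.
rewrite ej /= {1}/merge_at ltnn eqxx (la_mul bm).
by apply: ce => l ls; rewrite /merge_at ls.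
Qed.

(** The terms with [j < i] are matched with the others by [(i, j) |-> (j, i - 1)], which changes the
    parity of [i + j]. *)
Lemma alternating_sum (V : lmodType k) n (F : nat -> nat -> V) :
  (forall i j, (j < i)%N -> (i < n.+2)%N -> F i j = F j i.-1) ->
  \sum_(i < n.+2) (-1) ^+ i *: \sum_(j < n.+1) (-1) ^+ j *: F i j = 0.
Proof.
move=> h; pose G (i j : nat) := (-1 : k) ^+ (i + j) *: F i j.
transitivity (\sum_(i < n.+2) \sum_(j < n.+1) G i j).
  by apply: eq_bigr => i _; rewrite scaler_sumr; apply: eq_bigr => j _; rewrite scalerA -exprD.
transitivity (\sum_(i < n.+2) (\sum_(j < n.+1 | (j < i)%N) G i j) +
  \sum_(i < n.+2) (\sum_(j < n.+1 | ~~ (j < i)%N) G i j)).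
  by rewrite -big_split; apply: eq_bigr => i _; rewrite (bigID (fun j : 'I_n.+1 => (j < i)%N)).
(* The index [i = 0] contributes nothing to the first double sum and [i = n + 1] nothing to the
   second; without them both outer sums have [n + 1] terms. *)
rewrite big_ord_recl [X in X + _ + _]big1 // add0r.
rewrite [X in _ + X]big_ord_recr /= [X in _ + (_ + X)]big1 ?addr0; last first.
  by move=> j; rewrite -leqNgt => hj; have := ltn_ord j; rewrite ltnNge hj.
rewrite [X in _ + X](exchange_big_dep xpredT) //=.
rewrite -big_split big1 //= => i _.
have -> : \sum_(j < n.+1 | (j < bump 0 i)%N) G (bump 0 i) j = \sum_(j < n.+1 | ~~ (i < j)%N) - G j i.
  apply: eq_big => [j|j hj]; first by rewrite /bump /= add1n ltnS -leqNgt.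
  rewrite /bump /= add1n in hj *; rewrite /G h //; last by have := ltn_ord i; lia.
  by rewrite addSn exprS mulN1r scaleNr addnC.
by rewrite sumrN addNr.
Qed.

Lemma hoch_d_d s x : hoch_d la ra (s := s) (hoch_d la ra (s := s.+1) x) = 0.
Proof.
move: x; apply: hoch_ext => [||p g].
- exact: linear_comp (@hoch_d_linear s) (@hoch_d_linear s.+1).
- exact: linear_zero.
rewrite hoch_dE /face_sum (lin_sum (@hoch_d_linear s)).
transitivity (\sum_(i < s.+3) (-1) ^+ i *: \sum_(j < s.+2) (-1) ^+ j *:
  hgen s (face_p s.+1 j (face_p s.+2 i p g) (face_g s.+2 i g)) (face_g s.+1 j (face_g s.+2 i g))).
  by apply: eq_bigr => i _; rewrite (linZ (@hoch_d_linear s)) hoch_dE.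
apply: (alternating_sum (F := fun i j => hgen s (face_p s.+1 j (face_p s.+2 i p g) (face_g s.+2 i g))
  (face_g s.+1 j (face_g s.+2 i g)))).
by move=> i j ji hi; apply: face_face.
Qed.
End HochschildDifferential.
Arguments hoch_d_linear {k A P la ra} bm s a x y.

Lemma tlift0 (k : fieldType) (V W Z : lmodType k) (u : tensor V W) : tlift (fun _ _ => 0 : Z) u = 0.
Proof. by have [s hs] := tlift_sum u; rewrite hs big1 // => x _; rewrite scaler0. Qed.

Lemma tlift_bigsum (k : fieldType) (V W Z : lmodType k) (u : tensor V W) n (c : nat -> k) (X : nat -> V -> W -> Z) :
  tlift (fun v w => \sum_(i < n) c i *: X i v w) u = \sum_(i < n) c i *: tlift (X i) u.
Proof.
have [s hs] := tlift_sum u; rewrite hs.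
under [RHS]eq_bigr do rewrite hs scaler_sumr.
rewrite [RHS]exchange_big; apply: eq_bigr => x _; rewrite scaler_sumr.
by apply: eq_bigr => i _; rewrite !scalerA mulrC.
Qed.

Section HochschildFunctor.
Variables (k : fieldType) (A : algType k).

Definition hoch_map (P P' : lmodType k) (F : P -> P') s : hoch_chain A P s -> hoch_chain A P' s :=
  hoch_lift (fun p g => hgen s (F p) g).

Lemma hoch_map_compat (P P' : lmodType k) (F : P -> P') s : linear F ->
  hoch_compat s (fun p (g : nat -> A) => hgen s (F p) g).
Proof.
move=> lF; have h := hgen_compat A P' s; split=> [p g g'|g|p g i|p g i c].
- exact: compat_ext.
- exact: linear_hgen.
- exact: compat_multi.
- exact: compat_scalar.
Qed.

Lemma hoch_map_linear (P P' : lmodType k) (F : P -> P') s : linear F -> linear (hoch_map F (s := s)).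
Proof. by move=> lF; apply: hoch_lift_linear; apply: hoch_map_compat. Qed.

Lemma hoch_mapE (P P' : lmodType k) (F : P -> P') s p g : linear F ->
  hoch_map F (hgen s p g) = hgen s (F p) g.
Proof. by move=> lF; rewrite /hoch_map hoch_liftE //; apply: hoch_map_compat. Qed.

Lemma hoch_map_comp0 (P1 P2 P3 : lmodType k) (F : P1 -> P2) (G : P2 -> P3) s x : linear F -> linear G ->
  (forall p, G (F p) = 0) -> hoch_map G (hoch_map F x) = 0 :> hoch_chain A P3 s.
Proof.
move=> lF lG h; move: x; apply: hoch_ext => [||p g]; last first.
- by rewrite !hoch_mapE // h (lin0 (compat_linear (hgen_compat _ _ _) _)).
- exact: linear_zero.
exact: linear_comp (hoch_map_linear lG) (hoch_map_linear lF).
Qed.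

Lemma hoch_map_exact (P1 P2 P3 : lmodType k) (F : P1 -> P2) (G : P2 -> P3) s : linear F -> linear G ->
  (forall y, G y = 0 -> exists x, F x = y) ->
  forall u : hoch_chain A P2 s, hoch_map G u = 0 -> exists v, hoch_map F v = u.
Proof.
move=> lF lG ex u hu; have [a [b [la lb ab]]] := exact_split lF lG ex.
exists (hoch_map a u).
transitivity (hoch_map b (hoch_map G u) + hoch_map F (hoch_map a u)).
  by rewrite hu (lin0 (hoch_map_linear lb)) add0r.
move: u {hu}; apply: hoch_ext => // [|p g].
  apply: linear_add; first exact: linear_comp (hoch_map_linear lb) (hoch_map_linear lG).
  exact: linear_comp (hoch_map_linear lF) (hoch_map_linear la).
by rewrite !hoch_mapE // {3}[p]ab (linD (compat_linear (hgen_compat _ _ _) _)).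
Qed.

Lemma hoch_map_surj (P P' : lmodType k) (F : P -> P') s : linear F ->
  (forall y, exists x, F x = y) -> forall u, exists v, hoch_map F (s := s) v = u.
Proof.
move=> lF sF; apply: hoch_ind => [|p g]; first exact: submodule_im (hoch_map_linear lF).
by have [q hq] := sF p; exists (hgen s q g); rewrite hoch_mapE // hq.
Qed.

Lemma hoch_map_d (P P' : lmodType k) (F : P -> P') la ra la' ra' s x : linear F ->
  bimodule_axioms (A := A) la ra -> bimodule_axioms (A := A) la' ra' ->
  (forall a p, F (la a p) = la' a (F p)) -> (forall p a, F (ra p a) = ra' (F p) a) ->
  hoch_map F (hoch_d la ra (s := s) x) = hoch_d la' ra' (hoch_map F x).
Proof.
move=> lF bm bm' hl hr; move: x; apply: hoch_ext => [||p g].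
- exact: linear_comp (hoch_map_linear lF) (hoch_d_linear bm _).
- exact: linear_comp (hoch_d_linear bm' _) (hoch_map_linear lF).
rewrite hoch_mapE // !hoch_dE // (lin_sum (hoch_map_linear lF)); apply: eq_bigr => i _.
rewrite (linZ (hoch_map_linear lF)) hoch_mapE //; congr (_ *: hgen _ _ _).
by rewrite /face_p; case: eqP => // _; case: ltnP.
Qed.
End HochschildFunctor.

(** * The Hochschild complex of N (x) M resolves M (x)_A N when N has a section *)

Section HochschildContraction.
Variables (k : fieldType) (A : algType k) (M : rmodule A) (N : module A).
Local Notation P := (tensor N M).

Definition tens_left (a : A) : P -> P := tlift (fun n m => act N a n \ox m).
Definition tens_right (p : P) (a : A) : P := tlift (fun n m => n \ox ract a m) p.

Lemma tens_left_bilin1 a : bilin (fun (n : N) (m : M) => act N a n \ox m).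
Proof. by lin. Qed.
Lemma tens_right_bilin1 a : bilin (fun (n : N) (m : M) => n \ox ract a m).
Proof. by lin. Qed.
Lemma tens_leftE a n m : tens_left a (n \ox m) = act N a n \ox m.
Proof. exact: (tliftE (tens_left_bilin1 a)). Qed.
Lemma tens_rightE n m a : tens_right (n \ox m) a = n \ox ract a m.
Proof. exact: (tliftE (tens_right_bilin1 a)). Qed.
Lemma tens_left_linear a : linear (tens_left a).
Proof. exact: tlift_linear (tens_left_bilin1 a). Qed.
Lemma tens_right_linear a : linear (tens_right^~ a).
Proof. exact: tlift_linear (tens_right_bilin1 a). Qed.

Lemma tens_bimodule : bimodule_axioms tens_left tens_right.
Proof.
have ll := tens_left_linear; have lr := tens_right_linear.
split=> [||a b|p a b|a p b||].
- by apply: bilin_intro => // p; rewrite /tens_left; lin.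
- by apply: bilin_intro => // p; rewrite /tens_right; lin.
- apply: tens_ext => [||n m]; [exact: ll|exact: linear_comp (ll a) (ll b)|].
  by rewrite !tens_leftE actM.
- move: p; apply: tens_ext => [||n m]; [exact: lr|exact: linear_comp (lr b) (lr a)|].
  by rewrite !tens_rightE ract_mul.
- move: p; apply: tens_ext => [||n m]; [exact: linear_comp (ll a) (lr b)|exact: linear_comp (lr b) (ll a)|].
  by rewrite !(tens_leftE, tens_rightE).
- by apply: tens_ext => [||n m]; [exact: ll|exact: linear_id|rewrite tens_leftE act1].
by apply: tens_ext => [||n m]; [exact: lr|exact: linear_id|rewrite tens_rightE ract1].
Qed.
Let bm := tens_bimodule.
Local Notation C := (hoch_chain A P).
Local Notation d := (hoch_d tens_left tens_right).

Definition hoch_aug : C 0 -> tensor_over M N :=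
  hoch_lift (fun p _ => tlift (fun n m => tens_over m n) p).

Lemma tens_over_flip_bilin : bilin (fun (n : N) (m : M) => tens_over m n).
Proof. by lin. Qed.

Lemma hoch_aug_compat : hoch_compat 0 (fun p (_ : nat -> A) => tlift (fun (n : N) (m : M) => tens_over m n) p).
Proof. by split=> // g; apply: tlift_linear tens_over_flip_bilin. Qed.

Lemma hoch_aug_linear : linear hoch_aug.
Proof. exact: hoch_lift_linear hoch_aug_compat. Qed.

Lemma hoch_augE n m g : hoch_aug (hgen 0 (n \ox m) g) = tens_over m n.
Proof. by rewrite /hoch_aug hoch_liftE ?tliftE //; [apply: tens_over_flip_bilin | apply: hoch_aug_compat]. Qed.

Lemma hoch_tens_ext s (Z : lmodType k) (F G : C s -> Z) : linear F -> linear G ->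
  (forall n m g, F (hgen s (n \ox m) g) = G (hgen s (n \ox m) g)) -> forall x, F x = G x.
Proof.
move=> lF lG h; apply: hoch_ext => // p g; move: p; apply: tens_ext => [||n m]; last exact: h.
  by apply: (linear_comp lF); apply: linear_hgen.
by apply: (linear_comp lG); apply: linear_hgen.
Qed.

Lemma hoch_aug_d x : hoch_aug (d (s := 0) x) = 0.
Proof.
move: x; apply: hoch_tens_ext => [||n m g].
- exact: linear_comp hoch_aug_linear (hoch_d_linear bm _).
- exact: linear_zero.
rewrite hoch_dE // /face_sum !big_ord_recl big_ord0 addr0 /bump /= expr0 scale1r expr1 scaleN1r.
rewrite (linB hoch_aug_linear) /face_p /= tens_rightE tens_leftE !hoch_augE.
by rewrite [ract _ _]/(act M _ _) tens_over_balanced subrr.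
Qed.

Lemma hoch_aug_surj y : exists x, hoch_aug x = y.
Proof.
move: y; apply: tens_over_ind; first exact: submodule_im hoch_aug_linear.
by move=> m n; exists (hgen 0 (n \ox m) (fun=> 0)); rewrite hoch_augE.
Qed.

Variable tau : N -> tensor A N.
Hypothesis ht : action_section tau.
Let lt := section_linear ht.

Lemma contract_bilin s (m : M) g : bilin (fun (a : A) (n' : N) => hgen s.+1 (n' \ox m) (updates s a g)).
Proof.
apply: bilin_intro => [n'|a]; last by apply: linear_hgen; lin.
exact: (compat_multi (hgen_compat _ _ _)).
Qed.

(** An extra degeneracy at the end: [n] is written as the sum of [a n'], and [a] becomes a new last
    entry, at index [s]. *)
Definition contract_pure s (n : N) (m : M) (g : nat -> A) : C s.+1 :=
  tlift (fun a n' => hgen s.+1 (n' \ox m) (updates s a g)) (tau n).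

Lemma contract_pure_bilin s g : bilin (fun n m => contract_pure s n m g).
Proof.
apply: bilin_intro => [m|n]; first exact: linear_tlift (contract_bilin _ _ _) lt.
by apply: linear_tlift_fun => a n'; apply: linear_hgen; lin.
Qed.

Lemma contract_compat s : hoch_compat s (fun p g => tlift (fun n m => contract_pure s n m g) p).
Proof.
have h := hgen_compat A P s.+1; split=> [p g g' hg|g|p g i hi|p g i c hi hg].
- apply: tlift_eq => n m; apply: tlift_eq => a n'; apply: (compat_ext h) => j js.
  by rewrite /updates; case: eqP => // /eqP nj; apply: hg; lia.
- exact: tlift_linear (contract_pure_bilin _ _).
- apply: linear_tlift_fun => n m; apply: linear_tlift_fun => a n'.
  apply: (@hgen_at _ _ _ s.+1 _ (updates s a g) i A (fun x => updates s a (updates i x g))); first lia.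
    by move=> x j nj; rewrite /updates (negbTE nj).
  by rewrite /updates eqxx; case: eqP => // e; lia.
rewrite -(tlift0 (k := k) (V := N) (W := M) _ p); apply: tlift_eq => n m.
rewrite -(tlift0 (k := k) (V := A) (W := N) _ (tau n)); apply: tlift_eq => a n'.
apply: (@compat_scalar _ _ _ _ _ _ h _ _ i c); first lia.
by rewrite /updates; case: eqP => // e; lia.
Qed.

Definition contraction s : C s -> C s.+1 :=
  hoch_lift (fun p g => tlift (fun n m => contract_pure s n m g) p).

Lemma contraction_linear s : linear (@contraction s).
Proof. exact: hoch_lift_linear (contract_compat s). Qed.
Lemma contractionE s n m g : contraction (hgen s (n \ox m) g) = contract_pure s n m g.
Proof. by rewrite /contraction (hoch_liftE (contract_compat s)) (tliftE (contract_pure_bilin _ _)). Qed.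

Lemma hoch_d_contract s n m g : d (contract_pure s n m g) =
  tlift (fun a n' => face_sum tens_left tens_right s (n' \ox m) (updates s a g)) (tau n).
Proof.
rewrite /contract_pure (tlift_comp _ _ (hoch_d_linear bm _)).
by apply: tlift_eq => a n'; rewrite hoch_dE.
Qed.

Lemma last_face_contract s n m g :
  tlift (fun a n' => hgen s (face_p tens_left tens_right s.+1 s.+1 (n' \ox m) (updates s a g))
     (face_g s.+1 s.+1 (updates s a g))) (tau n) = hgen s (n \ox m) g.
Proof.
have lg : linear (fun n : N => hgen s (n \ox m) g) by apply: linear_hgen; lin.
rewrite -{2}(section_mult ht n) (tlift_comp _ _ lg); apply: tlift_eq => a n'.
have [-> ->] := face_last tens_left tens_right (n' \ox m) (updates s a g) (leqnn s.+1).
rewrite tens_leftE /= {1}/updates eqxx; apply: (compat_ext (hgen_compat _ _ _)) => j js.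
by rewrite /updates ifN //; lia.
Qed.

(** All faces but the last commute with the contraction; for the one that merges the old last entry
    with [a], this is the [A]-linearity of [tau]. The last face restores the chain because [a n']
    sums to [n], and its sign is that of its index [s + 2]. *)
Lemma contraction_homotopy s x : d (contraction x) = contraction (d x) + (-1) ^+ s *: x :> C s.+1.
Proof.
move: x; apply: hoch_tens_ext => [||n m g].
- exact: linear_comp (hoch_d_linear bm _) (@contraction_linear _).
- by apply: linear_add; [exact: linear_comp (@contraction_linear _) (hoch_d_linear bm _)|exact: linear_scale].
rewrite contractionE hoch_d_contract /face_sum.
rewrite (tlift_bigsum _ _ (fun i => (-1) ^+ i) (fun i a n' =>
  hgen s.+1 (face_p tens_left tens_right s.+2 i (n' \ox m) (updates s.+1 a g)) (face_g s.+2 i (updates s.+1 a g)))).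
rewrite big_ord_recr last_face_contract /= !exprS !mulN1r opprK; congr (_ + _).
rewrite hoch_dE // /face_sum (lin_sum (@contraction_linear s)); apply: eq_bigr => i _.
rewrite (linZ (@contraction_linear s)); congr (_ *: _).
have ce := compat_ext (hgen_compat A P s.+1).
case: i => -[|i] hi /=.
  rewrite /face_p /face_g /= [tens_right (n \ox m) _]tens_rightE contractionE /contract_pure.
  apply: tlift_eq => a n'; rewrite tens_rightE; apply: ce => j js.
  by rewrite /updates eqSS.
have [h|h] := ltnP i.+1 s.+1.
  have [-> ->] := face_mid tens_left tens_right (n \ox m) g h.
  rewrite contractionE; apply: tlift_eq => a n'.
  have [-> ->] := face_mid tens_left tens_right (n' \ox m) (updates s.+1 a g) hi.
  apply: ce => j js; rewrite /merge_at /updates.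
  by repeat (case: ifP => ?; try by exfalso; lia).
have ei : i = s by lia.
have [-> ->] := face_last tens_left tens_right (n \ox m) g h.
rewrite tens_leftE contractionE /contract_pure (section_act ht) /free_act.
rewrite (tlift_comp _ _ (tlift_linear (contract_bilin _ _ _))); apply: tlift_eq => a n'.
rewrite tliftE; last exact: contract_bilin.
have [-> ->] := face_mid tens_left tens_right (n' \ox m) (updates s.+1 a g) hi.
rewrite ei; apply: ce => j js; rewrite /merge_at /updates.
have [->|nj] := eqVneq j s; first by rewrite ltnn ifN ?eqxx //; lia.
by repeat (case: ifP => ?; try by exfalso; lia).
Qed.

Lemma hoch_acyclic s (x : C s.+1) : d x = 0 -> exists y, d y = x.
Proof.
move=> dx; exists ((-1) ^+ s *: contraction x).
rewrite (linZ (hoch_d_linear bm _)) contraction_homotopy dx (lin0 (@contraction_linear s)) add0r.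
exact: sign_scaleK.
Qed.

(** In degree 0 the contraction produces one face besides the chain itself, the one where [a] acts
    on [m]. It depends only on the augmentation of the chain, through this map. *)
Definition unaug_pure (m : M) (n : N) : C 0 := tlift (fun a n' => hgen 0 (n' \ox ract a m) (fun=> 0)) (tau n).

Lemma unaug_bilin1 m : bilin (fun (a : A) (n' : N) => hgen (A := A) 0 (n' \ox ract a m : P) (fun=> 0)).
Proof. by apply: bilin_intro => ?; apply: linear_hgen; lin. Qed.

Lemma unaug_bilin : bilin unaug_pure.
Proof.
apply: bilin_intro => [n|m]; last exact: linear_tlift (unaug_bilin1 m) lt.
by apply: linear_tlift_fun => a n'; apply: linear_hgen; lin.
Qed.

Lemma unaug_balanced (a : A^c) m n : unaug_pure (act M a m) n = unaug_pure m (act N a n).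
Proof.
rewrite /unaug_pure (section_act ht) /free_act.
rewrite (tlift_comp _ _ (tlift_linear (unaug_bilin1 _))); apply: tlift_eq => b n'.
by rewrite tliftE; [rewrite ract_mul | apply: unaug_bilin1].
Qed.

Lemma hoch_aug_exact x : hoch_aug x = 0 -> exists y, d (s := 0) y = x.
Proof.
move=> hx; exists (- contraction x).
suff e y : d (contraction y) = otlift unaug_pure (hoch_aug y) - y.
  rewrite (linN (hoch_d_linear bm _)) e hx (lin0 (otlift_linear unaug_bilin unaug_balanced)).
  by rewrite sub0r opprK.
move: y {x hx}; apply: hoch_tens_ext => [||n m g].
- exact: linear_comp (hoch_d_linear bm _) (@contraction_linear _).
- apply: linear_sub => //; exact: linear_comp (otlift_linear unaug_bilin unaug_balanced) hoch_aug_linear.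
rewrite contractionE hoch_d_contract /face_sum.
rewrite (tlift_bigsum _ _ (fun i => (-1) ^+ i) (fun i a n' =>
  hgen 0 (face_p tens_left tens_right 1 i (n' \ox m) (updates 0 a g)) (face_g 1 i (updates 0 a g)))).
rewrite big_ord_recr last_face_contract big_ord1 /= expr0 scale1r expr1 scaleN1r.
congr (_ - _); rewrite hoch_augE (otliftE unaug_bilin unaug_balanced); apply: tlift_eq => a n'.
by rewrite /face_p /face_g /= tens_rightE; apply: (compat_ext (hgen_compat _ _ _)).
Qed.
End HochschildContraction.

(** * Iterated coproducts *)

Section SweedlerSequences.
Variables (k : fieldType) (H : algType k) (HH : hopf H).
Local Notation sw := (sw (comul HH)).
Implicit Type U : lmodType k.

Definition scons (a : H) (f : nat -> H) : nat -> H := fun j => if j is i.+1 then f i else a.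

(* swn with the list of factors h(1), ..., h(n+1) presented as a sequence nat -> H. *)
Fixpoint swf U n (h : H) (phi : (nat -> H) -> U) : U :=
  if n is m.+1 then sw h (fun a h' => swf m h' (fun f => phi (scons a f))) else phi (scons h (fun=> 0)).

Lemma swn_swf U n h (phi : (nat -> H) -> U) : swn (comul HH) n h (fun s => phi (nth 0 s)) = swf n h phi.
Proof.
have e a s : nth 0 (a :: s) = scons a (nth 0 s) by apply/funext => -[|j].
elim: n h phi => [|n IH] h phi /=.
  by rewrite e; congr (phi (scons h _)); apply/funext => j; rewrite nth_nil.
apply: sw_eq => a h'; rewrite -(IH h' (fun f => phi (scons a f))).
by congr (swn _ _ _ _); apply/funext => s; rewrite e.
Qed.

Lemma swf_eq U n h (phi psi : (nat -> H) -> U) : (forall f, phi f = psi f) -> swf n h phi = swf n h psi.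
Proof. by move=> /funext ->. Qed.

Lemma swf_comp U U' n h (g : U -> U') (phi : (nat -> H) -> U) : linear g ->
  g (swf n h phi) = swf n h (fun f => g (phi f)).
Proof.
move=> lg; elim: n h phi => //= n IH h phi.
by rewrite (sw_comp _ _ _ lg); apply: sw_eq => a h'.
Qed.

Lemma swf_sw U n h l (phi : H -> H -> (nat -> H) -> U) :
  sw l (fun x y => swf n h (phi x y)) = swf n h (fun f => sw l (fun x y => phi x y f)).
Proof.
elim: n h phi => //= n IH h phi; rewrite sw_swap; apply: sw_eq => a h'.
exact: (IH h' (fun x y f => phi x y (scons a f))).
Qed.

Lemma swf_bigsum U n h m (c : nat -> k) (phi : nat -> (nat -> H) -> U) :
  swf n h (fun f => \sum_(i < m) c i *: phi i f) = \sum_(i < m) c i *: swf n h (phi i).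
Proof.
elim: n h phi => //= n IH h phi.
rewrite /Defs.sw -(tlift_bigsum _ _ c (fun i a h' => swf n h' (fun f => phi i (scons a f)))).
by apply: tlift_eq => a h'; apply: (IH h' (fun i f => phi i (scons a f))).
Qed.

Lemma linear_swf_fun U (V : lmodType k) n h (phi : V -> (nat -> H) -> U) : (forall f, linear (fun x : V => phi x f)) ->
  linear (fun x => swf n h (phi x)).
Proof.
elim: n h phi => [|n IH] h phi hphi /=; first exact: hphi.
by apply: linear_sw_fun => a h'; apply: IH.
Qed.

Definition multilin n U (phi : (nat -> H) -> U) : Prop :=
  forall i f, (i < n)%N -> linear (fun x => phi (updates i x f)).

Lemma updates_scons0 x a f : updates 0 x (scons a f) = scons x f.
Proof. by apply/funext => -[|j]. Qed.
Lemma updates_sconsS i x a f : updates i.+1 x (scons a f) = scons a (updates i x f).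
Proof. by apply/funext => -[|j]. Qed.

Lemma multilin_scons n U (phi : (nat -> H) -> U) a : multilin n.+1 phi -> multilin n (fun f => phi (scons a f)).
Proof.
move=> h i f hi c x y; have := @h i.+1 (scons a f) hi c x y.
by rewrite !updates_sconsS.
Qed.

Lemma multilin_head n U (phi : (nat -> H) -> U) f : multilin n.+1 phi -> linear (fun a => phi (scons a f)).
Proof.
by move=> h c x y; have := @h 0%N (scons 0 f) isT c x y; rewrite !updates_scons0.
Qed.

Lemma swf_linear n U (phi : (nat -> H) -> U) : multilin n.+1 phi -> linear (fun h => swf n h phi).
Proof.
elim: n phi => [|n IH] phi hphi /=; first exact: multilin_head hphi.
apply: linear_sw => //; apply: bilin_intro => [h'|a]; last by apply: IH; apply: multilin_scons.
by apply: linear_swf_fun => f; apply: multilin_head hphi.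
Qed.

Fixpoint insert2 l (x y : H) (f : nat -> H) : nat -> H :=
  if l is l'.+1 then scons (f 0%N) (insert2 l' x y (fun j => f j.+1)) else scons x (scons y (fun j => f j.+1)).

Lemma insert2E l x y f j :
  insert2 l x y f j = if (j < l)%N then f j else if j == l then x else if j == l.+1 then y else f j.-1.
Proof.
elim: l j f => [|l IH] [|[|j]] f //=; first by rewrite IH; case: l {IH}.
by rewrite IH ltnS !eqSS.
Qed.

(** Generalized coassociativity: [swf] always splits the rightmost factor, but the additional
    coproduct may be taken on any factor [l]. *)
Lemma swf_split n l h U (phi : (nat -> H) -> U) : (l <= n)%N -> multilin n.+2 phi ->
  swf n.+1 h phi = swf n h (fun f => sw (f l) (fun x y => phi (insert2 l x y f))).
Proof.
elim: n l h phi => [|n IH] [|l] h phi ln hphi //=.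
- transitivity (sw h (fun a c => sw a (fun x y => swf n c (fun f => phi (scons x (scons y f)))))).
    rewrite (sw_assoc HH (phi := fun x y c => swf n c (fun f => phi (scons x (scons y f))))) //.
    + by move=> y z; apply: linear_swf_fun => f; apply: multilin_head hphi.
    + move=> x z; apply: linear_swf_fun => f.
      exact: (multilin_head f (multilin_scons x hphi)).
    by move=> x y; apply: swf_linear; apply: (multilin_scons y (multilin_scons x hphi)).
  by apply: sw_eq => a c; rewrite swf_sw.
apply: sw_eq => a h'.
by rewrite -/(swf n.+1 h' (fun f => phi (scons a f))) (IH l) //; apply: multilin_scons.
Qed.
End SweedlerSequences.

(** * The chain endomorphism of an element of H *)

Section HopfChain.
Variables (k : fieldType) (H : algType k) (HH : hopf H) (A : algType k).
Variable C : crossed_product HH A.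
Variable finv : {linear tensor H H -> A}.
Hypothesis hfinv : convolution_inverse HH (cocycle C) finv.
Local Notation E := (cp_alg C : algType k).
Local Notation sw := (sw (comul HH)).
Local Notation iota := (@cp_of_alg k H HH A C).
Local Notation gamma := (@cp_of_hopf k H HH A C).
Local Notation u := (@cp_of_hopf_inv k H HH A C finv).
Local Notation "a ^^ h" := (wact (cp_act C) h a) (at level 30).
Variable M : rmodule E.

Section OneModule.
Variable N : module E.
Local Notation P := (bimod M N).
Local Notation bl := (@bimod_left k H HH A C M N).
Local Notation br := (@bimod_right k H HH A C M N).
Local Notation d := (@tor_alg_d k H HH A C M N).
Local Notation hchain := (@hopf_chain k H HH A C M N finv).

Lemma bimod_axioms_E : bimodule_axioms (A := E) bl br.
Proof. exact: (@tens_bimodule k E M N). Qed.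
Let bmE := bimod_axioms_E.

Lemma bimod_axioms_A : bimodule_axioms (A := A) (fun a => bl (iota a)) (fun p a => br p (iota a)).
Proof. exact: (@tens_bimodule k A (resr M) (resl N)). Qed.
Let bmA := bimod_axioms_A.

Definition hchain_pure s p g (f : nat -> H) : hoch_chain A P s :=
  hgen s (bl (gamma (f s.+1)) (br p (u (f 0%N)))) (fun i => g i ^^ f i.+1).

Lemma linear_bl_gamma (U : lmodType k) (q : U -> H) p : linear q -> linear (fun x => bl (gamma (q x)) p).
Proof.
move=> lq; apply: (linear_bilinl p (la_bilin bmE)).
by lin.
Qed.

Lemma linear_br_u (U : lmodType k) (q : U -> H) p : linear q -> linear (fun x => br p (u (q x))).
Proof.
move=> lq; apply: (linear_bilinr p (ra_bilin bmE)).
by lin.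
Qed.

Lemma bl_linear x : linear (bl x).
Proof. exact: (bilin_snd x (la_bilin bmE)). Qed.
Lemma br_linear x : linear (br^~ x).
Proof. exact: (bilin_fst x (ra_bilin bmE)). Qed.

Lemma hchain_compat s h : hoch_compat s (fun p g => swf HH s.+1 h (hchain_pure s p g)).
Proof.
have hc := hgen_compat A P s; split.
- by move=> p g g' hg; apply: swf_eq => f; apply: (compat_ext hc) => j js; rewrite hg.
- move=> g; apply: linear_swf_fun => f; apply: linear_hgen.
  exact: linear_comp (bl_linear _) (br_linear _).
- move=> p g i hi; apply: linear_swf_fun => f.
  apply: (@hgen_at _ _ _ s _ (fun j => g j ^^ f j.+1) i A (fun x j => updates i x g j ^^ f j.+1)) => //.
    by move=> x j nj; rewrite /updates (negbTE nj).
  by rewrite /updates eqxx; lin.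
move=> p g i c hi hg; rewrite (_ : hchain_pure s p g = fun _ => 0).
  have l0 : linear (fun x : hoch_chain A P s => 0 : hoch_chain A P s) by apply: linear_zero.
  by rewrite -(swf_comp HH s.+1 h (fun _ => 0 : hoch_chain A P s) l0).
(* Normalization is respected: the action of [h] sends the scalar [c] to the scalar [c eps(h)]. *)
apply/funext => f; apply: (@compat_scalar _ _ _ _ _ _ hc _ _ i (c * counit HH (f i.+1))) => //.
by rewrite hg (linZ (bilin_snd _ (wact_bilin _))) wact1r scalerA.
Qed.

Lemma hopf_chain_lift h s x : hchain h (s := s) x = hoch_lift (fun p g => swf HH s.+1 h (hchain_pure s p g)) x.
Proof.
apply: ext_eq => -[p t]; rewrite -swn_swf; congr (swn _ _ _ _); apply/funext => hs.
rewrite /hchain_pure /hgen; congr hoch_tens; apply: eq_from_tnth => i.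
by rewrite !tnth_mktuple (tnth_nth 0).
Qed.

Lemma hopf_chain_linear h s : linear (hchain h (s := s)).
Proof. by move=> c x y; rewrite !hopf_chain_lift (hoch_lift_linear (hchain_compat s h)). Qed.

Lemma hopf_chainE h s p g : hchain h (hgen s p g) = swf HH s.+1 h (hchain_pure s p g).
Proof. by rewrite hopf_chain_lift (hoch_liftE (hchain_compat s h)). Qed.

Local Notation fp := (face_p (fun a => bl (iota a)) (fun p a => br p (iota a))).

Definition hchain_face s l p g (f : nat -> H) : hoch_chain A P s :=
  hgen s (fp s.+1 l (bl (gamma (f s.+2)) (br p (u (f 0%N)))) (fun i => g i ^^ f i.+1))
         (face_g s.+1 l (fun i => g i ^^ f i.+1)).

Lemma face_p_linear s l g : linear (fun p => fp s.+1 l p g).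
Proof.
rewrite /face_p; case: eqP => _; first exact: br_linear.
by case: ltnP => _; [exact: linear_id|exact: bl_linear].
Qed.

Lemma hchain_face_multilin s l p g : multilin s.+3 (hchain_face s l p g).
Proof.
move=> [|i] f hi.
  have e x : hchain_face s l p g (updates 0 x f) =
     hgen s (fp s.+1 l (bl (gamma (f s.+2)) (br p (u x))) (fun i => g i ^^ f i.+1))
         (face_g s.+1 l (fun i => g i ^^ f i.+1)) by [].
  move=> c x y; rewrite !e; move: c x y; apply: linear_hgen; apply: (linear_comp (face_p_linear s l _)).
  by apply: (linear_comp (bl_linear _)); apply: linear_br_u; apply: linear_id.
have [ei|ni] := eqVneq i s.+1.
  subst i; have e x : hchain_face s l p g (updates s.+2 x f) =
     hgen s (fp s.+1 l (bl (gamma x) (br p (u (f 0%N)))) (fun i => g i ^^ f i.+1))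
         (face_g s.+1 l (fun i => g i ^^ f i.+1)).
    rewrite /hchain_face [updates _ _ _ s.+2]/updates eqxx; apply: face_ext => j js.
    by rewrite /updates ifN //; lia.
  move=> c x y; rewrite !e; move: c x y; apply: linear_hgen.
  by apply: (linear_comp (face_p_linear s l _)); apply: linear_bl_gamma; apply: linear_id.
have e x : hchain_face s l p g (updates i.+1 x f) =
   hgen s (fp s.+1 l (bl (gamma (f s.+2)) (br p (u (f 0%N)))) (updates i (g i ^^ x) (fun i => g i ^^ f i.+1)))
         (face_g s.+1 l (updates i (g i ^^ x) (fun i => g i ^^ f i.+1))).
  have -> : updates i (g i ^^ x) (fun i0 => g i0 ^^ f i0.+1) = fun j => g j ^^ updates i.+1 x f j.+1.
    by apply/funext => j; rewrite /updates eqSS; case: eqP => // ->.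
  rewrite /hchain_face; have -> : updates i.+1 x f s.+2 = f s.+2 by rewrite /updates ifN //; lia.
  by [].
move=> c x y; rewrite !e; move: c x y.
apply: (linear_comp (face_multi bmA l _ _ _)); first lia.
by lin.
Qed.

(** Recombining the factors [l] and [l + 1] is one law of the crossed product for each kind of face:
    [iota_cp_inv] at the left end, [wactM] in the middle, [gamma_iota] at the right end. *)
Lemma hchain_face_split s l p g f : (l < s.+2)%N ->
  sw (f l) (fun x y => hchain_face s l p g (insert2 l x y f)) =
  hchain_pure s (fp s.+1 l p g) (face_g s.+1 l g) f.
Proof.
move=> hl; have ce := compat_ext (hgen_compat A P s).
case: l hl => [|l] hl.
  have lg : linear (fun z : E => hgen s (bl (gamma (f s.+1)) (br p z)) (fun i => g i.+1 ^^ f i.+1)).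
    by apply: linear_hgen; apply: (linear_comp (bl_linear _)); apply: (linear_bilinr p (ra_bilin bmE)).
  transitivity (hgen s (bl (gamma (f s.+1)) (br p (iota (g 0%N) * u (f 0%N)))) (fun i => g i.+1 ^^ f i.+1)).
    rewrite iota_cp_inv // (sw_comp _ _ _ lg); apply: sw_eq => x y.
    by rewrite /hchain_face /face_p /face_g /= -(la_ra bmE) -(ra_mul bmE).
  by rewrite /hchain_pure /face_p /face_g /= (ra_mul bmE).
have [h|h] := ltnP l.+1 s.+1.
  have [e1 e2] := face_mid (fun a => bl (iota a)) (fun p a => br p (iota a)) p g h.
  rewrite e1 e2 {e1 e2}.
  pose p' := bl (gamma (f s.+1)) (br p (u (f 0%N))).
  pose base i := merge_at l g i ^^ f i.+1.
  have lg : linear (fun z => hgen s p' (updates l z base)).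
    by apply: (compat_multi (hgen_compat _ _ _)); lia.
  transitivity (hgen s p' (updates l ((g l * g l.+1) ^^ f l.+1) base)); last first.
    apply: ce => j js; rewrite /updates /base; case: eqP => // ->.
    by rewrite /merge_at ltnn eqxx.
  rewrite wactM (sw_comp _ _ _ lg); apply: sw_eq => x y; rewrite /hchain_face.
  set F := insert2 l.+1 x y f; have FE := insert2E l.+1 x y f.
  have [-> ->] := face_mid (fun a => bl (iota a)) (fun p a => br p (iota a))
    (bl (gamma (F s.+2)) (br p (u (F 0%N)))) (fun i => g i ^^ F i.+1) h.
  have -> : F s.+2 = f s.+1 by rewrite /F FE; repeat (case: ifP => ?; try by exfalso; lia).
  apply: ce => j js; rewrite /updates /base /merge_at /F !FE.
  have [->|nj] := eqVneq j l.
    by rewrite !ltnn !eqxx; repeat (case: ifP => ?; try by exfalso; lia).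
  by repeat (case: ifP => ?; try by exfalso; lia).
have el : l = s by lia.
have [-> ->] := face_last (fun a => bl (iota a)) (fun p a => br p (iota a)) p g h.
rewrite el in hl *.
have lg : linear (fun z : E => hgen s (bl z (br p (u (f 0%N)))) (fun i => g i ^^ f i.+1)).
  by apply: linear_hgen; apply: (linear_bilinl _ (la_bilin bmE)).
transitivity (hgen s (bl (gamma (f s.+1) * iota (g s)) (br p (u (f 0%N)))) (fun i => g i ^^ f i.+1)); last first.
  by rewrite /hchain_pure /= (la_mul bmE) (la_ra bmE).
rewrite gamma_iota (sw_comp _ _ _ lg); apply: sw_eq => x y; rewrite /hchain_face.
set F := insert2 s.+1 x y f; have FE := insert2E s.+1 x y f.
have [-> ->] := face_last (fun a => bl (iota a)) (fun p a => br p (iota a))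
    (bl (gamma (F s.+2)) (br p (u (F 0%N)))) (fun i => g i ^^ F i.+1) (leqnn s.+1).
have -> : F s.+2 = y by rewrite /F FE; repeat (case: ifP => ?; try by exfalso; lia).
have e1 : F s.+1 = x by rewrite /F FE ltnn eqxx.
rewrite /= e1 -(la_mul bmE); apply: ce => j js.
by rewrite /F FE; repeat (case: ifP => ?; try by exfalso; lia).
Qed.

(** The comparison is made face by face. In degree [s + 1] the endomorphism uses one more coproduct
    factor than in degree [s], and [swf_split] takes the additional coproduct exactly where face [l]
    merges. *)
Lemma hopf_chain_d h s x : hchain h (d (s := s) x) = d (hchain h x).
Proof.
have ld t : linear (d (s := t)) := hoch_d_linear bmA t.
move: x; apply: hoch_ext => [||p g].
- exact: linear_comp (@hopf_chain_linear h s) (ld s).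
- exact: linear_comp (ld s) (@hopf_chain_linear h s.+1).
rewrite hopf_chainE (swf_comp _ _ _ _ (ld s)).
have -> : d (hgen s.+1 p g) = face_sum (fun a => bl (iota a)) (fun p a => br p (iota a)) s p g.
  exact: (hoch_dE bmA).
rewrite /face_sum (lin_sum (@hopf_chain_linear h s)).
transitivity (swf HH s.+2 h (fun f => \sum_(l < s.+2) (-1) ^+ l *: hchain_face s l p g f)); last first.
  by apply: swf_eq => f; apply: esym; apply: (hoch_dE bmA).
rewrite (swf_bigsum HH s.+2 h s.+2 (fun l => (-1) ^+ l) (fun l => hchain_face s l p g)).
apply: eq_bigr => l _; rewrite (linZ (@hopf_chain_linear h s)); congr (_ *: _).
have hl : (l < s.+2)%N := ltn_ord l.
rewrite hopf_chainE (@swf_split _ _ HH s.+1 l h _ (hchain_face s l p g)) //; last exact: hchain_face_multilin.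
by apply: swf_eq => f; rewrite hchain_face_split.
Qed.

(** On the edge [M (x)_A N] the endomorphism becomes the strict action, since in degree 0 only
    [u(h1)] and [gamma(h2)] occur. *)
Lemma hopf_chain_aug h x : hoch_aug (M := resr M) (N := resl N) (hchain h (s := 0) x) =
  hopf_act finv h (hoch_aug (M := resr M) (N := resl N) x).
Proof.
have la := @hoch_aug_linear k A (resr M) (resl N).
have lh := @hopf_act_linear k H HH A C finv hfinv M N h.
move: x; apply: (@hoch_tens_ext k A (resr M) (resl N)) => [||n m g].
- exact: linear_comp la (@hopf_chain_linear h 0).
- exact: linear_comp lh la.
rewrite hoch_augE hopf_actE // hopf_chainE /= (sw_comp _ _ _ la).
apply: sw_eq => a b; rewrite /hchain_pure /=.
have -> : br (n \ox m) (u a) = n \ox ract (u a) m by apply: (@tens_rightE k E M N).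
have -> : bl (gamma b) (n \ox ract (u a) m) = act N (gamma b) n \ox ract (u a) m by apply: (@tens_leftE k E M N).
by rewrite hoch_augE.
Qed.
End OneModule.

(** Applied to the differentials and the augmentation of [Q], this makes the endomorphisms of [h] a
    map of double complexes, compatible with the Hochschild edge. *)
Lemma hopf_chain_natural (N N' : module E) (F : N -> N') h s x : module_hom F ->
  hopf_chain finv h (hoch_map (A := A) (tlift (fun n m => F n \ox m) : bimod M N -> bimod M N') x) =
  hoch_map (tlift (fun n m => F n \ox m)) (hopf_chain finv h (s := s) x).
Proof.
move=> [lF hF]; have b : bilin (fun n (m : M) => F n \ox m) by lin.
have lt := tlift_linear b.
move: x; apply: hoch_ext => [||p g].
- exact: linear_comp (@hopf_chain_linear N' h s) (hoch_map_linear lt).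
- exact: linear_comp (hoch_map_linear lt) (@hopf_chain_linear N h s).
rewrite hoch_mapE // !hopf_chainE (swf_comp _ _ _ _ (hoch_map_linear lt)); apply: swf_eq => f.
rewrite /hchain_pure hoch_mapE //; congr (hgen _ _ _); move: p.
have ll K x := @bl_linear K x; have lr K x := @br_linear K x.
apply: tens_ext => [||n m].
- exact: linear_comp (ll _ _) (linear_comp (lr _ _) lt).
- exact: linear_comp lt (linear_comp (ll _ _) (lr _ _)).
rewrite (tliftE b).
have e1 (K : module E) (n' : K) (m' : M) x : bimod_right (n' \ox m') x = n' \ox ract x m' by apply: (@tens_rightE k E M K).
have e2 (K : module E) (n' : K) (m' : M) x : bimod_left x (n' \ox m') = act K x n' \ox m' by apply: (@tens_leftE k E M K).
by rewrite !e1 !e2 (tliftE b) hF.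
Qed.
End HopfChain.

(** * The spectral sequence *)

Section ModuleGeneralities.
Variables (k : fieldType) (R : algType k).

Lemma submodule_module (V : module R) (S : set V) : submodule S -> (forall r v, S v -> S (act V r v)) ->
  exists (b : R -> sub S -> sub S) (hb : is_module b), forall r z, val (b r z) = act V r (val z).
Proof.
move=> mS stab.
have ex (rz : R * sub S) : exists z' : sub S, val z' = act V rz.1 (val rz.2).
  by apply: (submodule_lift mS); apply: stab; apply: sub_valP.
have [b0 hb0] := choice ex; pose b r z := b0 (r, z).
have hb r z : val (b r z) = act V r (val z) by apply: (hb0 (r, z)).
exists b; have [V1 V2 V3] := act_is_module V.
suff mb : is_module b by exists mb.
split=> [|z|r s z]; last by apply: val_inj; rewrite !hb V3.
  split=> [z c r s|r c z w]; apply: val_inj; rewrite val_linear !hb.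
    exact: (bilin_fst (val z) V1).
  by rewrite val_linear; apply: (bilin_snd r V1).
by apply: val_inj; rewrite hb V2.
Qed.

Lemma over_mapr_comp (P : rmodule R) (N1 N2 N3 : module R) (f : N1 -> N2) (g : N2 -> N3) (h : N1 -> N3) :
  module_hom f -> module_hom g -> module_hom h -> (forall x, g (f x) = h x) ->
  forall x : tensor_over P N1, over_mapr g (over_mapr f x) = over_mapr h x.
Proof.
move=> hf hg hh e; have [lf ef] := over_maprP P hf; have [lg eg] := over_maprP P hg.
have [lh eh] := over_maprP P hh.
apply: tens_over_ext => [||p n]; [exact: linear_comp lg lf|exact: lh|].
by rewrite ef eg eh e.
Qed.

Lemma zero_hom (N1 N2 : module R) : module_hom (fun _ : N1 => 0 : N2).
Proof.
split; first exact: linear_zero.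
by move=> r m; rewrite (lin0 (linear_actr r (@linear_id k N2))).
Qed.

Lemma over_mapr0 (P : rmodule R) (N1 N2 : module R) (x : tensor_over P N1) :
  over_mapr (fun _ : N1 => 0 : N2) x = 0.
Proof.
have [l e] := over_maprP P (zero_hom N1 N2).
move: x; apply: tens_over_ext => [||p n]; [exact: l|exact: linear_zero|].
by rewrite e (lin0 (linear_tens_overr p (@linear_id k N2))).
Qed.

Lemma over_mapl_comp0 (P1 P2 P3 : rmodule R) (N : module R) (f : P1 -> P2) (g : P2 -> P3) :
  module_hom f -> module_hom g -> (forall x, g (f x) = 0) ->
  forall x : tensor_over P1 N, over_mapl g (over_mapl f x) = 0.
Proof.
move=> hf hg e; have [lf ef] := over_maplP N hf; have [lg eg] := over_maplP N hg.
apply: tens_over_ext => [||p n]; [exact: linear_comp lg lf|exact: linear_zero|].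
by rewrite ef eg e (lin0 (linear_tens_overl n (@linear_id k P3))).
Qed.

Lemma over_mapl_mapr (P P' : rmodule R) (N N' : module R) (f : P -> P') (g : N -> N') :
  module_hom f -> module_hom g -> forall x, over_mapl f (over_mapr g x) = over_mapr g (over_mapl f x).
Proof.
move=> hf hg; have [lf ef] := over_maplP N hf; have [lf' ef'] := over_maplP N' hf.
have [lg eg] := over_maprP P hg; have [lg' eg'] := over_maprP P' hg.
apply: tens_over_ext => [||p n]; [exact: linear_comp lf' lg|exact: linear_comp lg' lf|].
by rewrite eg ef' ef eg'.
Qed.

Lemma over_mapr_surj (P : rmodule R) (N N' : module R) (g : N -> N') : module_hom g ->
  (forall y, exists x, g x = y) -> forall u : tensor_over P N', exists v, over_mapr g v = u.
Proof.
move=> hg sg; have [lg eg] := over_maprP P hg.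
apply: tens_over_ind => [|p n]; first exact: submodule_im lg.
by have [x <-] := sg n; exists (tens_over p x); rewrite eg.
Qed.

(** Flatness applied to the exact pair formed by the zero map and [g]. *)
Lemma projective_inj (P : rmodule R) (N N' : module R) (g : N -> N') : projective P -> module_hom g ->
  (forall x, g x = 0 -> x = 0) -> forall u : tensor_over P N, over_mapr g u = 0 -> u = 0.
Proof.
move=> /projective_section[s hs] hg ig u hu.
have [y hy|v <-] := projective_flat hs (zero_hom N N) hg _ hu; first by exists 0; rewrite (ig y).
exact: over_mapr0.
Qed.

Lemma dres_dres (M : module R) (Q : resolution M) n x : dres (dres x : Q n.+1) = 0 :> Q n.
Proof. by apply/dres_exact; exists x. Qed.
Lemma aug_dres (M : module R) (Q : resolution M) x : aug (dres x : Q 0%N) = 0 :> M.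
Proof. by apply/aug_exact; exists x. Qed.
End ModuleGeneralities.

Section RestrictedSection.
Variables (k : fieldType) (H : algType k) (HH : hopf H) (A : algType k).
Variable C : crossed_product HH A.
Local Notation E := (cp_alg C : algType k).
Local Notation iota := (@cp_of_alg k H HH A C).
Local Notation gamma := (@cp_of_hopf k H HH A C).

(* E = A (x) H is free as a left A-module, so a section over E restricts to one over A. *)
Lemma restricted_section (N : module E) (sigma : N -> tensor E N) : action_section sigma ->
  exists tau : resl N -> tensor A (resl N), action_section tau.
Proof.
move=> hs; have ls := section_linear hs.
have l1 n' : linear (fun h => act N (gamma h) n' : resl N).
  exact: (@linear_actl k E N H gamma n' (@gamma_linear _ _ _ _ C)).
have l2 h : linear (fun n' : N => act N (gamma h) n' : resl N).
  exact: (@linear_actr k E N N id (gamma h) (@linear_id _ N)).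
pose phi (n' : N) (a : A) (h : H) : tensor A (resl N) := a \ox (act N (gamma h) n' : resl N).
have b1 n' : bilin (phi n') by rewrite /phi; lin.
have b2 : bilin (fun (e : E) (n' : N) => tlift (phi n') e).
  apply: bilin_intro => [n'|e]; first exact: tlift_linear.
  by apply: linear_tlift_fun => a h; rewrite /phi; lin.
exists (fun n => tlift (fun (e : E) n' => tlift (phi n') e) (sigma n)); split.
- exact: linear_tlift b2 ls.
- move=> a n; rewrite [act (resl N) a n]/(act N (iota a) n) (section_act hs); move: (sigma n).
  apply: tens_ext => [||e n'].
  + exact: linear_comp (tlift_linear b2) (free_act_linear _).
  + exact: linear_comp (free_act_linear _) (tlift_linear b2).
  rewrite free_actE !(tliftE b2); move: e; apply: cp_ext => [||b h].
  + exact: (linear_comp (tlift_linear (b1 n')) (linear_mulr (iota a) (@linear_id k E))).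
  + exact: linear_comp (free_act_linear _) (tlift_linear (b1 n')).
  by rewrite iota_mul_tens !(tliftE (b1 n')) free_actE.
move=> n; have ba := act_bilin (resl N).
rewrite (tlift_comp _ _ (tlift_linear ba)) -{2}(section_mult hs n); apply: tlift_eq => e n'.
move: e; apply: cp_ext => [||a h].
- exact: linear_comp (tlift_linear ba) (tlift_linear (b1 n')).
- exact: (@linear_actl k E N E id n' (@linear_id k E)).
rewrite (tliftE (b1 n')) (tliftE ba) -iota_gamma.
by rewrite actM.
Qed.
End RestrictedSection.

Section CrossedProductTor.
Variables (k : fieldType) (H : algType k) (HH : hopf H) (A : algType k).
Variable C : crossed_product HH A.
Variable finv : {linear tensor H H -> A}.
Hypothesis hfinv : convolution_inverse HH (cocycle C) finv.
Local Notation E := (cp_alg C : algType k).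
Variables (M : rmodule E) (N : module E).
Variables (K : resolution (trivial HH)) (Q : resolution N).
Local Notation Y j := (hopf_tensor hfinv M (Q j)).

Definition tensor_d j : tensor_over (resr M) (resl (Q j.+1)) -> tensor_over (resr M) (resl (Q j)) :=
  over_mapr (P := resr M) (N := resl (Q j.+1)) (N' := resl (Q j)) (dres (n := j)).

Lemma tensor_d_hom j : module_hom (M := Y j.+1) (N := Y j) (@tensor_d j).
Proof. exact: hopf_tensor_map_hom (dres_hom Q j). Qed.
Lemma tensor_d_linear j : linear (@tensor_d j).
Proof. exact: (tensor_d_hom j).1. Qed.

Lemma tensor_d_d j y : tensor_d (tensor_d (j := j.+1) y) = 0.
Proof.
have h1 := resl_hom (dres_hom Q j.+1); have h2 := resl_hom (dres_hom Q j).
rewrite /tensor_d (over_mapr_comp h1 h2 (zero_hom _ _) _ y) ?over_mapr0 // => x.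
exact: dres_dres.
Qed.

Definition bimod_dres j : bimod M (Q j.+1) -> bimod M (Q j) := tlift (fun n m => dres n \ox m).
Definition bimod_aug : bimod M (Q 0%N) -> bimod M N := tlift (fun n m => aug n \ox m).

Lemma bimod_dres_bilin j : bilin (fun (n : Q j.+1) (m : M) => dres n \ox m).
Proof. by have [l _] := dres_hom Q j; lin. Qed.
Lemma bimod_aug_bilin : bilin (fun (n : Q 0%N) (m : M) => aug n \ox m).
Proof. by have [l _] := aug_hom Q; lin. Qed.
Lemma bimod_dres_linear j : linear (@bimod_dres j).
Proof. exact: tlift_linear (bimod_dres_bilin j). Qed.
Lemma bimod_aug_linear : linear bimod_aug.
Proof. exact: tlift_linear bimod_aug_bilin. Qed.

Lemma bimod_map_left (N1 N2 : module E) (F : N1 -> N2) x p : module_hom F ->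
  tlift (fun n (m : M) => F n \ox m) (bimod_left x p) = bimod_left x (tlift (fun n m => F n \ox m) p).
Proof.
move=> [lF hF]; have b : bilin (fun n (m : M) => F n \ox m) by lin.
move: p; apply: tens_ext => [||n m].
- exact: linear_comp (tlift_linear b) (@bl_linear k H HH A C M N1 x).
- by move=> c p q; rewrite (tlift_linear b); apply: bl_linear.
rewrite (tliftE b).
have e2 (L : module E) (n' : L) (m' : M) : bimod_left x (n' \ox m') = act L x n' \ox m' by apply: (@tens_leftE k E M L).
by rewrite !e2 (tliftE b) hF.
Qed.

Lemma bimod_map_right (N1 N2 : module E) (F : N1 -> N2) x p : module_hom F ->
  tlift (fun n (m : M) => F n \ox m) (bimod_right p x) = bimod_right (tlift (fun n m => F n \ox m) p) x.
Proof.
move=> [lF hF]; have b : bilin (fun n (m : M) => F n \ox m) by lin.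
move: p; apply: tens_ext => [||n m].
- exact: linear_comp (tlift_linear b) (@br_linear k H HH A C M N1 x).
- by move=> c p q; rewrite (tlift_linear b); apply: br_linear.
rewrite (tliftE b).
have e2 (L : module E) (n' : L) (m' : M) : bimod_right (n' \ox m') x = n' \ox ract x m' by apply: (@tens_rightE k E M L).
by rewrite !e2 (tliftE b).
Qed.

Lemma bimod_dres_dres j p : bimod_dres (bimod_dres (j := j.+1) p) = 0.
Proof.
move: p; apply: tens_ext => [||n m].
- exact: linear_comp (@bimod_dres_linear j) (@bimod_dres_linear j.+1).
- exact: linear_zero.
rewrite /bimod_dres !(tliftE (bimod_dres_bilin _)) dres_dres.
by rewrite (lin0 (linear_tensl m (@linear_id k (Q j)))).
Qed.

Definition hoch_complex (i j : nat) : lmodType k := hoch_chain A (bimod M (Q j)) i.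
Definition hoch_dh (i j : nat) : hoch_complex i.+1 j -> hoch_complex i j := @tor_alg_d k H HH A C M (Q j) i.
Definition hoch_dv (i j : nat) : hoch_complex i j.+1 -> hoch_complex i j := hoch_map (@bimod_dres j) (s := i).

Lemma hoch_double_complex : double_complex hoch_dh hoch_dv.
Proof.
split=> i j.
- exact: (hoch_d_linear (bimod_axioms_A M (Q j)) i).
- exact: (hoch_map_linear (@bimod_dres_linear j)).
- exact: (hoch_d_d (bimod_axioms_A M (Q j))).
- move=> x; apply: (hoch_map_comp0 x (@bimod_dres_linear j.+1) (@bimod_dres_linear j)).
  exact: bimod_dres_dres.
move=> x; apply: esym.
apply: (hoch_map_d x (@bimod_dres_linear j) (bimod_axioms_A M (Q j.+1)) (bimod_axioms_A M (Q j))).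
  by move=> a p; apply: (bimod_map_left _ _ (dres_hom Q j)).
by move=> p a; apply: (bimod_map_right _ _ (dres_hom Q j)).
Qed.

Lemma hoch_rows : column_resolution hoch_dh hoch_dv tensor_d
  (fun j => @hoch_aug k A (resr M) (resl (Q j))).
Proof.
have sec j : exists tau : resl (Q j) -> tensor A (resl (Q j)), action_section tau.
  have [sigma hs] := projective_section (@res_projective _ _ _ Q j); exact: restricted_section hs.
split=> [j|j|j x|j b|j x|j x|i j x].
- exact: (@hoch_aug_linear k A (resr M) (resl (Q j))).
- exact: tensor_d_linear.
- have lm := @bimod_dres_linear j; have ly := @tensor_d_linear j.
  have la j := @hoch_aug_linear k A (resr M) (resl (Q j)).
  move: x; apply: (@hoch_tens_ext k A (resr M) (resl (Q j.+1))) => [||n m g].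
  + exact: linear_comp (la _) (hoch_map_linear lm).
  + exact: linear_comp ly (la _).
  rewrite /hoch_dv (hoch_mapE _ _ _ lm) {1}/bimod_dres (tliftE (bimod_dres_bilin j)) !hoch_augE.
  rewrite /tensor_d; have [_ e] := over_maprP (resr M) (resl_hom (dres_hom Q j)); exact/esym/e.
- exact: (@hoch_aug_surj k A (resr M) (resl (Q j)) b).
- exact: (@hoch_aug_d k A (resr M) (resl (Q j)) x).
- by have [tau ht] := sec j; apply: (@hoch_aug_exact k A (resr M) (resl (Q j)) tau ht x).
by have [tau ht] := sec j; apply: (@hoch_acyclic k A (resr M) (resl (Q j)) tau ht i x).
Qed.

Lemma hoch_columns : column_resolution (flip_dh hoch_dv) (flip_dv hoch_dh) (@tor_alg_d k H HH A C M N)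
  (fun i => hoch_map bimod_aug (s := i)).
Proof.
have lm := bimod_aug_linear.
split=> [i|i|i x|i|i x|i x|j i x].
- exact: hoch_map_linear.
- exact: (hoch_d_linear (bimod_axioms_A M N) i).
- apply: (hoch_map_d x lm (bimod_axioms_A M (Q 0%N)) (bimod_axioms_A M N)).
    by move=> a p; apply: (bimod_map_left _ _ (aug_hom Q)).
  by move=> p a; apply: (bimod_map_right _ _ (aug_hom Q)).
- apply: (hoch_map_surj lm); apply: tens_ind; first exact: submodule_im lm.
  move=> n m; have [q <-] := aug_surj Q n.
  by exists (q \ox m); rewrite /bimod_aug (tliftE bimod_aug_bilin).
- apply: (hoch_map_comp0 x (@bimod_dres_linear 0) lm); apply: tens_ext => [||n m].
  + exact: linear_comp lm (@bimod_dres_linear 0).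
  + exact: linear_zero.
  rewrite /bimod_dres (tliftE (bimod_dres_bilin 0)) /bimod_aug (tliftE bimod_aug_bilin) aug_dres.
  by rewrite (lin0 (linear_tensl m (@linear_id k N))).
- apply: (hoch_map_exact (@bimod_dres_linear 0) lm); apply: tensor_exactl.
  + exact: (dres_hom Q 0).1.
  + exact: (aug_hom Q).1.
  by move=> y /aug_exact.
apply: (hoch_map_exact (@bimod_dres_linear j.+1) (@bimod_dres_linear j)); apply: tensor_exactl.
- exact: (dres_hom Q j.+1).1.
- exact: (dres_hom Q j).1.
by move=> y /dres_exact.
Qed.

Local Notation T n := (chain_homology tensor_d n).
Local Notation tor n := (tor_alg M N n).
(** Two classes are linked when a single total cycle of [hoch_complex] has both as its edge
    classes. *)
Definition tor_rel n : tor n -> T n -> Prop :=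
  @edge_rel k hoch_complex hoch_dh hoch_dv _ (@tor_alg_d k H HH A C M N) (fun i => hoch_map bimod_aug (s := i))
    _ tensor_d (fun j => @hoch_aug k A (resr M) (resl (Q j))) n.
Let dcH := hoch_double_complex.

Lemma tor_rel_linear n : linear_rel (@tor_rel n).
Proof. exact: (edge_rel_linear dcH hoch_columns hoch_rows). Qed.
Lemma tor_rel_total n t : exists w, @tor_rel n t w.
Proof. exact: (edge_rel_total dcH hoch_columns hoch_rows). Qed.
Lemma tor_rel_surj n w : exists t, @tor_rel n t w.
Proof. exact: (edge_rel_surj dcH hoch_columns hoch_rows). Qed.
Lemma tor_rel_inj n t w t' : @tor_rel n t w -> @tor_rel n t' w -> t = t'.
Proof.
move=> h h'; apply/eqP; rewrite -subr_eq0; apply/eqP.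
apply: (edge_rel_inj dcH hoch_columns hoch_rows); rewrite -(subrr w).
exact: (linear_relB (tor_rel_linear n)).
Qed.
Lemma tor_rel_fun n t w w' : @tor_rel n t w -> @tor_rel n t w' -> w = w'.
Proof.
move=> h h'; apply/eqP; rewrite -subr_eq0; apply/eqP.
apply: (edge_rel_fun dcH hoch_columns hoch_rows); rewrite -(subrr t).
exact: (linear_relB (tor_rel_linear n)).
Qed.

Definition tensor_cycles n : set (tensor_over (resr M) (resl (Q n))) := [set y | d_out tensor_d (n := n) y = 0].
Arguments tensor_cycles : clear implicits.
Lemma tensor_cycles_submodule n : submodule (tensor_cycles n).
Proof. exact: (d_out_submodule tensor_d_linear). Qed.

Lemma hact_cycle n h y : tensor_cycles n y -> tensor_cycles n (act (Y n) h y).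
Proof.
case: n y => // n y; rewrite /tensor_cycles /= => hy.
have [_ e] := tensor_d_hom n; have := e h y; rewrite /= hy => ->.
exact: lin0 (hopf_act_linear hfinv h).
Qed.

Definition homology_class n (z : sub (tensor_cycles n)) : T n := \pi_(T n) z.
Lemma homology_class_linear n : linear (@homology_class n).
Proof. exact: pi_linear. Qed.

Lemma tor_rel_act n h (t t' : tor n) (z z' : sub (tensor_cycles n)) :
  tor_rel t (homology_class z) -> homology_graph (hopf_chain finv h) t t' ->
  val z' = act (Y n) h (val z) -> tor_rel t' (homology_class z').
Proof.
move=> r ht hz; apply: (edge_rel_equivariant dcH hoch_columns hoch_rows
  (fX := fun i j => @hopf_chain k H HH A C M (Q j) finv h i)
  (fA := @hopf_chain k H HH A C M N finv h) (fB := fun j => hopf_act finv h) _ _ _ _ _ _ _ r ht).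
- by move=> i j; apply: hopf_chain_linear.
- by move=> i; apply: hopf_chain_linear.
- by move=> j; apply: (hopf_act_linear hfinv).
- by move=> i j x; apply: (hopf_chain_d hfinv).
- by move=> i j x; apply: hopf_chain_natural; apply: dres_hom.
- by move=> i x; apply: hopf_chain_natural; apply: aug_hom.
- by move=> j x; apply: esym; apply: (hopf_chain_aug hfinv).
by exists z, z'.
Qed.

(* Tor^A(M, N) computed from M (x)_A Q is matched here with H(A, N (x) M). *)
Definition cycle_class n : sub (tensor_cycles n) -> tor n := projT1 (choice (fun z => tor_rel_surj (homology_class z))).
Lemma cycle_classP n z : tor_rel (@cycle_class n z) (homology_class z).
Proof. by rewrite /cycle_class; case: choice => p hp /=. Qed.

Lemma cycle_class_linear n : linear (@cycle_class n).
Proof.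
move=> c z w; apply: tor_rel_inj (cycle_classP _) _; rewrite homology_class_linear.
by apply: (tor_rel_linear n).2; apply: cycle_classP.
Qed.

Lemma cycle_class_surj n t : exists z, @cycle_class n z = t.
Proof.
have [w hw] := tor_rel_total t; exists (repr w); apply: tor_rel_inj (cycle_classP _) _.
by rewrite /homology_class reprK.
Qed.

Lemma cycle_class_eq0 n z : @cycle_class n z = 0 <-> exists y, tensor_d (j := n) y = val z.
Proof.
rewrite -(homology_eq0 tensor_d_linear); split=> h.
  by have := cycle_classP z; rewrite h => h0; apply: tor_rel_fun h0 (tor_rel_linear n).1.
by have := cycle_classP z; rewrite [homology_class z]h => h0; apply: tor_rel_inj h0 (tor_rel_linear n).1.
Qed.

Lemma cycles_act_exists n : exists (b : H -> sub (tensor_cycles n) -> sub (tensor_cycles n)) (hb : is_module b),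
  forall h z, val (b h z) = act (Y n) h (val z).
Proof. exact: (submodule_module (V := Y n) (tensor_cycles_submodule n) (@hact_cycle n)). Qed.

Definition cycles_act n := projT1 (cid (cycles_act_exists n)).
Lemma cycles_act_val n h z : val (@cycles_act n h z) = act (Y n) h (val z).
Proof. by rewrite /cycles_act; case: cid => b [hb e]; apply: e. Qed.
Lemma cycles_act_module n : is_module (@cycles_act n).
Proof. by rewrite /cycles_act; case: cid => b [hb e]; apply: hb. Qed.
Definition cycles_module n : module H := Module (cycles_act_module n).

(** Transport of structure: a class is represented by a cycle of [M (x)_A Q], on which [H] acts
    strictly. Independence of the chosen cycle is [tor_act_cycle_class]. *)
Definition tor_act n (h : H) (t : tor n) : tor n := cycle_class (cycles_act h (projT1 (cid (cycle_class_surj t)))).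

Lemma tor_act_cycle_class n h (z : cycles_module n) : tor_act h (cycle_class z) = cycle_class (act (cycles_module n) h z).
Proof.
rewrite /tor_act; case: cid => w /= e; apply/eqP; rewrite -subr_eq0 -(linB (@cycle_class_linear n)); apply/eqP/cycle_class_eq0.
have /cycle_class_eq0[y hy] : cycle_class (w - z) = 0 by rewrite (linB (@cycle_class_linear n)) e subrr.
have [_ ed] := tensor_d_hom n; exists (act (Y n.+1) h y).
rewrite ed hy !(linB (@val_linear _ _ _)) !cycles_act_val.
exact: linB (hopf_act_linear hfinv h) _ _.
Qed.

Lemma tor_act_module n : is_module (@tor_act n).
Proof.
have lp := @cycle_class_linear n; have [b m1 mM] := act_is_module (cycles_module n).
split; last 2 first.
- by move=> t; have [z <-] := cycle_class_surj t; rewrite (tor_act_cycle_class 1 z) m1.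
- by move=> r s t; have [z <-] := cycle_class_surj t; rewrite (tor_act_cycle_class (r * s) z) mM !(tor_act_cycle_class _ _).
apply: bilin_intro => [t|h] c x y.
  have [z <-] := cycle_class_surj t; rewrite !(tor_act_cycle_class _ z) (bilin_fst z b); exact: lp.
have [z <-] := cycle_class_surj x; have [w <-] := cycle_class_surj y.
rewrite -lp !(tor_act_cycle_class h _) (bilin_snd h b); exact: lp.
Qed.

(** The transported image of a class and the one induced by [hopf_chain] are both linked by
    [tor_rel] to the same class of [M (x)_A Q], hence they are equal. *)
Lemma tor_act_induced n : induced_action finv (@tor_act n).
Proof.
move=> h z.
have [z' hz' g] := homology_graph_total (hoch_d_linear (bimod_axioms_A M N)) (phi := @hopf_chain k H HH A C M N finv h)
  (@hopf_chain_linear k H HH A C finv M N h) (hopf_chain_d hfinv h) z.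
exists z' => //; have [w hw] := cycle_class_surj (\pi_(tor n) z); rewrite -hw (tor_act_cycle_class h w).
have hr : tor_rel (\pi_(tor n) z) (homology_class w) by rewrite -hw; apply: cycle_classP.
apply: tor_rel_inj (cycle_classP _) _; apply: tor_rel_act hr g _; exact: cycles_act_val.
Qed.

Definition tor_module n : module H := Module (tor_act_module n).

Definition cycle_class_map n : cycles_module n -> tor_module n := @cycle_class n.
Lemma cycle_class_hom n : module_hom (@cycle_class_map n).
Proof. by split=> [|h z]; [apply: cycle_class_linear | apply: esym; apply: tor_act_cycle_class]. Qed.

Definition cycles_incl n (z : cycles_module n) : Y n := val z.
Lemma cycles_incl_hom n : module_hom (@cycles_incl n).
Proof. by split; [apply: val_linear | apply: cycles_act_val]. Qed.
Lemma cycles_incl_eq0 n z : @cycles_incl n z = 0 -> z = 0.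
Proof. by move=> h; apply: val_inj. Qed.

Lemma boundary_hom n : exists2 dZ : Y n.+1 -> cycles_module n, module_hom dZ & forall y, cycles_incl (dZ y) = tensor_d y.
Proof.
have ex (y : Y n.+1) : exists z : cycles_module n, cycles_incl z = tensor_d y.
  apply: (submodule_lift (tensor_cycles_submodule n)).
  by case: n y => // n y; apply: tensor_d_d.
have [dZ e] := choice ex; exists dZ => //; have [ly ay] := tensor_d_hom n; have [li ai] := cycles_incl_hom n.
split=> [c x y|h y]; apply: val_inj.
  by rewrite -[LHS]/(cycles_incl _) -[RHS]/(cycles_incl _) li !e ly.
by rewrite -[LHS]/(cycles_incl _) -[RHS]/(cycles_incl _) ai !e ay.
Qed.

Lemma d_out_hom n : module_hom (M := Y n) (N := Y n.-1) (d_out tensor_d (n := n)).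
Proof. by case: n => [|n]; [apply: zero_hom | apply: tensor_d_hom]. Qed.

Lemma d_out_exact n (y : Y n) : d_out tensor_d y = 0 -> exists z, cycles_incl z = y.
Proof. exact: (submodule_lift (tensor_cycles_submodule n)). Qed.

Definition mixed (i j : nat) : lmodType k := tensor_over (K i) (Y j).
Definition mixed_dh (i j : nat) : mixed i.+1 j -> mixed i j := over_mapl (N := Y j) (dres (r := K) (n := i)).
Definition mixed_dv (i j : nat) : mixed i j.+1 -> mixed i j := over_mapr (P := K i) (N := Y j.+1) (N' := Y j) (@tensor_d j).

Lemma mixed_double_complex : double_complex mixed_dh mixed_dv.
Proof.
split=> i j.
- exact: (over_maplP (Y j) (dres_hom K i)).1.
- exact: (over_maprP (K i) (tensor_d_hom j)).1.
- by apply: over_mapl_comp0 (dres_hom K i.+1) (dres_hom K i) _ => x; apply: dres_dres.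
- move=> x; rewrite /mixed_dv (over_mapr_comp (tensor_d_hom j.+1) (tensor_d_hom j) (zero_hom _ _)) ?over_mapr0 //.
  exact: tensor_d_d.
exact: (over_mapl_mapr (dres_hom K i) (tensor_d_hom j)).
Qed.

Lemma mixed_columns : column_resolution mixed_dh mixed_dv
  (fun j => over_mapr (P := M) (N := Q j.+1) (N' := Q j) (dres (n := j)))
  (fun j => hopf_augment (hfinv := hfinv) (M := M) (N := Q j) (aug (r := K))).
Proof.
have sec j : exists theta : Y j -> tensor H (Y j), action_section theta.
  have [sigma hs] := projective_section (@res_projective _ _ _ Q j).
  by eexists; apply: (theta_section hfinv M hs).
split=> [j|j|j x|j b|j x|j x hx|i j x].
- exact: augment_linear (aug_hom K).
- exact: (over_maprP M (dres_hom Q j)).1.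
- exact: (augment_natural (dres_hom Q j) (aug_hom K)).
- exact: (augment_surj hfinv (aug_hom K) (aug_surj K)).
- by apply: (augment_comp (aug_hom K) (dres_hom K 0)) => y; apply: aug_dres.
- have [th hth] := sec j.
  apply: (projective_flatl hth (dres_hom K 0) (aug_hom K)); first by move=> y /aug_exact.
  by rewrite -(unaugmentK (aug_hom K)) hx; apply: lin0; apply: unaugment_linear.
have [th hth] := sec j.
by apply: (projective_flatl hth (dres_hom K i.+1) (dres_hom K i)) => y /dres_exact.
Qed.

Definition page1 (p q : nat) : lmodType k := tensor_over (K p) (tor_module q).
Definition page1_d (p q : nat) : page1 p.+1 q -> page1 p q := over_mapl (N := tor_module q) (dres (r := K) (n := p)).

(* As K p is projective, K p (x)_H Z_q is the space of cycles of mixed p * in degree q. *)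
Definition page1_rel p q (x : mixed p q) (u : page1 p q) : Prop :=
  exists2 z : tensor_over (K p) (cycles_module q), over_mapr (@cycles_incl q) z = x
    & over_mapr (@cycle_class_map q) z = u.

Lemma mixed_d_out p q (x : mixed p q) : d_out (@mixed_dv p) x = over_mapr (N := Y q) (N' := Y q.-1) (d_out tensor_d (n := q)) x.
Proof. by case: q x => //= x; rewrite over_mapr0. Qed.

(** Write [Z_q] for the cycles of [Y q]. Tensoring with the projective [K p] is applied to
    [Z_q -> Y_q -> Y_{q-1}] to lift vertical cycles, to [Y_{q+1} -> Z_q -> tor_q] to recognize
    boundaries, and to the inclusion of [Z_q] to make the lift unique. *)
Lemma page2_iso p q : linear_iso (page (column_ss mixed_double_complex) 2 p%:Z q%:Z) (Tor_left K (tor_module q) p).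
Proof.
have li p' q' := (over_maprP (K p') (cycles_incl_hom q')).1; have lp p' q' := (over_maprP (K p') (cycle_class_hom q')).1.
apply: (column_page2 mixed_double_complex (dU := page1_d) (R := page1_rel)) => {p q}.
- by move=> p q; apply: (over_maplP (tor_module q) (dres_hom K p)).1.
- move=> p q; split=> [|c x x' u u' [z <- <-] [z' <- <-]].
    by exists 0; [apply: lin0 (li p q) | apply: lin0 (lp p q)].
  by exists (c *: z + z'); [apply: li | apply: lp].
- move=> p q x; rewrite mixed_d_out => hx; have [s hs] := projective_section (@res_projective _ _ _ K p).
  have [z hz] := projective_flat hs (cycles_incl_hom q) (d_out_hom q) (@d_out_exact q) hx.
  by exists (over_mapr (@cycle_class_map q) z), z.
- move=> p q u; have [z hz] := over_mapr_surj (P := K p) (cycle_class_hom q) (@cycle_class_surj q) u.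
  by exists (over_mapr (@cycles_incl q) z), z.
- move=> p q x u [z <- _]; rewrite mixed_d_out.
  rewrite (over_mapr_comp (cycles_incl_hom q) (d_out_hom q) (zero_hom _ _)) ?over_mapr0 // => y.
  exact: (sub_valP (tensor_cycles_submodule q)).
- move=> p q x u [z <- <-]; have [dZ hZ eZ] := boundary_hom q.
  have eX c : over_mapr (@cycles_incl q) (over_mapr dZ c) = mixed_dv (i := p) c.
    exact: (over_mapr_comp hZ (cycles_incl_hom q) (tensor_d_hom q) eZ).
  split=> [hz|[c hc]].
    have [s hs] := projective_section (@res_projective _ _ _ K p).
    have [|c hc] := projective_flat hs hZ (cycle_class_hom q) _ hz; last by exists c; rewrite -hc eX.
    by move=> y /cycle_class_eq0[w hw]; exists w; apply: val_inj; rewrite -hw; apply: eZ.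
  have -> : z = over_mapr dZ c.
    apply/eqP; rewrite -subr_eq0; apply/eqP.
    apply: (projective_inj (@res_projective _ _ _ K p) (cycles_incl_hom q) (@cycles_incl_eq0 q)).
    by rewrite (linB (li p q)) eX hc subrr.
  rewrite (over_mapr_comp hZ (cycle_class_hom q) (zero_hom _ _)) ?over_mapr0 // => y.
  by apply/cycle_class_eq0; exists y; rewrite -eZ.
move=> p q x u [z <- <-]; exists (over_mapl (dres (n := p)) z).
  by rewrite /mixed_dh (over_mapl_mapr (dres_hom K p) (cycles_incl_hom q)).
by rewrite /page1_d (over_mapl_mapr (dres_hom K p) (cycle_class_hom q)).
Qed.

End CrossedProductTor.

Theorem mainTheorem17 (k : fieldType) (H : algType k) (HH : hopf H)
    (A : algType k) (C : crossed_product HH A)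
    (finv : {linear tensor H H -> A})
    (hfinv : convolution_inverse HH (cocycle C) finv)
    (M : rmodule (cp_alg C)) (N : module (cp_alg C))
    (K : resolution (trivial HH)) (Q : resolution N) :
  exists (a : forall s : nat, H -> tor_alg M N s -> tor_alg M N s)
         (ha : forall s : nat, is_module (a s)),
    (forall s : nat, induced_action finv (a s)) /\
    exists S : spectral_sequence k,
      [/\ forall r s : nat,
            linear_iso (page S 2 r s) (Tor_left K (Module (ha s)) r),
          first_quadrant S
        & converges_to S (Tor_right M Q)].
Proof.
exists (@tor_act k H HH A C finv hfinv M N Q), (@tor_act_module k H HH A C finv hfinv M N Q).
split=> [s|]; first exact: tor_act_induced.
exists (column_ss (mixed_double_complex hfinv M K Q)); split.
- by move=> r s; apply: page2_iso.
- exact: column_ss_first_quadrant.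
exact: column_ss_converges (mixed_columns hfinv M K Q).
Qed.
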